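(* Let $\mathfrak{o}$ be the ring of integers in a local field $F$ of characteristic zero with residue field of characteristic $p>0$, let $G$ be a finite group with commutator subgroup $G'$, let $\Lambda := \mathfrak{o}[G]$, and let $\Lambda'$ be a maximal $\mathfrak{o}$-order in $F[G]$ containing $\Lambda$. Put $\mathrm{Tr}_{G'} := \sum_{g'\in G'}g'$, $e := |G'|^{-1}\mathrm{Tr}_{G'}$ and $\Lambda'(G,G') := \mathfrak{o}[G]e\oplus\Lambda'(1-e)$. Then, with $\chi_i$, $\mathfrak{o}_i'$ ($1\le i\le k$) as defined in the context, $$\mathcal{F}(\Lambda'(G,G'),\Lambda) = \mathfrak{o}[G]\cdot\mathrm{Tr}_{G'}\oplus\mathcal{F}(\Lambda',\Lambda)(1-e) = \mathfrak{o}[G]\cdot\mathrm{Tr}_{G'}\oplus\bigoplus_{\substack{1\le i\le k\\ \chi_i(1)\ne1}}\frac{|G|}{\chi_i(1)}\mathfrak{D}^{-1}(\mathfrak{o}_i'/\mathfrak{o}).$$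
   Context: $\zeta(\cdot)$ denotes the centre of a ring. For orders $\Lambda\subset\Gamma$ in $F[G]$, the central conductor is $\mathcal{F}(\Gamma,\Lambda) := \{x\in\zeta(\Gamma)\mid x\Gamma\subset\Lambda\}$. Let $\overline{F}$ be an algebraic closure of $F$ and let $\chi_1,\dots,\chi_k$ be representatives of the irreducible $\overline{F}$-valued characters of $G$ modulo the action of $\mathrm{Gal}(\overline{F}/F)$. Let $F_i := F(\chi_i(g)\mid g\in G)$ and let $\mathfrak{o}_i'$ be its ring of integers. There are natural identifications $\zeta(F[G])\simeq\bigoplus_{i=1}^kF_i$ and $\zeta(\Lambda')\simeq\bigoplus_{i=1}^k\mathfrak{o}_i'$, where $\alpha_i\in F_i$ corresponds to $\sum_{\sigma\in\mathrm{Gal}(F_i/F)}\alpha_i^\sigma\frac{\chi_i(1)}{|G|}\sum_{g\in G}\chi_i^\sigma(g^{-1})g$. Finally $\mathfrak{D}^{-1}(\mathfrak{o}_i'/\mathfrak{o}) := \{x\in F_i\mid\mathrm{Tr}_{F_i/F}(x\mathfrak{o}_i')\subset\mathfrak{o}\}$ is the inverse different. *)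

(* Defs.v *)
From HB Require Import structures.
From mathcomp Require Import all_boot all_order all_algebra all_fingroup.
From mathcomp Require Import all_solvable all_character.
From mathcomp Require Import all_classical.

Set Implicit Arguments.
Unset Strict Implicit.
Unset Printing Implicit Defensive.

Import Order.TTheory GRing.Theory Num.Theory.
Local Open Scope classical_set_scope.
Local Open Scope ring_scope.

(* [val_ge v n x] is "v x >= n" with the convention v 0 = +oo; the value that
   the function [v : F -> int] takes at 0 is never used. *)
Definition val_ge (F : fieldType) (v : F -> int) (n : int) : {pred F} :=
  fun x => (x == 0) || (n <= v x).

(* A field of characteristic zero, complete for a normalized discrete
   valuation, with finite residue field of characteristic p.  The residue field
   is {v >= 0} / {v >= 1}: [lf_residue_fin] lists representatives of its
   elements, and [lf_residue_char] says that the prime p vanishes in it. *)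
Record local_field (F : fieldType) (p : nat) := LocalField {
  lf_val : F -> int;
  lf_valM : forall x y, x != 0 -> y != 0 -> lf_val (x * y) = lf_val x + lf_val y;
  lf_valD : forall n x y, x \in val_ge lf_val n -> y \in val_ge lf_val n ->
    x + y \in val_ge lf_val n;
  lf_val_norm : exists2 x, x != 0 & lf_val x = 1;
  lf_complete : forall u : nat -> F,
    (forall n : nat, exists N : nat, forall i j : nat,
        (N <= i)%N -> (N <= j)%N -> u i - u j \in val_ge lf_val n%:Z) ->
    exists l : F, forall n : nat, exists N : nat, forall i : nat,
        (N <= i)%N -> u i - l \in val_ge lf_val n%:Z;
  lf_residue_fin : exists s : seq F, forall x, x \in val_ge lf_val 0 ->
    exists2 y, y \in s & x - y \in val_ge lf_val 1;
  lf_residue_char : prime p /\ (p%:R : F) \in val_ge lf_val 1;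
  lf_char0 : [pchar F] =i pred0
}.

Definition integers (F : fieldType) (p : nat) (hF : local_field F p) :
  {pred F} := val_ge (lf_val hF) 0.

(* Functions on the group, multiplied by convolution; the library does not put
   a canonical ring structure on [{ffun gT -> R}]. *)
Definition galg (R : comNzRingType) (gT : finGroupType) := {ffun gT -> R}.

Section GroupAlgebra.
Variables (R : comNzRingType) (gT : finGroupType).
Local Notation A := (galg R gT).
Implicit Types a b c : A.

HB.instance Definition _ := GRing.Zmodule.on A.

Definition gcoef (a : A) (g : gT) : R := (a : {ffun gT -> R}) g.

Definition galg_of (g : gT) : A := [ffun h => (h == g)%:R].

Definition galg_mul a b : A :=
  [ffun g => \sum_h gcoef a h * gcoef b (h^-1 * g)%g].

Definition galg_scale (r : R) a : A := [ffun g => r * gcoef a g].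

Lemma galgP a b : (forall g, gcoef a g = gcoef b g) -> a = b.
Proof. by move=> ab; apply/ffunP. Qed.

Lemma gcoefD a b g : gcoef (a + b) g = gcoef a g + gcoef b g.
Proof. by rewrite /gcoef ffunE. Qed.

Lemma gcoefM a b g :
  gcoef (galg_mul a b) g = \sum_h gcoef a h * gcoef b (h^-1 * g)%g.
Proof. by rewrite /gcoef ffunE. Qed.

Lemma gcoef_scale r a g : gcoef (galg_scale r a) g = r * gcoef a g.
Proof. by rewrite /gcoef ffunE. Qed.

Lemma gcoef_of h g : gcoef (galg_of h) g = (g == h)%:R.
Proof. by rewrite /gcoef ffunE. Qed.

Lemma galg_mulA : associative galg_mul.
Proof.
move=> a b c; apply: galgP => g; rewrite !gcoefM.
under eq_bigr do rewrite gcoefM mulr_sumr.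
under [RHS]eq_bigr do rewrite gcoefM mulr_suml.
rewrite [RHS]exchange_big /=; apply: eq_bigr => h _.
rewrite (reindex_inj (mulgI h^-1%g)) /=; apply: eq_bigr => k _.
by rewrite mulrA invMg invgK -!mulgA mulKVg.
Qed.

Lemma galg_mul1l : left_id (galg_of 1%g) galg_mul.
Proof.
move=> a; apply: galgP => g; rewrite gcoefM (bigD1 1%g) //= big1 ?addr0.
  by rewrite gcoef_of eqxx mul1r invg1 mul1g.
by move=> h /negbTE hn; rewrite gcoef_of hn mul0r.
Qed.

Lemma galg_mul1r : right_id (galg_of 1%g) galg_mul.
Proof.
move=> a; apply: galgP => g; rewrite gcoefM (bigD1 g) //= big1 ?addr0.
  by rewrite gcoef_of mulVg eqxx mulr1.
move=> h /negbTE hn; rewrite gcoef_of -eq_mulVg1 hn mulr0 //.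
Qed.

Lemma galg_mulDl : left_distributive galg_mul +%R.
Proof.
move=> a b c; apply: galgP => g; rewrite gcoefD !gcoefM -big_split /=.
by apply: eq_bigr => h _; rewrite gcoefD mulrDl.
Qed.

Lemma galg_mulDr : right_distributive galg_mul +%R.
Proof.
move=> a b c; apply: galgP => g; rewrite gcoefD !gcoefM -big_split /=.
by apply: eq_bigr => h _; rewrite gcoefD mulrDr.
Qed.

Lemma galg_1neq0 : galg_of 1%g != 0.
Proof.
apply/eqP => /(congr1 (fun a : A => gcoef a 1%g)).
by rewrite gcoef_of eqxx /gcoef ffunE => /eqP; rewrite oner_eq0.
Qed.

HB.instance Definition _ := GRing.Zmodule_isNzRing.Build A
  galg_mulA galg_mul1l galg_mul1r galg_mulDl galg_mulDr galg_1neq0.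

Lemma galg_scaleA r s a :
  galg_scale r (galg_scale s a) = galg_scale (r * s) a.
Proof. by apply: galgP => g; rewrite !gcoef_scale mulrA. Qed.

Lemma galg_scale1 : left_id 1 galg_scale.
Proof. by move=> a; apply: galgP => g; rewrite gcoef_scale mul1r. Qed.

Lemma galg_scaleDr : right_distributive galg_scale +%R.
Proof.
by move=> r a b; apply: galgP => g; rewrite gcoefD !gcoef_scale gcoefD mulrDr.
Qed.

Lemma galg_scaleDl a : {morph galg_scale^~ a : r s / r + s}.
Proof.
by move=> r s; apply: galgP => g; rewrite gcoefD !gcoef_scale mulrDl.
Qed.

HB.instance Definition _ := GRing.Zmodule_isLmodule.Build R A
  galg_scaleA galg_scale1 galg_scaleDr galg_scaleDl.

Lemma galg_scaleAl (r : R) a b : r *: (a * b) = r *: a * b.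
Proof.
apply: galgP => g; rewrite gcoef_scale !gcoefM mulr_sumr.
by apply: eq_bigr => h _; rewrite gcoef_scale mulrA.
Qed.

HB.instance Definition _ := GRing.Lmodule_isLalgebra.Build R A galg_scaleAl.

Lemma galg_scaleAr (r : R) a b : r *: (a * b) = a * (r *: b).
Proof.
apply: galgP => g; rewrite gcoef_scale !gcoefM mulr_sumr.
by apply: eq_bigr => h _; rewrite gcoef_scale mulrCA.
Qed.

HB.instance Definition _ := GRing.Lalgebra_isAlgebra.Build R A galg_scaleAr.

End GroupAlgebra.

Definition galg_map (R S : comNzRingType) (gT : finGroupType) (f : R -> S)
  (a : galg R gT) : galg S gT := [ffun g => f (gcoef a g)].

Section Orders.
Variables (F : fieldType) (o : {pred F}) (A : algType F).
Implicit Types Gam Lam : set A.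

Definition is_subring Gam : Prop :=
  [/\ Gam 1, forall x y, Gam x -> Gam y -> Gam (x - y) &
      forall x y, Gam x -> Gam y -> Gam (x * y)].

(* The last two conditions: Gam is a finitely generated o-module, and
   F Gam = A. *)
Definition is_order Gam : Prop :=
  [/\ is_subring Gam,
      exists (n : nat) (s : 'I_n -> A), Gam =
        [set x | exists2 c : 'I_n -> F, forall j, c j \in o &
                   x = \sum_j c j *: s j] &
      forall x : A, exists (n : nat) (c : 'I_n -> F) (s : 'I_n -> A),
        (forall j, Gam (s j)) /\ x = \sum_j c j *: s j].

Definition is_maximal_order Gam : Prop :=
  is_order Gam /\ forall Del, is_order Del -> Gam `<=` Del -> Del = Gam.

Definition center_of Gam : set A :=
  [set x | Gam x /\ forall y, Gam y -> x * y = y * x].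

Definition central_conductor Gam Lam : set A :=
  [set x | center_of Gam x /\ forall y, Gam y -> Lam (x * y)].

End Orders.

Definition set_add (V : zmodType) (A B : set V) : set V :=
  [set a + b | a in A & b in B].

Definition set_mulr (A : nzRingType) (X : set A) (y : A) : set A :=
  [set x * y | x in X].

Definition set_sum (V : zmodType) (I : finType) (P : pred I) (A : I -> set V) :
  set V :=
  [set z | exists2 x : I -> V, forall i, P i -> A i (x i) &
             z = \sum_(i | P i) x i].

(* For additive subgroups, uniqueness of the decomposition of 0 is directness. *)
Definition direct_add (V : zmodType) (A B : set V) : Prop :=
  forall a b, A a -> B b -> a + b = 0 -> a = 0 /\ b = 0.

Definition direct_sum (V : zmodType) (I : finType) (P : pred I)
  (A : I -> set V) : Prop :=
  forall x : I -> V, (forall i, P i -> A i (x i)) ->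
    \sum_(i | P i) x i = 0 -> forall i, P i -> x i = 0.

Definition is_alg_closure (F : fieldType) (Fbar : closedFieldType)
  (iota : {rmorphism F -> Fbar}) : Prop :=
  forall x : Fbar, algebraicOver iota x.

Definition irr_character (K : fieldType) (gT : finGroupType) (chi : gT -> K) :
  Prop :=
  exists (n : nat) (rG : mx_representation K [set: gT]%G n),
    mx_irreducible rG /\ forall g, chi g = \tr (rG g).

Definition absolute_galois (F : fieldType) (Fbar : closedFieldType)
  (iota : {rmorphism F -> Fbar}) (s : {rmorphism Fbar -> Fbar}) : Prop :=
  bijective s /\ forall a, s (iota a) = iota a.

(* The chi i represent the orbits of the absolute Galois group on the
   irreducible characters, each orbit once. *)
Definition character_representatives (F : fieldType) (Fbar : closedFieldType)
  (iota : {rmorphism F -> Fbar}) (gT : finGroupType) (k : nat)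
  (chi : 'I_k -> gT -> Fbar) : Prop :=
  (forall i, irr_character (chi i)) /\
  forall psi : gT -> Fbar, irr_character psi ->
    exists! i : 'I_k, exists2 s : {rmorphism Fbar -> Fbar},
      absolute_galois iota s & forall g, psi g = s (chi i g).

Section ValueField.
Variables (F : fieldType) (Fbar : closedFieldType).
Variables (iota : {rmorphism F -> Fbar}) (gT : finGroupType) (chi : gT -> Fbar).

(* The smallest subfield of Fbar that contains F and the values of chi. *)
Definition in_value_field : {pred Fbar} :=
  fun x => `[< forall S : {pred Fbar}, divring_closed S ->
                 (forall a, iota a \in S) -> (forall g, chi g \in S) ->
                 x \in S >].

Lemma in_value_fieldP x :
  reflect (forall S : {pred Fbar}, divring_closed S ->
             (forall a, iota a \in S) -> (forall g, chi g \in S) -> x \in S)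
          (x \in in_value_field).
Proof. exact: asboolP. Qed.

Lemma in_value_field_divring : divring_closed in_value_field.
Proof.
split=> [|x y|x y].
- by apply/in_value_fieldP => S [].
- move=> /in_value_fieldP xS /in_value_fieldP yS; apply/in_value_fieldP.
  by move=> S SR SF Schi; case: (SR) => _ SB _; apply: SB; [apply: xS|apply: yS].
- move=> /in_value_fieldP xS /in_value_fieldP yS; apply/in_value_fieldP.
  by move=> S SR SF Schi; case: (SR) => _ _ SV; apply: SV; [apply: xS|apply: yS].
Qed.

HB.instance Definition _ :=
  GRing.isDivringClosed.Build Fbar in_value_field in_value_field_divring.

Definition value_field := {x : Fbar | x \in in_value_field}.

HB.instance Definition _ := SubType.on value_field.
HB.instance Definition _ := Choice.on value_field.
HB.instance Definition _ := [SubChoice_isSubIntegralDomain of value_field by <:].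
HB.instance Definition _ := [SubIntegralDomain_isSubField of value_field by <:].

Lemma iota_in_value_field a : iota a \in in_value_field.
Proof. by apply/in_value_fieldP => S _ SF _; apply: SF. Qed.

Lemma chi_in_value_field g : chi g \in in_value_field.
Proof. by apply/in_value_fieldP => S _ _; apply. Qed.

Definition vf_incl (a : F) : value_field := Sub (iota a) (iota_in_value_field a).

Definition vf_chi (g : gT) : value_field := Sub (chi g) (chi_in_value_field g).

Definition vf_gal : set (value_field -> value_field) :=
  [set s | [/\ zmod_morphism s, monoid_morphism s, bijective s &
               forall a, s (vf_incl a) = vf_incl a]].

(* F(chi) / F is abelian, so that the trace is the sum over the Galois group.
   As this group is finite, the finitely supported sum is the plain sum. *)
Definition vf_trace (x : value_field) : value_field := \sum_(s \in vf_gal) s x.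

(* The ring of integers of F(chi): the integral closure of o. *)
Definition vf_integers (o : {pred F}) : set value_field :=
  [set x | exists p : {poly F},
     [/\ p \is monic, p \is a polyOver o & root (map_poly vf_incl p) x]].

Definition inverse_different (o : {pred F}) : set value_field :=
  [set x | forall y, vf_integers o y ->
             exists2 a, a \in o & vf_trace (x * y) = vf_incl a].

(* The image of [alpha] in the group algebra: its coefficients lie in F, but the
   formula is evaluated over F(chi). *)
Definition vf_central (alpha : value_field) : galg value_field gT :=
  \sum_(s \in vf_gal)
    (s alpha * (vf_chi 1%g / #|gT|%:R)) *:
      \sum_(g : gT) s (vf_chi g^-1%g) *: galg_of value_field g.

(* The subset of F[G] that corresponds to a subset X of F(chi). *)
Definition central_image (X : set value_field) : set (galg F gT) :=
  [set z | exists2 alpha, X alpha & galg_map vf_incl z = vf_central alpha].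

Definition scaled_inverse_different (o : {pred F}) : set value_field :=
  [set #|gT|%:R / vf_chi 1%g * x | x in inverse_different o].

End ValueField.

Section GroupRing.
Variables (F : fieldType) (o : {pred F}) (gT : finGroupType).

Definition group_ring_order : set (galg F gT) :=
  [set a | forall g, gcoef a g \in o].

Definition commutator_trace : galg F gT :=
  \sum_(g in [set: gT]%G^`(1)%g) galg_of F g.

Definition commutator_idem : galg F gT :=
  (#|[set: gT]%G^`(1)%g|%:R)^-1 *: commutator_trace.

(* o[G] e + Lam' (1 - e); the sum is direct, e being a central idempotent. *)
Definition mixed_order (Lam' : set (galg F gT)) : set (galg F gT) :=
  set_add (set_mulr group_ring_order commutator_idem)
          (set_mulr Lam' (1 - commutator_idem)).

End GroupRing.

Arguments group_ring_order {F} o gT _.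

(* Main.v *)
(** An element z of the centre of F[G] lies in the conductor of a maximal order
    L into o[G] iff the coefficient at 1 of z y is integral for all y in L.
    By the decomposition of the regular character this coefficient is the sum
    over i of Tr_(F_i/F)(w_i * chi_i(1)/|G| * chi_i(y)), where w_i is the scalar
    by which z acts in a representation affording chi_i.  As L contains the
    integral closure of o in the centre, z is in the conductor as soon as the
    w_i * chi_i(1)/|G| lie in the inverse different of F_i, and the converse
    holds provided that the character values chi_i(y), y in L, generate the unit
    ideal of o_i'.

    This last point is local: let e be an idempotent of L, minimal among those
    on which chi_i does not vanish.  By maximality e L e is a noncommutative
    discrete valuation ring.  A root of unity T of order prime to p in e L e
    that generates a maximal unramified extension has residue field that of its
    whole centralizer C, so that C is generated over its centre by a
    uniformizer of C and is therefore commutative.  Hence an eigenvalue of T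
    has multiplicity one in the representation, and the trace 1 of the
    corresponding spectral projection is a combination of the chi_i(T^j) with
    integral coefficients.  *)
Require Import Defs.
From HB Require Import structures.
From mathcomp Require Import all_boot all_order all_algebra all_fingroup.
From mathcomp Require Import all_solvable all_field all_character.
From mathcomp Require Import all_classical.
From mathcomp Require Import zify ring.

Set Implicit Arguments.
Unset Strict Implicit.
Unset Printing Implicit Defensive.

Import Order.TTheory GRing.Theory Num.Theory.
Local Open Scope classical_set_scope.
Local Open Scope ring_scope.

(** * The valuation of a local field *)

(** The obstacle is that neither F_i nor a splitting field of F[G] carries a valuation here. All
    limits are therefore taken inside L for the pi-adic topology, where completeness of F and
    finiteness of its residue field suffice, and integrality in Fbar is expressed by monic
    polynomials alone. No structure theory of simple F-algebras is invoked either: maximality of L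
    acts through two enlargements that must collapse to L, one by the multipliers of the non-units
    of a corner, the other by an integral central element. The relation that evaluates to 1 has
    coefficients, the powers of an eigenvalue, that may lie outside F_i; only the character values
    are known to lie in F_i, and a circulant determinant takes the place of a descent. The summand
    o[G] Tr_G' needs none of this: it consists of the elements of o[G] fixed by e, and F[G]e is
    commutative. *)

Section Valuation.
Variables (F : fieldType) (p : nat) (hF : local_field F p).
Local Notation v := (lf_val hF).
Local Notation vg := (val_ge (lf_val hF)).
Local Notation o := (integers hF).
Implicit Types (x y : F) (m n : int).

Lemma val_geE n x : (x \in vg n) = (x == 0) || (n <= v x).
Proof. by []. Qed.

Lemma lf_val1 : v 1 = 0.
Proof.
have := lf_valM hF (oner_neq0 F) (oner_neq0 F); rewrite mulr1 => /eqP.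
by rewrite -subr_eq0 opprD addNKr oppr_eq0 => /eqP.
Qed.

Lemma lf_valV x : x != 0 -> v x^-1 = - v x.
Proof.
move=> x0; apply/eqP; rewrite -addr_eq0 addrC -lf_valM ?invr_eq0 //.
by rewrite divff // lf_val1.
Qed.

Lemma lf_valN x : x != 0 -> v (- x) = v x.
Proof.
move=> x0; rewrite -mulN1r lf_valM ?oppr_eq0 ?oner_eq0 //.
have : v (-1) + v (-1) = 0.
  by rewrite -lf_valM ?oppr_eq0 ?oner_eq0 // mulrNN mulr1 lf_val1.
by move=> /eqP; rewrite -mulr2n mulrn_eq0 /= => /eqP ->; rewrite add0r.
Qed.

Lemma val_ge0 n : 0 \in vg n.
Proof. by rewrite val_geE eqxx. Qed.

Lemma val_geN n x : x \in vg n -> - x \in vg n.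
Proof.
rewrite !val_geE oppr_eq0; have [//|x0 /=] := eqVneq x 0.
by rewrite lf_valN.
Qed.

Lemma val_geM m n x y : x \in vg m -> y \in vg n -> x * y \in vg (m + n).
Proof.
rewrite !val_geE mulf_eq0; have [//|x0 /=] := eqVneq x 0.
by have [//|y0 /=] := eqVneq y 0; rewrite lf_valM //; apply: lerD.
Qed.

Lemma val_geS m n x : m <= n -> x \in vg n -> x \in vg m.
Proof. by rewrite !val_geE => mn /orP[->//|/(le_trans mn) ->]; rewrite orbT. Qed.

Lemma integers_subring : subring_closed o.
Proof.
split=> [|x y xo yo|x y xo yo]; first by rewrite val_geE lf_val1 lexx orbT.
  by apply: lf_valD => //; apply: val_geN.
by have := val_geM xo yo; rewrite addr0.
Qed.

HB.instance Definition _ := GRing.isSubringClosed.Build F o integers_subring.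

Definition unif : F := s2val (cid2 (lf_val_norm hF)).

Lemma unif_neq0 : unif != 0.
Proof. by rewrite /unif; case: cid2. Qed.

Lemma unif_val : v unif = 1.
Proof. by rewrite /unif; case: cid2. Qed.

Lemma unifX_neq0 k : unif ^+ k != 0.
Proof. by rewrite expf_neq0 // unif_neq0. Qed.

Lemma unifX_val k : v (unif ^+ k) = k%:Z.
Proof.
elim: k => [|k IH]; first by rewrite expr0 lf_val1.
by rewrite exprS lf_valM ?unif_neq0 ?unifX_neq0 // IH unif_val -intS.
Qed.

Lemma unifX_integers k : unif ^+ k \in o.
Proof. by rewrite val_geE unifX_val orbT. Qed.

Lemma unif_integers : unif \in o.
Proof. exact: (unifX_integers 1). Qed.

Lemma val_geP (k : nat) x :
  reflect (exists2 y, y \in o & x = unif ^+ k * y) (x \in vg k%:Z).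
Proof.
apply: (iffP idP) => [xk|[y yo ->]]; last first.
  rewrite -[k%:Z]addr0; apply: val_geM => //.
  by rewrite val_geE unifX_val lexx orbT.
exists ((unif ^+ k)^-1 * x); last by rewrite mulVKf ?unifX_neq0.
rewrite /integers -[0](addNr k%:Z); apply: val_geM => //.
by rewrite val_geE lf_valV ?unifX_neq0 // unifX_val lexx orbT.
Qed.

Lemma val_ge_bounded n x : x \in vg n -> unif ^+ `|n|%N * x \in o.
Proof.
move=> xn; rewrite /integers; apply: val_geS (_ : 0 <= `|n|%N%:Z + n) _.
  by rewrite abszE -lerBlDr sub0r -normrN ler_norm.
by apply: val_geM => //; rewrite val_geE unifX_val lexx orbT.
Qed.

Lemma val_ge_separated x : (forall k : nat, x \in vg k%:Z) -> x = 0.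
Proof.
move=> xk; apply/eqP/negPn/negP => x0.
have := xk `|v x|.+1; rewrite val_geE (negPf x0) /= => h.
have := le_trans h (ler_norm (v x)); rewrite -abszE lez_nat ltnn //.
Qed.

Lemma val_exists_bound x : exists k : nat, unif ^+ k * x \in o.
Proof.
by exists `|v x|%N; apply: val_ge_bounded; rewrite val_geE lexx orbT.
Qed.

Lemma prime_p : prime p.
Proof. by case: (lf_residue_char hF). Qed.

Lemma char_unif : exists2 y, y \in o & p%:R = unif * y :> F.
Proof.
by have [_ /(val_geP 1)[y yo ->]] := lf_residue_char hF; exists y.
Qed.

(** If 1 + pi y vanished or had positive valuation, then 1 would lie in the maximal ideal. *)
Lemma integersV_1Dunif y : y \in o -> (1 + unif * y)^-1 \in o.
Proof.
move=> yo; set x := 1 + _.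
have x0 : x != 0.
  apply/eqP => x0; have : (1 : F) \in vg 1.
    have -> : 1 = unif ^+ 1 * - y.
      by apply/eqP; rewrite -subr_eq0 expr1 mulrN opprK -/x x0.
    by apply/(val_geP 1); exists (- y) => //; rewrite rpredN.
  by rewrite val_geE oner_eq0 lf_val1.
rewrite /integers val_geE lf_valV // oppr_ge0; apply/orP; right.
rewrite leNgt; apply/negP => vx.
have : (1 : F) \in vg 1.
  have -> : 1 = x - unif * y by rewrite addrK.
  apply: lf_valD.
    by rewrite val_geE -gtz0_ge1 vx orbT.
  by apply: val_geN; apply/(val_geP 1); exists y.
by rewrite val_geE oner_eq0 lf_val1.
Qed.

(** The number p^r - 1 is congruent to -1 modulo pi. It is a common exponent of the roots of unity
    used below, so averaging over their powers preserves integrality. *)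
Lemma integersV_expB1 r : (0 < r)%N -> ((p ^ r)%N.-1%:R : F)^-1 \in o.
Proof.
move=> r0; have [y yo py] := char_unif.
have pr : (0 < p ^ r)%N by rewrite expn_gt0 prime_gt0 ?prime_p.
have -> : (p ^ r)%N.-1%:R = - (1 + unif * - (y * p%:R ^+ r.-1)) :> F.
  rewrite mulrN opprD opprK mulrA -py -exprS prednK // -natrX.
  by rewrite -[in RHS](prednK pr) -natr1 addrC addrK.
by rewrite invrN rpredN integersV_1Dunif // rpredN rpredM // rpredX // rpred_nat.
Qed.

Lemma char0_natr_neq0 (n : nat) : (0 < n)%N -> n%:R != 0 :> F.
Proof.
by move=> n0; rewrite (pcharf0P _).1 -?lt0n //; apply: lf_char0 hF.
Qed.

(** Completeness gives no rate of convergence; the estimate at each k comes from comparing l with a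
    partial sum far beyond k. *)
Lemma cauchy_series (c : nat -> F) : (forall i, c i \in o) ->
  exists l, forall k : nat, l - \sum_(i < k) unif ^+ i * c i \in vg k%:Z.
Proof.
move=> co; pose u (n : nat) := \sum_(i < n) unif ^+ i * c i.
have uD (m d : nat) : u (m + d)%N - u m \in vg m%:Z.
  elim: d => [|d IH]; first by rewrite addn0 subrr val_ge0.
  rewrite addnS /u big_ord_recr /= addrAC; apply: lf_valD IH _.
  apply: (@val_geS _ (m + d)%N); first by rewrite lez_nat leq_addr.
  by apply/val_geP; exists (c (m + d)%N).
have [|l lP] := @lf_complete _ _ hF u.
  move=> n; exists n => i j ni nj.
  rewrite -(subrK (u n) (u i)) -addrA; apply: lf_valD.
    by rewrite -(subnKC ni).
  by rewrite -opprB val_geN // -(subnKC nj).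
exists l => n; have [N NP] := lP n.
rewrite -/(u n) -(subrK (u (n + N)%N) l) -addrA; apply: lf_valD => //.
by rewrite -opprB val_geN // NP // leq_addl.
Qed.

End Valuation.

(** * Orders in the group algebra *)

Lemma ex_min_nat (P : nat -> Prop) :
  (exists n, P n) -> exists2 n, P n & forall m, P m -> (n <= m)%N.
Proof.
move=> [n0 Pn0]; have exP : exists n, `[< P n >] by exists n0; apply/asboolP.
by case: (ex_minnP exP) => n /asboolP Pn min; exists n => // m /asboolP /min.
Qed.

Lemma ex_max_nat (P : nat -> Prop) b :
  (exists n, P n) -> (forall n, P n -> (n <= b)%N) ->
  exists2 n, P n & forall m, P m -> (m <= n)%N.
Proof.
move=> [n0 Pn0] Pb.
have [|_ [n Pn ->] min] := @ex_min_nat (fun d => exists2 n, P n & d = (b - n)%N).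
  by exists (b - n0)%N, n0.
exists n => // m Pm; have := min _ (ex_intro2 _ _ m Pm erefl).
by rewrite leq_sub2lE // Pb.
Qed.

(* The properties of a maximal order that the local theory uses; the lattice
   conditions are expressed by means of the uniformizer. *)
Record max_local_order (F : fieldType) (p : nat) (hF : local_field F p)
    (A : algType F) (L : set A) := MaxLocalOrder {
  mlo_ring : is_subring L;
  mlo_gen : exists (n : nat) (s : 'I_n -> A), L =
        [set x | exists2 c : 'I_n -> F, forall j, c j \in integers hF &
                   x = \sum_j c j *: s j];
  mlo_span : forall x, exists k, L (unif hF ^+ k *: x);
  mlo_sep : forall x, (forall k, L ((unif hF ^+ k)^-1 *: x)) -> x = 0;
  mlo_max : forall Gam : set A, is_subring Gam -> L `<=` Gam ->
    (exists k, forall x, Gam x -> L (unif hF ^+ k *: x)) -> Gam `<=` L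
}.

Section GroupAlgebraOrders.
Variables (F : fieldType) (p : nat) (hF : local_field F p) (gT : finGroupType).
Local Notation o := (integers hF).
Local Notation A := (galg F gT).
Local Notation pi := (unif hF).
Local Notation Lam := (group_ring_order o gT).
Implicit Types (x y : A) (M : set A).

Lemma gcoef0 g : gcoef (0 : A) g = 0.
Proof. by rewrite /gcoef ffunE. Qed.

Lemma gcoefZ c x g : gcoef (c *: x) g = c * gcoef x g.
Proof. exact: gcoef_scale. Qed.

Lemma gcoefME x y g : gcoef (x * y) g = \sum_h gcoef x h * gcoef y (h^-1 * g)%g.
Proof. exact: gcoefM. Qed.

Lemma gcoefN x g : gcoef (- x) g = - gcoef x g.
Proof. by rewrite -scaleN1r gcoefZ mulN1r. Qed.

Lemma gcoef_sum (I : Type) (r : seq I) (P : pred I) (f : I -> A) g :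
  gcoef (\sum_(i <- r | P i) f i) g = \sum_(i <- r | P i) gcoef (f i) g.
Proof.
by elim/big_ind2: _ => [|x a y b <- <-|//]; rewrite ?gcoef0 ?gcoefD.
Qed.

Lemma galg_sumE x : x = \sum_g gcoef x g *: galg_of F g.
Proof.
apply: galgP => h; rewrite gcoef_sum (bigD1 h) //= big1 ?addr0.
  by rewrite gcoefZ gcoef_of eqxx mulr1.
by move=> g /negbTE gh; rewrite gcoefZ gcoef_of eq_sym gh mulr0.
Qed.

Definition o_span n (s : 'I_n -> A) : set A :=
  [set x | exists2 c : 'I_n -> F, forall j, c j \in o & x = \sum_j c j *: s j].

(** Echelon form over a valuation ring: an element x0 of M whose coefficient at g has least
    valuation divides all other coefficients at g, and subtracting multiples of x0 leaves the
    submodule M' of elements vanishing at g. The bound by k makes the least valuation exist. *)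
Lemma bounded_fg M k :
  M 0 -> (forall x y, M x -> M y -> M (x + y)) ->
  (forall c x, c \in o -> M x -> M (c *: x)) ->
  (forall x g, M x -> pi ^+ k * gcoef x g \in o) ->
  exists n (s : 'I_n -> A), M = o_span s.
Proof.
move=> M0 MD MZ Mk.
suff fg (l : seq gT) : forall M, M 0 -> (forall x y, M x -> M y -> M (x + y)) ->
    (forall c x, c \in o -> M x -> M (c *: x)) ->
    (forall x g, M x -> pi ^+ k * gcoef x g \in o) ->
    (forall x g, M x -> g \notin l -> gcoef x g = 0) ->
    exists n (s : 'I_n -> A), M = o_span s.
  by apply: (fg (enum gT)) => // x g _; rewrite mem_enum.
elim: l {M M0 MD MZ Mk} => [|g l IH] M M0 MD MZ Mk Ml.
  exists 0%N, (fun _ => 0); apply/seteqP; split=> x /=.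
    by move=> Mx; exists (fun=> 0) => [[]//|]; rewrite big_ord0; apply: galgP => g;
      rewrite gcoef0 Ml.
  by case=> c _ ->; rewrite big_ord0.
pose M' := [set x | M x /\ gcoef x g = 0].
have [|||||n [s M's]] := IH M'.
- by split; rewrite ?gcoef0.
- by move=> x y [Mx xg] [My yg]; split; [exact: MD | rewrite gcoefD xg yg addr0].
- by move=> c x co [Mx xg]; split; [exact: MZ | rewrite gcoefZ xg mulr0].
- by move=> x h [Mx _]; apply: Mk.
- move=> x h [Mx xg] hl; have [->//|hg] := eqVneq h g.
  by apply: Ml => //; rewrite inE negb_or hg.
have [[x1 Mx1 x1g]|noM] := pselect (exists2 x, M x & gcoef x g != 0); last first.
  exists n, s; rewrite -M's; apply/seteqP; split=> x; last by case.
  by move=> Mx; split=> //; apply/eqP/negPn/negP => xg; apply: noM; exists x.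
pose P m := exists x, [/\ M x, gcoef x g != 0 & lf_val hF (pi ^+ k * gcoef x g) = m%:Z].
have vP x : M x -> gcoef x g != 0 ->
    exists2 m, P m & lf_val hF (pi ^+ k * gcoef x g) = m%:Z.
  move=> Mx xg; have := Mk x g Mx; rewrite val_geE mulf_eq0 (negPf xg) orbF.
  rewrite (negPf (unifX_neq0 hF k)) /= => le0.
  by exists `|lf_val hF (pi ^+ k * gcoef x g)|%N; [exists x; split|]; rewrite // gez0_abs.
have [|m0 [x0 [Mx0 x0g x0v]] m0min] := @ex_min_nat P.
  by have [m Pm _] := vP _ Mx1 x1g; exists m.
have quo x : M x -> gcoef x g / gcoef x0 g \in o.
  move=> Mx; have [->|xg] := eqVneq (gcoef x g) 0; first by rewrite mul0r rpred0.
  have [m Pm xv] := vP _ Mx xg; rewrite val_geE lf_valM ?invr_eq0 // lf_valV //.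
  have := m0min m Pm; rewrite -lez_nat -x0v -xv !lf_valM ?unifX_neq0 //.
  by rewrite lerD2l -subr_ge0 => ->; rewrite orbT.
exists n.+1, (fun i => if unlift ord0 i is Some j then s j else x0).
apply/seteqP; split=> x /=.
  move=> Mx; have : M' (x - (gcoef x g / gcoef x0 g) *: x0).
    split; first by apply: MD => //; rewrite -scaleNr; apply: MZ; rewrite ?rpredN ?quo.
    by rewrite gcoefD gcoefN gcoefZ divfK // subrr.
  rewrite M's => -[c co /eqP]; rewrite subr_eq => /eqP xE.
  exists (fun i => if unlift ord0 i is Some j then c j else gcoef x g / gcoef x0 g).
    by move=> j; case: unliftP => // _; apply: quo.
  rewrite big_ord_recl unlift_none {1}xE addrC; congr (_ + _).
  by apply: eq_bigr => i _; rewrite liftK.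
case=> c co ->; rewrite big_ord_recl unlift_none; apply: MD; first exact: MZ.
under eq_bigr do rewrite liftK.
suff : M' (\sum_(i < n) c (lift ord0 i) *: s i) by case.
by rewrite M's; exists (fun i => c (lift ord0 i)).
Qed.

Lemma o_span_bounded n (s : 'I_n -> A) :
  exists k, forall x g, o_span s x -> pi ^+ k * gcoef x g \in o.
Proof.
have /choice[f fP] : forall i : 'I_n * gT, exists k, pi ^+ k * gcoef (s i.1) i.2 \in o.
  by move=> i; apply: val_exists_bound.
exists (\max_i f i) => _ g [c co ->]; rewrite gcoef_sum mulr_sumr.
apply: rpred_sum => j _; rewrite gcoefZ mulrCA; apply: rpredM => //.
rewrite -(subnK (leq_bigmax (j, g))) exprD -mulrA.
by apply: rpredM; [exact: unifX_integers | exact: fP].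
Qed.

Variables (L : set A).
Hypotheses (maxL : is_maximal_order o L) (LamL : Lam `<=` L).

Lemma order_bounded : exists k, forall x g, L x -> pi ^+ k * gcoef x g \in o.
Proof.
by have [[_ [n [s ->]] _] _] := maxL; apply: o_span_bounded.
Qed.

Lemma galg_bounded x : exists k, Lam (pi ^+ k *: x).
Proof.
have /choice[f fP] : forall g, exists k, pi ^+ k * gcoef x g \in o.
  by move=> g; apply: val_exists_bound.
exists (\max_g f g) => g; rewrite gcoefZ -(subnK (leq_bigmax g)) exprD -mulrA.
by apply: rpredM; [exact: unifX_integers | exact: fP].
Qed.

Lemma galg_max_local_order : max_local_order hF L.
Proof.
have [[[L1 LB LM] [n [s Ls]] _] Lmax] := maxL.
have [k kP] := order_bounded.
split=> //; first by exists n, s.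
- by move=> x; have [j jP] := galg_bounded x; exists j; apply: LamL.
- move=> x xL; apply: galgP => g; rewrite gcoef0.
  apply: (mulfI (unifX_neq0 hF k)); rewrite mulr0; apply: (@val_ge_separated _ _ hF).
  move=> j; have := kP _ g (xL j); rewrite gcoefZ mulrCA => h.
  by apply/val_geP; eexists; [exact: h | rewrite mulVKf ?unifX_neq0].
move=> Gam GamR LGam [j jP].
(* The scalars of o lie in [Lam], so the ring [Gam] is automatically an o-module. *)
have GamZ c x : c \in o -> Gam x -> Gam (c *: x).
  have [_ _ GM] := GamR; move=> co Gx; rewrite -[x]mul1r scalerAl; apply: GM => //.
  apply/LGam/LamL => g; rewrite gcoefZ gcoef_of.
  by apply: rpredM => //; case: eqP; rewrite ?rpred0 ?rpred1.
have [G1 GB GM] := GamR.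
have G0 : Gam 0 by rewrite -(subrr 1); apply: GB.
have GD x y : Gam x -> Gam y -> Gam (x + y).
  by move=> Gx Gy; rewrite -[y]opprK -[- y]sub0r; apply/GB/GB.
suff -> : Gam = L by [].
apply: Lmax => //; split=> //.
  apply: (@bounded_fg _ (k + j)) => // x g Gx.
  by rewrite exprD -mulrA -gcoefZ; apply: kP; apply: jP.
move=> x; exists #|gT|, (fun i => gcoef x (enum_val i)), (fun i => galg_of F (enum_val i)).
split; last first.
  rewrite {1}[x]galg_sumE (reindex (enum_val (A := predT))) //.
  by apply: onW_bij; apply: enum_val_bij.
move=> i; apply/LGam/LamL => g; rewrite gcoef_of.
by case: eqP; rewrite ?rpred0 ?rpred1.
Qed.

End GroupAlgebraOrders.

(** * Congruences modulo powers of the uniformizer *)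

Section LocalOrder.
Variables (F : fieldType) (p : nat) (hF : local_field F p) (A : algType F).
Variables (L : set A) (hL : max_local_order hF L).
Local Notation o := (integers hF).
Local Notation pi := (unif hF).
Implicit Types (x y a b : A) (k m n : nat).

Definition mlo_pred (_ : max_local_order hF L) : {pred A} := fun x => `[< L x >].
Local Notation Lp := (mlo_pred hL).

Lemma mlo_predE x : (x \in Lp) <-> L x.
Proof. by split=> [/asboolP|/asboolP]. Qed.

Lemma mlo_pred_subring : subring_closed Lp.
Proof.
have [L1 LB LM] := mlo_ring hL.
by split=> [|x y|x y]; [exact/asboolP | |];
  move=> /asboolP Lx /asboolP Ly; apply/asboolP; [exact: LB|exact: LM].
Qed.

HB.instance Definition _ := GRing.isSubringClosed.Build A Lp mlo_pred_subring.

Lemma mlo_predZ c x : c \in o -> x \in Lp -> c *: x \in Lp.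
Proof.
move=> co /asboolP Lx; apply/asboolP.
have [n [s Ls]] := mlo_gen hL; move: Lx; rewrite Ls => -[d dO ->].
exists (fun j => c * d j) => [j|]; first exact: rpredM.
by rewrite scaler_sumr; apply: eq_bigr => j _; rewrite scalerA.
Qed.

(** The pi-adic filtration of L, in which all limits below are taken. *)
Definition dv k x := (pi ^+ k)^-1 *: x \in Lp.

Lemma dv_scale k x : dv k (pi ^+ k *: x) = (x \in Lp).
Proof. by rewrite /dv scalerK ?unifX_neq0. Qed.

Lemma dv0 x : dv 0 x = (x \in Lp).
Proof. by rewrite /dv expr0 invr1 scale1r. Qed.

Lemma dv_leq (j k : nat) x : (j <= k)%N -> dv k x -> dv j x.
Proof.
move=> jk xk; have -> : x = pi ^+ j *: (pi ^+ (k - j) *: ((pi ^+ k)^-1 *: x)).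
  by rewrite !scalerA -exprD subnKC // mulfV ?scale1r ?unifX_neq0.
by rewrite dv_scale mlo_predZ // unifX_integers.
Qed.

Lemma dvL k x : dv k x -> x \in Lp.
Proof. by rewrite -dv0; apply: dv_leq. Qed.

Lemma dvD k x y : dv k x -> dv k y -> dv k (x + y).
Proof. by rewrite /dv scalerDr; apply: rpredD. Qed.

Lemma dvN k x : dv k x -> dv k (- x).
Proof. by rewrite /dv scalerN rpredN. Qed.

Lemma dvBC k x y : dv k (x - y) -> dv k (y - x).
Proof. by move=> xy; rewrite -opprB; apply: dvN. Qed.

Lemma dv_trans k y x z : dv k (x - y) -> dv k (y - z) -> dv k (x - z).
Proof. by move=> xy yz; rewrite -(subrK y x) -addrA; apply: dvD. Qed.

Lemma dvM (j k : nat) x y : dv j x -> dv k y -> dv (j + k) (x * y).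
Proof.
rewrite /dv => xj yk; rewrite exprD invfM -scalerA scalerAr scalerAl.
exact: rpredM.
Qed.

Lemma dvMl k x y : x \in Lp -> dv k y -> dv k (x * y).
Proof. by rewrite -dv0; apply: dvM. Qed.

Lemma dvMr k x y : dv k x -> y \in Lp -> dv k (x * y).
Proof. by rewrite -dv0 -{2}[k]addn0; apply: dvM. Qed.

Lemma dv_zero k : dv k 0.
Proof. by rewrite /dv scaler0 rpred0. Qed.

Lemma dv_eq0 x : (forall k, dv k x) -> x = 0.
Proof. by move=> xk; apply: (mlo_sep hL) => k; apply/mlo_predE/xk. Qed.

Lemma dv_eq x y : (forall k, dv k (x - y)) -> x = y.
Proof. by move=> xy; apply/eqP; rewrite -subr_eq0; apply/eqP/dv_eq0. Qed.

Lemma dvX k n a b : a \in Lp -> b \in Lp -> dv k (a - b) -> dv k (a ^+ n - b ^+ n).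
Proof.
move=> aL bL ab; elim: n => [|n IH]; first by rewrite subrr dv_zero.
rewrite !exprS; apply: (@dv_trans _ (a * b ^+ n)).
  by rewrite -mulrBr dvMl.
by rewrite -mulrBl dvMr // rpredX.
Qed.

Lemma dv_char : dv 1 (p%:R : A).
Proof.
have [y yo py] := char_unif hF.
by rewrite -[p%:R]scaler_nat py -scalerA dv_scale mlo_predZ ?rpred1.
Qed.

(** In a^p - b^p = (a - b) S the factor S is congruent to p b^(p-1) modulo pi, because a and b agree
    modulo pi; hence S is divisible by pi, as p is. *)
Lemma dv_expp k a b : a \in Lp -> b \in Lp -> GRing.comm a b -> (0 < k)%N ->
  dv k (a - b) -> dv k.+1 (a ^+ p - b ^+ p).
Proof.
move=> aL bL ab k0 abk; rewrite subrXX_comm // -addn1; apply: dvM => //.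
rewrite -[X in dv 1 X](subrK (\sum_(i < p) b ^+ p.-1)); apply: dvD; last first.
  rewrite sumr_const card_ord -mulr_natl.
  by apply: dvMr dv_char _; rewrite rpredX.
rewrite -sumrB /dv scaler_sumr; apply: rpred_sum => i _.
have -> : b ^+ p.-1 = b ^+ (p.-1 - i) * b ^+ i.
  by rewrite -exprD subnK // -ltnS prednK ?prime_gt0 ?(prime_p hF).
rewrite -mulrBl; apply: dvMr; last by rewrite rpredX.
by apply: dvX => //; apply: dv_leq abk.
Qed.

Lemma dv_exppX k m a b : a \in Lp -> b \in Lp -> GRing.comm a b -> (0 < k)%N ->
  dv k (a - b) -> dv (k + m) (a ^+ (p ^ m) - b ^+ (p ^ m)).
Proof.
move=> aL bL ab k0 abk; elim: m => [|m IH]; first by rewrite addn0 expn0 !expr1.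
rewrite expnSr !exprM addnS; apply: dv_expp; rewrite ?rpredX ?addn_gt0 ?k0 //.
exact/commrX/commr_sym/commrX/commr_sym.
Qed.

Lemma dv_frobenius m a b : a \in Lp -> b \in Lp -> GRing.comm a b ->
  dv 1 ((a - b) ^+ (p ^ m) - (a ^+ (p ^ m) - b ^+ (p ^ m))).
Proof.
have frobD x y : x \in Lp -> y \in Lp -> GRing.comm x y ->
    dv 1 ((x + y) ^+ p - (x ^+ p + y ^+ p)).
  move=> xL yL xy; rewrite exprDn_comm // -(prednK (prime_gt0 (prime_p hF))).
  rewrite big_ord_recl big_ord_recr /= !subn0 bin0 subnn binn !expr0 !mulr1n mul1r mulr1.
  rewrite opprD addrACA subrr add0r addrK.
  rewrite /dv scaler_sumr; apply: rpred_sum => i _.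
  have p0 : (0 < p)%N by rewrite prime_gt0 ?(prime_p hF).
  have /dvdnP[q Cq] : (p %| 'C(p, i.+1))%N.
    by rewrite prime_dvd_bin ?(prime_p hF) //= -ltn_predRL.
  rewrite /bump /= add1n prednK // Cq.
  rewrite mulrnA -mulr_natl; apply: dvMr dv_char _.
  by rewrite rpredMn // rpredM // rpredX.
move=> aL bL ab; elim: m => [|m IH].
  by rewrite expn0 !expr1 subrr dv_zero.
rewrite expnSr !exprM; set x := a ^+ _; set y := b ^+ _; set z := (a - b) ^+ _.
have [xL yL] : x \in Lp /\ y \in Lp by rewrite !rpredX.
have xy : GRing.comm x y by apply/commrX/commr_sym/commrX/commr_sym.
apply: (@dv_trans _ ((x - y) ^+ p)).
  by apply: dvX; rewrite ?rpredX ?rpredB.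
(* Applying the formula for sums to (x - y) + y avoids the sign (-1)^p. *)
have := @frobD (x - y) y; rewrite subrK rpredB // => /(_ isT yL) h.
have {h} /h : GRing.comm (x - y) y by apply/commr_sym/commrB/commr_refl/commr_sym.
by move=> /dvBC; rewrite opprB addrA.
Qed.

Lemma o_span_gen m (s : 'I_m -> A) j :
  L = [set x | exists2 c : 'I_m -> F, forall j, c j \in o & x = \sum_j c j *: s j] ->
  s j \in Lp.
Proof.
move=> Ls; apply/mlo_predE; rewrite Ls.
exists (fun i => (i == j)%:R) => [i|]; first by rewrite rpred_nat.
rewrite (bigD1 j) //= eqxx scale1r big1 ?addr0 // => i /negbTE ->.
by rewrite scale0r.
Qed.

(** The generators of L are not known to be independent, so coordinates are chosen for each
    difference [u n.+1 - u n]; the resulting power series in pi converge in F. *)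
Lemma dv_lim (u : nat -> A) : (forall n, dv n (u n.+1 - u n)) ->
  exists l, forall n, dv n (l - u n).
Proof.
have [m [s Ls]] := mlo_gen hL.
move=> uS; have /choice[c cP] : forall n, exists c : 'I_m -> F,
    (forall j, c j \in o) /\ u n.+1 - u n = pi ^+ n *: \sum_j c j *: s j.
  move=> n; have /mlo_predE := uS n; rewrite Ls => -[c co cE].
  by exists c; split; rewrite // -cE scalerA mulfV ?scale1r ?unifX_neq0.
have /choice[g gP] : forall j, exists l, forall n,
    l - \sum_(i < n) pi ^+ i * c i j \in val_ge (lf_val hF) n%:Z.
  by move=> j; apply: (@cauchy_series _ _ hF (c^~ j)) => n; apply: (cP n).1.
have uE n : u n = u 0 + \sum_j (\sum_(i < n) pi ^+ i * c i j) *: s j.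
  elim: n => [|n IH].
    by rewrite big1 ?addr0 // => j _; rewrite big_ord0 scale0r.
  rewrite -(subrK (u n) (u n.+1)) (cP n).2 {}IH addrC -addrA; congr (_ + _).
  rewrite scaler_sumr -big_split /=; apply: eq_bigr => j _.
  by rewrite big_ord_recr /= scalerA scalerDl.
exists (u 0 + \sum_j g j *: s j) => n; rewrite (uE n) opprD addrACA subrr add0r.
rewrite -sumrB /dv scaler_sumr; apply: rpred_sum => j _.
have /val_geP[y yo e] := gP j n; rewrite -scalerBl e.
rewrite -scalerA scalerK ?unifX_neq0 // mlo_predZ //.
exact: (o_span_gen _ Ls).
Qed.

(** Finiteness of L / pi L, inherited from the residue field. The bound K is uniform in the
    sequence, which makes the exponents of [teichmuller] independent of h. *)
Lemma residue_pigeonhole : exists K, forall u : nat -> A,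
  (forall i, u i \in Lp) ->
  exists i j, [/\ (i < j)%N, (j <= K)%N & dv 1 (u i - u j)].
Proof.
have [m [s Ls]] := mlo_gen hL; have [r rP] := lf_residue_fin hF.
pose T := {ffun 'I_m -> 'I_(size r)}.
exists #|{: T}| => u uL.
have /choice[f fP] : forall i, exists f : T,
    exists2 c : 'I_m -> F, u i = \sum_j c j *: s j &
    forall j, c j - nth 0 r (f j) \in val_ge (lf_val hF) 1.
  move=> i; have /mlo_predE := uL i; rewrite Ls => -[c co uE].
  have /choice[f fP] : forall j, exists k : 'I_(size r),
      c j - nth 0 r k \in val_ge (lf_val hF) 1.
    move=> j; have [y yr cy] := rP _ (co j).
    by move: yr; rewrite -index_mem => yr; exists (Ordinal yr); rewrite nth_index -?index_mem.
  by exists [ffun j => f j]; exists c => // j; rewrite ffunE.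
have : ~~ injectiveb (fun i : 'I_(#|{: T}|.+1) => f i).
  apply/injectiveP => inj_f; have := leq_card _ inj_f.
  by rewrite card_ord ltnn.
case/injectivePn=> i [j ij fij].
have eqmod k l : f k = f l -> dv 1 (u k - u l).
  have [[c -> cP] [d -> dP]] := (fP k, fP l) => fkl.
  rewrite -sumrB /dv scaler_sumr; apply: rpred_sum => q _; rewrite -scalerBl.
  have /(val_geP hF 1)[y yo ->] : c q - d q \in val_ge (lf_val hF) 1.
    rewrite -(subrK (nth 0 r (f k q)) (c q)) -addrA; apply: lf_valD => //.
    by rewrite -opprB val_geN // fkl.
  rewrite -scalerA expr1 scalerK ?unif_neq0 // mlo_predZ //.
  exact: (o_span_gen _ Ls).
case: (ltngtP i j) => [ltij|ltji|/val_inj/eqP]; last by rewrite (negPf ij).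
  by exists i, j; split; rewrite // ?eqmod // -ltnS.
by exists j, i; split; rewrite // ?eqmod // -ltnS.
Qed.

End LocalOrder.

(** * Teichmueller representatives and units congruent to an idempotent *)

Section Teichmuller.
Variables (F : fieldType) (p : nat) (hF : local_field F p) (A : algType F).
Variables (L : set A) (hL : max_local_order hF L).
Local Notation o := (integers hF).
Local Notation pi := (unif hF).
Local Notation Lp := (mlo_pred hL).
Local Notation dv := (dv hL).

(** One pair of exponents serves every h, so that all representatives T are roots of one equation;
    [r %| s] makes T its own p^s-th power. The last two conditions say that T inherits from h its
    commutation relations and its membership in a corner. *)
Definition teichmuller_exponents r s := [/\ (0 < r)%N, (r %| s)%N &
  forall h, h \in Lp -> exists T,
    [/\ T \in Lp, T ^+ (p ^ r) = T, dv 1 (h ^+ (p ^ s) - T),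
        forall y, y \in Lp -> y * h = h * y -> y * T = T * y &
        forall e, e \in Lp -> e * h = h -> h * e = h -> e * T = T /\ T * e = T]].

(* T is the limit of the powers h ^ (p ^ (s + r * n)). *)
Lemma teichmuller : exists r s, teichmuller_exponents r s.
Proof.
have [K KP] := residue_pigeonhole hL.
(* Modulo pi the sequence h^(p^i) is periodic from an index at most K on, with a period at most K.
   The factorial is a multiple of every such period, and the second exponent is at least K, hence
   past the preperiod. *)
exists K`!, (K`! * K)%N; split; rewrite ?fact_gt0 ?dvdn_mulr // => h hLp.
set r := K`!; set s := (r * K)%N; set q := (p ^ r)%N.
have r0 : (0 < r)%N by apply: fact_gt0.
have hX n : h ^+ n \in Lp by apply: rpredX.
have per : dv 1 (h ^+ (p ^ (s + r)) - h ^+ (p ^ s)).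
  have [|i [j [ij jK hij]]] := KP (fun i => h ^+ (p ^ i)).
    by move=> i; apply: hX.
  have step n : (i <= n)%N -> dv 1 (h ^+ (p ^ (n + (j - i))) - h ^+ (p ^ n)).
    move=> lein; rewrite -(subnKC lein) addnAC subnKC ?(ltnW ij) //.
    by rewrite !expnD !exprM; apply: dvX; rewrite ?hX //; apply: dvBC.
  have steps n k : (i <= n)%N -> dv 1 (h ^+ (p ^ (n + k * (j - i))) - h ^+ (p ^ n)).
    move=> lein; elim: k => [|k IH]; first by rewrite mul0n addn0 subrr dv_zero.
    rewrite mulSn addnCA addnC; apply: dv_trans IH.
    by apply: step; rewrite (leq_trans lein) ?leq_addr.
  have /dvdnP[k rE] : (j - i %| r)%N.
    by apply: dvdn_fact; rewrite subn_gt0 ij leq_subLR (leq_trans jK) ?leq_addl.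
  rewrite [in X in h ^+ (p ^ (_ + X))]rE; apply: steps.
  by rewrite (leq_trans (ltnW ij)) // (leq_trans jK) // leq_pmull.
pose u n := h ^+ (p ^ s * q ^ n).
have uL n : u n \in Lp by apply: hX.
have uSn n : u n.+1 = u n ^+ q by rewrite /u expnSr mulnA exprM.
have uS n : dv n.+1 (u n.+1 - u n).
  elim: n => [|n IH].
    by rewrite /u expn0 expn1 muln1 /q -expnD.
  have cm : GRing.comm (u n.+1) (u n) by rewrite /u /GRing.comm -!exprD addnC.
  rewrite (uSn n.+1) {2}(uSn n); apply: dv_leq (_ : (_ <= n.+1 + r)%N) _.
    by rewrite -[X in (X <= _)%N]addn1 leq_add2l.
  exact: dv_exppX.
have [|T TP] := @dv_lim _ _ _ _ _ hL u.
  by move=> n; apply: dv_leq (uS n).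
have TL : T \in Lp by have := rpredD (dvL (TP 0)) (uL 0); rewrite subrK.
exists T; split=> //.
- apply: (dv_eq (hL := hL)) => n; apply: (@dv_trans _ _ _ _ _ hL _ (u n.+1)).
    by rewrite uSn; apply: dvX.
  by apply: dvBC; apply: dv_leq (TP n.+1).
- have u0 : u 0 = h ^+ (p ^ s) by rewrite /u expn0 muln1.
  rewrite -u0; apply: (@dv_trans _ _ _ _ _ hL _ (u 1)).
    by apply: dvBC; apply: uS.
  by apply: dvBC; apply: TP.
- move=> y yL yh; have yu n : y * u n = u n * y by apply: commrX.
  apply: (dv_eq (hL := hL)) => n.
  apply: (@dv_trans _ _ _ _ _ hL _ (y * u n)); first by rewrite -mulrBr dvMl.
  by rewrite yu -mulrBl; apply: dvMr yL; apply: dvBC.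
move=> e eL eh he.
have ue n : e * u n = u n /\ u n * e = u n.
  have n0 : (0 < p ^ s * q ^ n)%N.
    by rewrite muln_gt0 !expn_gt0 (prime_gt0 (prime_p hF)).
  by rewrite /u -(prednK n0) {1 2}exprS mulrA eh exprSr -mulrA he.
split; apply: (dv_eq (hL := hL)) => n; have [eu ue'] := ue n.
  apply: (@dv_trans _ _ _ _ _ hL _ (u n)); last by apply: dvBC.
  by rewrite -{1}eu -mulrBr dvMl.
apply: (@dv_trans _ _ _ _ _ hL _ (u n)); last by apply: dvBC.
by rewrite -{1}ue' -mulrBl dvMr.
Qed.

(* Geometric series. *)
Lemma mlo_inv_1Dunif e x : e \in Lp -> e * e = e -> dv 1 x -> e * x = x -> x * e = x ->
  exists y, [/\ y \in Lp, e * y = y, y * e = y & (e + x) * y = e] /\ y * (e + x) = e.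
Proof.
move=> eL ee xd ex xe; have xL := dvL xd.
pose X n := iter n (fun z => - (x * z)) e.
have XS n : X n.+1 = - (x * X n) by [].
have X0 : X 0 = e by [].
move: X XS X0 => X XS X0.
pose u n := \sum_(i < n) X i.
have Xd n : dv n (X n).
  elim: n => [|n IH]; first by rewrite dv0 X0.
  by rewrite XS -addn1 addnC; apply: dvN; apply: dvM.
have eX n : e * X n = X n.
  by case: n => [|n]; rewrite ?X0 // XS mulrN mulrA ex.
have XxC n : X n * x = x * X n.
  elim: n => [|n IH]; first by rewrite X0 ex xe.
  by rewrite XS mulNr -mulrA IH mulrN.
have Xe n : X n * e = X n.
  by elim: n => [|n IH]; rewrite ?X0 // XS mulNr -mulrA IH.
have uS n : dv n (u n.+1 - u n).
  by rewrite /u big_ord_recr /= addrAC subrr add0r.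
have uL n : u n \in Lp by apply: rpred_sum => i _; apply: dvL (Xd i).
have [y yP] := dv_lim uS.
have yL : y \in Lp by have := rpredD (dvL (yP 0)) (uL 0); rewrite subrK.
have eu n : e * u n = u n by rewrite mulr_sumr; apply: eq_bigr.
have ue n : u n * e = u n by rewrite mulr_suml; apply: eq_bigr.
have xu n : (e + x) * u n = e - X n.
  rewrite mulrDl eu; elim: n => [|n IH].
    by rewrite /u big_ord0 mulr0 addr0 X0 subrr.
  rewrite {1 2}/u !big_ord_recr /= -!/(u n) mulrDr addrACA IH.
  by rewrite XS opprK addrA subrK.
have ux n : u n * (e + x) = e - X n.
  rewrite -xu mulrDr mulrDl ue eu; congr (_ + _).
  by rewrite mulr_suml mulr_sumr; apply: eq_bigr.
have lim (z : A) (v : nat -> A) : (forall n, dv n (z - v n)) -> forall (f : A -> A) w,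
    (forall a b, f (a - b) = f a - f b) -> (forall n a, dv n a -> dv n (f a)) ->
    (forall n, dv n (f (v n) - w)) -> f z = w.
  move=> zv f w fB fd fw; apply: (dv_eq (hL := hL)) => n.
  by apply: (@dv_trans _ _ _ _ _ hL _ (f (v n))); rewrite // -fB fd.
exists y; split; first split=> //.
- apply: (lim _ _ yP (fun z => e * z)) => [a b|n a|n]; rewrite ?mulrBr //.
    exact: dvMl.
  by rewrite eu; apply: dvBC.
- apply: (lim _ _ yP (fun z => z * e)) => [a b|n a|n]; rewrite ?mulrBl //.
    by move=> /dvMr; apply.
  by rewrite ue; apply: dvBC.
- apply: (lim _ _ yP (fun z => (e + x) * z)) => [a b|n a|n]; rewrite ?mulrBr //.
    by apply: dvMl; apply: rpredD.
  by rewrite xu addrAC subrr add0r; apply: dvN.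
apply: (lim _ _ yP (fun z => z * (e + x))) => [a b|n a|n]; rewrite ?mulrBl //.
  by move=> /dvMr; apply; apply: rpredD.
by rewrite ux addrAC subrr add0r; apply: dvN.
Qed.

End Teichmuller.

(** * The corner ring of a primitive idempotent *)

Section Corner.
Variables (F : fieldType) (p : nat) (hF : local_field F p) (A : algType F).
Variables (L : set A) (hL : max_local_order hF L).
Local Notation o := (integers hF).
Local Notation pi := (unif hF).
Local Notation Lp := (mlo_pred hL).
Local Notation dv := (dv hL).

Variable e : A.
Hypotheses (eL : e \in Lp) (ee : e * e = e) (e0 : e != 0).

(** This is e A e, which [corner_division] shows to be a division algebra; [corner] is its order e L
    e. *)
Definition in_corner x := e * x = x /\ x * e = x.
Definition corner x := x \in Lp /\ in_corner x.

Hypothesis noidem : forall f, corner f -> f * f = f -> f = 0 \/ f = e.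

Variables (r s : nat) (hrs : teichmuller_exponents hL r s).

Definition corner_unit x := exists y, [/\ corner y, x * y = e & y * x = e].
(** The name anticipates [nilP]: the non-units are the elements with a power in pi L. *)
Definition corner_nil x := corner x /\ ~ corner_unit x.

Lemma corner_e : corner e.
Proof. by []. Qed.

Lemma in_cornerM x y : in_corner x -> in_corner y -> in_corner (x * y).
Proof. by move=> [ex _] [_ ye]; split; rewrite ?mulrA ?ex // -mulrA ye. Qed.

Lemma in_cornerB x y : in_corner x -> in_corner y -> in_corner (x - y).
Proof. by move=> [ex xe] [ey ye]; split; rewrite ?mulrBr ?mulrBl ?ex ?xe ?ey ?ye. Qed.

Lemma in_cornerZ c x : in_corner x -> in_corner (c *: x).
Proof. by move=> [ex xe]; split; rewrite -?scalerAr -?scalerAl ?ex ?xe. Qed.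

Lemma in_cornerX x n : in_corner x -> in_corner (x ^+ n.+1).
Proof.
move=> cx; elim: n => [|n IH]; first by rewrite expr1.
by rewrite exprS; apply: in_cornerM.
Qed.

Lemma cornerM x y : corner x -> corner y -> corner (x * y).
Proof. by move=> [? ?] [? ?]; split; [exact: rpredM | exact: in_cornerM]. Qed.

Lemma cornerB x y : corner x -> corner y -> corner (x - y).
Proof. by move=> [? ?] [? ?]; split; [exact: rpredB | exact: in_cornerB]. Qed.

Lemma cornerX x n : corner x -> corner (x ^+ n.+1).
Proof. by move=> [? ?]; split; [exact: rpredX | exact: in_cornerX]. Qed.

Lemma corner_sandwich x : x \in Lp -> corner (e * x * e).
Proof.
move=> xL; split; first by rewrite !rpredM.
by split; rewrite ?mulrA ?ee // -mulrA ee.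
Qed.

Lemma e_not_dv : ~ dv 1 e.
Proof.
move=> e1; case/negP: e0; apply/eqP/(dv_eq0 (hL := hL)).
by elim=> [|n IH]; [rewrite dv0 | rewrite -ee -addn1; apply: dvM].
Qed.

Lemma corner_unitP x a b : corner x -> a \in Lp -> b \in Lp ->
  x * a = e -> b * x = e -> corner_unit x.
Proof.
move=> [xL [ex xe]] aL bL xa bx; exists (e * a * e).
have xae : x * (e * a * e) = e by rewrite !mulrA xe xa ee.
split; rewrite //; first exact: corner_sandwich.
rewrite -[e * a * e]mulrA -{1}bx -!mulrA (mulrA x a) xa (mulrA e e) ee.
by rewrite ex.
Qed.

(** Multiplication by a finite geometric series turns e - x into [e - x ^+ n.+1], which is e modulo
    pi and is inverted by the infinite one. *)
Lemma unit_1Bnil x n : corner x -> dv 1 (x ^+ n.+1) -> corner_unit (e - x).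
Proof.
move=> cx xn; have [xL [ex xe]] := cx.
have cex : GRing.comm e x by rewrite /GRing.comm ex xe.
pose S := \sum_(i < n.+1) e ^+ (n - i) * x ^+ i.
have SL : S \in Lp by apply: rpred_sum => i _; rewrite rpredM ?rpredX.
have eX k : e ^+ k.+1 = e by elim: k => [|k IH]; rewrite ?expr1 // exprS IH ee.
have SE : (e - x) * S = e + - x ^+ n.+1 by rewrite -subrXX_comm // eX.
have SC : S * (e - x) = (e - x) * S.
  rewrite mulr_suml mulr_sumr; apply: eq_bigr => i _.
  have c1 : GRing.comm (e - x) (e ^+ (n - i)).
    by apply: commrX; apply/commr_sym/commrB => //; apply: commr_refl.
  have c2 : GRing.comm (e - x) (x ^+ i).
    by apply: commrX; apply/commr_sym/commrB; [apply: commr_sym | apply: commr_refl].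
  by rewrite -mulrA -c2 !mulrA c1.
have [_ [eXn Xne]] := cornerX n cx.
have [|||||y [[yL _ _ y1] y2]] := @mlo_inv_1Dunif _ _ _ _ _ hL e (- x ^+ n.+1) => //.
- by rewrite dvN.
- by rewrite mulrN eXn.
- by rewrite mulNr Xne.
apply: (@corner_unitP _ (S * y) (y * S)); rewrite ?rpredM //.
- by apply: cornerB.
- by rewrite mulrA SE y1.
by rewrite -mulrA SC SE.
Qed.

(** Let T be the representative of x. Its power of exponent p^r - 1 is an idempotent of the corner,
    hence 0 or e. If it is 0, then T = 0 and x^(p^s) lies in pi L; if it is e, then T is invertible
    and so is x^(p^s) = T + d with d in pi L. *)
Lemma corner_dichotomy x : corner x -> corner_unit x \/ exists n, dv 1 (x ^+ n.+1).
Proof.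
move=> cx; have [xL [ex xe]] := cx.
have [r0 rs /(_ x xL)[T [TL TQ xT _ /(_ e eL ex xe)[eT Te]]]] := hrs.
have Q1 : (1 < p ^ r)%N by rewrite -(exp1n r) ltn_exp2r // prime_gt1 ?(prime_p hF).
move: TQ; case: (p ^ r)%N Q1 => [//|[//|Q]] _ TQ.
have cT : corner T by [].
have ps : (0 < p ^ s)%N by rewrite expn_gt0 prime_gt0 ?(prime_p hF).
have ff : T ^+ Q.+1 * T ^+ Q.+1 = T ^+ Q.+1.
  by rewrite -exprD addSnnS addnC exprD TQ -exprS.
case: (noidem (cornerX Q cT) ff) => fE.
  right; exists (p ^ s).-1; rewrite prednK //.
  by move: xT; rewrite -TQ exprS fE mulr0 subr0.
left; pose T' := e * T ^+ Q; set d := x ^+ _ - T in xT.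
have xE : x ^+ (p ^ s) = T + d by rewrite addrC subrK.
have [_ [ed de]] : corner d.
  by rewrite /d -(prednK ps); apply: cornerB => //; apply: cornerX.
have T'L : T' \in Lp by rewrite rpredM ?rpredX.
have TT' : T * T' = e by rewrite mulrA Te -exprS.
have T'T : T' * T = e.
  rewrite /T' -mulrA -exprSr fE ee //.
have eT' : e * T' = T' by rewrite mulrA ee.
have T'e : T' * e = T'.
  have ceT : GRing.comm e T by rewrite /GRing.comm eT Te.
  by rewrite /T' -mulrA -(commrX Q ceT) mulrA ee.
clearbody T'.
have [|||||y [[yL _ _ y1] _]] := @mlo_inv_1Dunif _ _ _ _ _ hL e (d * T') => //.
- exact: dvMr.
- by rewrite mulrA ed.
- by rewrite -mulrA T'e.
have [|||||z [[zL _ _ _] z2]] := @mlo_inv_1Dunif _ _ _ _ _ hL e (T' * d) => //.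
- exact: dvMl.
- by rewrite mulrA eT'.
- by rewrite -mulrA de.
apply: (@corner_unitP _ (x ^+ (p ^ s).-1 * T' * y) (z * T' * x ^+ (p ^ s).-1)) => //.
- by rewrite !rpredM ?rpredX.
- by rewrite !rpredM ?rpredX.
- by rewrite !mulrA -exprS prednK // xE mulrDl TT' y1.
by rewrite -mulrA -exprSr prednK // xE -mulrA mulrDr T'T.
Qed.

Lemma nilP x : corner x -> corner_nil x <-> exists n, dv 1 (x ^+ n.+1).
Proof.
move=> cx; split=> [[_ nux]|[n xn]]; first by case: (corner_dichotomy cx).
split=> // -[y [cy xy yx]]; apply: e_not_dv.
have <- : x ^+ n.+1 * y ^+ n.+1 = e; last first.
  by apply: dvMr => //; rewrite rpredX //; case: cy.
have [_ [ex xe]] := cx.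
elim: n {xn} => [|n IH]; first by rewrite !expr1.
by rewrite exprSr (exprS y) mulrA -(mulrA _ x y) xy (cornerX n cx).2.2 IH.
Qed.

Lemma nil_corner x : corner_nil x -> corner x.
Proof. by case. Qed.

(** If z inverts x * y, then y * z * x is a nonzero idempotent, hence e, and y * z inverts x. *)
Lemma nilMr x y : corner_nil x -> corner y -> corner_nil (x * y).
Proof.
move=> [cx nux] cy; split; first exact: cornerM.
move=> [z [cz xyz zxy]]; apply: nux.
have cw : corner (y * z * x) by apply: cornerM => //; apply: cornerM.
have [_ [ex _]] := cx.
have xw : x * (y * z * x) = x by rewrite !mulrA xyz ex.
case: (noidem cw); first by rewrite -(mulrA (y * z)) xw.
  move=> w0; case/negP: e0; apply/eqP.
  by rewrite -xyz -xw w0 mulr0 !mul0r.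
by move=> we; exists (y * z); split; rewrite ?mulrA //; apply: cornerM.
Qed.

Lemma nilMl x y : corner_nil x -> corner y -> corner_nil (y * x).
Proof.
move=> [cx nux] cy; split; first exact: cornerM.
move=> [z [cz yxz zyx]]; apply: nux.
have cw : corner (x * (z * y)) by apply: cornerM => //; apply: cornerM.
have [_ [_ xe]] := cx.
have wx : x * (z * y) * x = x by rewrite -!mulrA zyx xe.
case: (noidem cw); first by rewrite mulrA wx.
  move=> w0; case/negP: e0; apply/eqP.
  by rewrite -zyx -wx w0 mul0r !mulr0.
by move=> we; exists (z * y); split; rewrite -?mulrA //; apply: cornerM.
Qed.

Lemma nil_unif : corner_nil (pi *: e).
Proof.
have pL : pi *: e \in Lp by rewrite mlo_predZ ?unif_integers.
have cp : corner (pi *: e) by split=> //; apply: in_cornerZ.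
apply/(nilP cp); exists 0; rewrite expr1 -[pi]expr1 dv_scale //.
Qed.

(** The factor e makes the empty product the unit of the corner instead of that of A. *)
Definition nil_prod (t : seq A) := e * \prod_(x <- t) x.

Lemma nil_prod_rcons t x : nil_prod (rcons t x) = nil_prod t * x.
Proof. by rewrite /nil_prod -cats1 big_cat big_seq1 mulrA. Qed.

Lemma nil_prod_cons t x : corner x -> nil_prod (x :: t) = x * nil_prod t.
Proof. by move=> [_ [ex xe]]; rewrite /nil_prod big_cons !mulrA ex xe. Qed.

Lemma nil_prod_nil t x : corner_nil x -> (forall y, y \in t -> corner_nil y) ->
  corner_nil (nil_prod (x :: t)).
Proof.
elim/last_ind: t => [|t y IH] nx tn.
  by rewrite (nil_prod_rcons [::]) /nil_prod big_nil mulr1 (nil_corner nx).2.1.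
rewrite -rcons_cons nil_prod_rcons; apply: nilMr; last first.
  by apply/nil_corner/tn; rewrite mem_rcons mem_head.
by apply: IH => // z zt; apply: tn; rewrite mem_rcons inE zt orbT.
Qed.

Lemma nil_prod_corner t : (forall y, y \in t -> corner_nil y) -> corner (nil_prod t).
Proof.
case: t => [_|x t xt]; first by rewrite /nil_prod big_nil mulr1; apply: corner_e.
apply/nil_corner/nil_prod_nil; first by apply: xt; rewrite mem_head.
by move=> y yt; apply: xt; rewrite inE yt orbT.
Qed.

Lemma nil_prod_cat t u : (forall y, y \in t -> corner_nil y) ->
  nil_prod (t ++ u) = nil_prod t * nil_prod u.
Proof.
move=> /nil_prod_corner[_ [_ te]].
by rewrite /nil_prod big_cat /= !mulrA te.
Qed.

(* Among the initial products of a long word two are congruent mod pi, say P and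
   P w with w nilpotent, and e - w is a unit. *)
Lemma nil_prod_dv : exists K, forall t, (K <= size t)%N ->
  (forall y, y \in t -> corner_nil y) -> dv 1 (nil_prod t).
Proof.
have [K KP] := residue_pigeonhole hL; exists K => t Kt tn.
have tkn k : forall y, y \in take k t -> corner_nil y by move=> y /mem_take; apply: tn.
have [|i [j [ij jK dij]]] := KP (fun i => nil_prod (take i t)).
  by move=> i; have [] := nil_prod_corner (tkn i).
have jt : (j <= size t)%N := leq_trans jK Kt.
set P := nil_prod (take i t) in dij.
have cP : corner P := nil_prod_corner (tkn i).
have tjE : take j t = take i t ++ drop i (take j t).
  by rewrite -{1}(cat_take_drop i (take j t)) take_takel // ltnW.
have nw : corner_nil (nil_prod (drop i (take j t))).
  have : (0 < size (drop i (take j t)))%N by rewrite size_drop size_takel // subn_gt0.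
  have : forall y, y \in drop i (take j t) -> corner_nil y.
    by move=> y /mem_drop; apply: tkn.
  case: drop => // x u xun _; apply: nil_prod_nil; first by apply: xun; rewrite mem_head.
  by move=> y yu; apply: xun; rewrite inE yu orbT.
set w := nil_prod _ in nw; have cw := nil_corner nw.
have [n wn] := (nilP cw).1 nw.
have [z [[zL _] wz _]] := unit_1Bnil cw wn.
have Pd : dv 1 P.
  have tjw : nil_prod (take j t) = P * w by rewrite tjE (nil_prod_cat _ (tkn i)).
  have -> : P = (P - nil_prod (take j t)) * z.
    have [_ [_ Pe]] := cP.
    by rewrite tjw -[X in X - _]Pe -mulrBr -mulrA wz Pe.
  exact: dvMr.
rewrite -(cat_take_drop i t) (nil_prod_cat _ (tkn i)); apply: dvMr Pd _.
have [|] // := @nil_prod_corner (drop i t).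
by move=> y /mem_drop; apply: tn.
Qed.

(** Take the least K such that every product of K non-units lies in pi L; then y is a product of K -
    1 non-units outside pi L. Modulo pi it is annihilated by the non-units on both sides. *)
Lemma socle_elt : exists y, [/\ corner y, ~ dv 1 y,
  forall x, corner_nil x -> dv 1 (x * y) & forall x, corner_nil x -> dv 1 (y * x)].
Proof.
have [|K KP Kmin] := @ex_min_nat (fun K => forall t, size t = K ->
    (forall y, y \in t -> corner_nil y) -> dv 1 (nil_prod t)).
  by have [K KP] := nil_prod_dv; exists K => t tK; apply: KP; rewrite tK.
case: K KP Kmin => [|K] KP Kmin.
  by case: e_not_dv; have := KP [::] erefl; rewrite /nil_prod big_nil mulr1; apply.
have [[t [tK tn tdv]]|noT] := pselect (exists t, [/\ size t = K,
    forall y, y \in t -> corner_nil y & ~ dv 1 (nil_prod t)]).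
  exists (nil_prod t); split=> // [|x nx|x nx]; first exact: nil_prod_corner.
    rewrite -nil_prod_cons; last exact: nil_corner.
    by apply: KP => /= [|y]; [rewrite tK | rewrite inE => /orP[/eqP->|/tn]].
  rewrite -nil_prod_rcons; apply: KP => [|y]; first by rewrite size_rcons tK.
  by rewrite mem_rcons inE => /orP[/eqP->|/tn].
have := Kmin K; rewrite ltnn; case/(_ _)/notF => t tK tn.
by apply: contrapT => tdv; apply: noT; exists t.
Qed.

(* The order generated by L and an order of the corner containing e L e. *)
Inductive sandwich (H : A -> Prop) : A -> Prop :=
| Sandwich0 : sandwich H 0
| SandwichS a h b w : a \in Lp -> H h -> b \in Lp -> sandwich H w ->
    sandwich H (a * h * b + w).

Lemma sandwichD H x y : sandwich H x -> sandwich H y -> sandwich H (x + y).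
Proof.
move=> Hx Hy; elim: Hx => [|a h b w aL Hh bL _ IH]; first by rewrite add0r.
by rewrite -addrA; apply: SandwichS.
Qed.

Lemma sandwichMl H c x : c \in Lp -> sandwich H x -> sandwich H (c * x).
Proof.
move=> cL; elim=> [|a h b w aL Hh bL _ IH]; first by rewrite mulr0; apply: Sandwich0.
by rewrite mulrDr !mulrA; apply: SandwichS; rewrite ?rpredM.
Qed.

Lemma sandwichMr H c x : c \in Lp -> sandwich H x -> sandwich H (x * c).
Proof.
move=> cL; elim=> [|a h b w aL Hh bL _ IH]; first by rewrite mul0r; apply: Sandwich0.
by rewrite mulrDl -!mulrA mulrA; apply: SandwichS; rewrite ?rpredM.
Qed.

Lemma sandwichN H x : sandwich H x -> sandwich H (- x).
Proof. by rewrite -mulN1r; apply: sandwichMl; rewrite rpredN rpred1. Qed.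

Lemma sandwich_gen (H : A -> Prop) h : H h -> sandwich H h.
Proof.
move=> Hh; rewrite -[h]addr0 -[h]mulr1 -[h in h * 1]mul1r.
by apply: SandwichS; rewrite ?rpred1 //; apply: Sandwich0.
Qed.

(** Maximality descends to the corner: L + L H L is a ring, because between two elements of H a
    factor b * a' from L may be replaced by e * (b * a') * e, which lies in e L e and so in H. *)
Lemma mlo_corner_max (H : A -> Prop) k :
  (forall h, H h -> in_corner h) -> (forall h, corner h -> H h) ->
  (forall g h, H g -> H h -> H (g * h)) ->
  (forall h, H h -> pi ^+ k *: h \in Lp) ->
  forall h, H h -> h \in Lp.
Proof.
move=> Hc cH HM Hk h Hh.
have sM x y : sandwich H x -> sandwich H y -> sandwich H (x * y).
  move=> Hx Hy; elim: Hx => [|a g b w aL Hg bL _ IH].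
    by rewrite mul0r; apply: Sandwich0.
  rewrite mulrDl; apply: sandwichD IH.
  elim: Hy => [|a' g' b' w' a'L Hg' b'L _ IH]; first by rewrite mulr0; apply: Sandwich0.
  rewrite mulrDr; apply: sandwichD IH.
  have -> : a * g * b * (a' * g' * b') = a * (g * (e * (b * a') * e) * g') * b' + 0.
    by rewrite addr0 !mulrA -(mulrA a g e) (Hc _ Hg).2 -(mulrA _ e g') (Hc _ Hg').1.
  apply: SandwichS => //; last exact: Sandwich0.
  by apply: (HM) => //; apply: (HM) => //; apply/cH/corner_sandwich/rpredM.
pose Gam : set A := fun x => exists l w, [/\ l \in Lp, sandwich H w & x = l + w].
have : Gam h by exists 0, h; rewrite rpred0 add0r; split=> //; apply: sandwich_gen.
move=> Gh; apply/(mlo_predE hL); apply: (mlo_max hL) Gh.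
- split.
  + by exists 1, 0; rewrite rpred1 addr0; split=> //; apply: Sandwich0.
  + move=> _ _ [l [w [lL Hw ->]]] [l' [w' [l'L Hw' ->]]].
    exists (l - l'), (w - w'); rewrite rpredB // opprD addrACA; split=> //.
    by apply: sandwichD => //; apply: sandwichN.
  move=> _ _ [l [w [lL Hw ->]]] [l' [w' [l'L Hw' ->]]].
  exists (l * l'), (l * w' + w * l' + w * w'); rewrite rpredM //; split=> //.
    by apply: sandwichD; [apply: sandwichD; [apply: sandwichMl|apply: sandwichMr]|apply: sM].
  by rewrite mulrDl !mulrDr !addrA.
- by move=> x /(mlo_predE hL) xL; exists x, 0; rewrite addr0; split=> //; apply: Sandwich0.
exists k => _ [l [w [lL Hw ->]]]; apply/(mlo_predE hL).
rewrite scalerDr rpredD //.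
  by rewrite mlo_predZ ?unifX_integers.
elim: Hw => [|a g b w' aL Hg bL _ IH]; first by rewrite scaler0 rpred0.
by rewrite scalerDr rpredD // scalerAl scalerAr !rpredM // Hk.
Qed.

(** The classical argument that the maximal ideal of a maximal order is invertible. With y from
    [socle_elt], the element x0 = y / pi carries non-units into e L e but is not in L. By maximality
    it cannot carry every non-unit to a non-unit, so x0 * a is a unit for some non-unit a; this a is
    the uniformizer P. *)
Lemma corner_uniformizer : exists P x, [/\ corner_nil P, in_corner x, P * x = e, x * P = e &
  forall n, corner_nil n -> x * n \in Lp].
Proof.
have [y [cy ydv Ny yN]] := socle_elt.
pose x0 := pi^-1 *: y.
have cx0 : in_corner x0 by apply: in_cornerZ; case: cy.
have x0N n : corner_nil n -> corner (x0 * n).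
  move=> nn; split; last by apply: in_cornerM => //; have [[]] := nn.
  by have := yN n nn; rewrite /dv expr1 -scalerAl.
have Nx0 n : corner_nil n -> corner (n * x0).
  move=> nn; split; last by apply: in_cornerM => //; have [[]] := nn.
  by have := Ny n nn; rewrite /dv expr1 -scalerAr.
have [a na ux0a] : exists2 a, corner_nil a & corner_unit (x0 * a).
  apply: contrapT => noa; apply: ydv; rewrite /dv expr1 -/x0.
  pose H h := in_corner h /\ forall n, corner_nil n -> corner_nil (h * n).
  (* H consists of the multipliers of the set of non-units. The exponent is 1 since pi e is a
     non-unit, so that pi h = h * (pi e) is integral for h in H. *)
  apply: (@mlo_corner_max H 1).
  - by move=> h [].
  - by move=> h ch; split=> [|n nn]; [case: ch | apply: nilMl].
  - move=> g h [cg gN] [ch hN]; split=> [|n nn]; first exact: in_cornerM.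
    by rewrite -mulrA; apply/gN/hN.
  - move=> h [ch hN]; have [[]] := hN _ nil_unif.
    by rewrite -scalerAr ch.2 expr1.
  split=> // n nn; split; first exact: x0N.
  by move=> un; apply: noa; exists n.
have [z [cz x0az zx0a]] := ux0a.
pose x1 := z * x0.
have cx1 : in_corner x1 by apply: in_cornerM => //; case: cz.
have x1a : x1 * a = e by rewrite -mulrA.
have cax1 : corner (a * x1).
  rewrite /x1 mulrA; apply/Nx0/nilMr => //.
have [ea ae] : in_corner a by have [[]] := na.
have ax1 : a * x1 = e.
  case: (noidem cax1) => [|ax0|//]; first by rewrite mulrA -(mulrA a) x1a ae.
  by case/negP: e0; apply/eqP; rewrite -x1a -cx1.1 -x1a -(mulrA x1 a) ax0 mulr0 mul0r.
exists a, x1; split=> // n nn; rewrite -mulrA; apply: rpredM; first by case: cz.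
by case: (x0N n nn).
Qed.

Lemma in_cornerXl x d j : in_corner x -> e * d = d -> e * (x ^+ j * d) = x ^+ j * d.
Proof.
move=> [ex _] ed; case: j => [|j]; first by rewrite expr0 mul1r.
by rewrite exprS !mulrA ex.
Qed.

Lemma cornerXK x y d j : in_corner x -> in_corner y -> x * y = e -> e * d = d ->
  x ^+ j * (y ^+ j * d) = d.
Proof.
move=> cx cy xy ed; elim: j => [|j IH]; first by rewrite !expr0 !mul1r.
by rewrite exprSr (exprS y) -!mulrA (mulrA x) xy in_cornerXl.
Qed.

(** Divide d by P as long as the quotient stays in L. This stops because the powers of P tend to 0,
    and the last quotient is a unit, since a non-unit could be divided once more. *)
Lemma corner_factor : exists P x, [/\ corner_nil P, in_corner x, P * x = e, x * P = e &
  forall d, corner d -> d != 0 -> exists j u, [/\ corner u, corner_unit u & d = P ^+ j * u]].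
Proof.
have [P [x [nP cx Px xP xN]]] := corner_uniformizer.
exists P, x; split=> // d [dL [ed de]] d0.
have cP := nil_corner nP; have cPc := cP.2.
have dE j : d = P ^+ j * (x ^+ j * d) by rewrite cornerXK.
have [|m xm mmin] := @ex_min_nat (fun m => x ^+ m * d \notin Lp).
  apply: contrapT => noM; case/negP: d0; apply/eqP/(dv_eq0 (hL := hL)) => k.
  have [n Pn] := (nilP cP).1 nP.
  rewrite (dE (n.+1 * k)%N); apply: dvMr; last first.
    by apply: contrapT => /negP xd; apply: noM; exists (n.+1 * k)%N.
  elim: k => [|k IH]; first by rewrite muln0 expr0 dv0 rpred1.
  by rewrite mulnS addnC exprD -addn1; apply: dvM.
case: m xm mmin => [|j] xm mmin; first by rewrite expr0 mul1r dL in xm.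
have xjL : x ^+ j * d \in Lp.
  by apply: contrapT => /negP xj; have := mmin _ xj; rewrite ltnn.
have cu : corner (x ^+ j * d).
  by split=> //; split; [apply: in_cornerXl | rewrite -mulrA de].
exists j, (x ^+ j * d); split=> //.
apply: contrapT => nu; case/negP: xm; rewrite exprS -mulrA; exact: xN.
Qed.

Lemma corner_division d : in_corner d -> d != 0 ->
  exists d', [/\ in_corner d', d * d' = e & d' * d = e].
Proof.
move=> cd d0; have [P [x [nP cx Px xP fac]]] := corner_factor.
have [k /(mlo_predE hL) kd] := mlo_span hL d.
have [||j [u [cu [v [cv uv vu]] dE]]] := fac (pi ^+ k *: d).
- by split=> //; apply: in_cornerZ.
- by rewrite scaler_eq0 (negPf d0) orbF unifX_neq0.
have cPc := (nil_corner nP).2.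
have exe : e * (x ^+ j * e) = x ^+ j * e by apply: in_cornerXl.
(* The factor e is needed for j = 0, where the power of x is the unit of A and not of the corner. *)
exists (pi ^+ k *: (v * (x ^+ j * e))); split.
- apply: in_cornerZ; split; first by rewrite mulrA cv.2.1.
  by rewrite -!mulrA ee.
- rewrite -scalerAr scalerAl dE -!mulrA (mulrA u) uv exe cornerXK //.
rewrite -scalerAl scalerAr dE -!mulrA.
by rewrite (in_cornerXl _ cPc cu.2.1) cornerXK // cu.2.1.
Qed.

Lemma corner_integral d e' : in_corner d -> in_corner e' -> d * e' = 0 -> d != 0 -> e' = 0.
Proof.
move=> cd [ee' _] de d0; have [d' [_ _ d'd]] := corner_division cd d0.
by rewrite -ee' -d'd -mulrA de mulr0.
Qed.

(** * Commutativity of the centralizer of a root of unity *)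

Section Centralizer.
Variable T : A.
Hypothesis cT : corner T.
Let cent c := corner c /\ c * T = T * c.
Hypothesis centP : forall c, cent c ->
  exists c0, [/\ cent c0, forall d, cent d -> c0 * d = d * c0 & corner_nil (c - c0)].

Lemma centB c d : cent c -> cent d -> cent (c - d).
Proof.
by move=> [cc cC] [cd dC]; split; [exact: cornerB | rewrite mulrBl mulrBr cC dC].
Qed.

(** Take c1 of least P-adic order j0 among the nonzero non-units of the centralizer. The quotient of
    another non-unit by c1 is then integral, and it commutes with T because the corner has no zero
    divisors. *)
Lemma cent_uniformizer : exists2 c1, cent c1 /\ corner_nil c1 &
  forall c, cent c -> corner_nil c -> exists2 c', cent c' & c = c1 * c'.
Proof.
have [P [x [nP cx Px xP fac]]] := corner_factor.
have cPc := (nil_corner nP).2.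
pose Q j := exists c u, [/\ cent c, corner_nil c, corner u, corner_unit u & c = P ^+ j * u].
have pe0 : pi *: e != 0 by rewrite scaler_eq0 (negPf e0) orbF unif_neq0.
have [|j0 [c1 [u1 [cc1 nc1 cu1 [v1 [cv1 uv1 vu1]] c1E]]] j0min] := @ex_min_nat Q.
  have [j [u [cu uu uE]]] := fac _ (nil_corner nil_unif) pe0.
  exists j, (pi *: e), u; split; rewrite //; last exact: nil_unif.
  split; first exact: nil_corner nil_unif.
  by rewrite -scalerAl -scalerAr cT.2.1 cT.2.2.
exists c1; first by split.
move=> c cc nc; have [->|c0] := eqVneq c 0.
  by exists (c1 - c1); [apply: centB | rewrite subrr mulr0].
have [i [u [cu uu cE]]] := fac c (nil_corner nc) c0.
have j0i : (j0 <= i)%N by apply: j0min; exists c, u.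
have ec : e * c = c by case: cc => [[_ []]].
have xc : x ^+ j0 * c = P ^+ (i - j0) * u.
  by rewrite cE -(subnKC j0i) addKn exprD -mulrA cornerXK // in_cornerXl // cu.2.1.
have cc' : corner (v1 * (x ^+ j0 * c)).
  apply: cornerM => //; rewrite xc; split.
    by rewrite rpredM ?rpredX //; [case: (nil_corner nP) | case: cu].
  by split; [apply: in_cornerXl => //; case: cu => _ [] | rewrite -mulrA cu.2.2].
have c1c' : c1 * (v1 * (x ^+ j0 * c)) = c.
  by rewrite c1E -mulrA (mulrA u1) uv1 in_cornerXl // cornerXK.
exists (v1 * (x ^+ j0 * c)) => //; split=> //.
set c' := v1 * _ in cc' c1c' *; clearbody c'.
apply/eqP; rewrite -subr_eq0; apply/eqP.
apply: (@corner_integral c1).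
- by case: cc1 => [[]].
- by apply: in_cornerB; apply: in_cornerM; case: cT; case: cc'.
- by rewrite mulrBr !mulrA c1c' cc1.2 -mulrA c1c' cc.2 subrr.
apply: contraNneq c0 => c10; by rewrite -c1c' c10 mul0r.
Qed.

(** Write c = c0 + c1 c' with c0 central in the centralizer. Once c1 is known to be central, [c, d]
    = c1 [c', d]; by iteration the commutator is divisible by every power of c1 and vanishes. The
    same argument with d = c1 comes first and shows that c1 is central. *)
Lemma cent_commutative c d : cent c -> cent d -> c * d = d * c.
Proof.
have [c1 [cc1 nc1] c1P] := cent_uniformizer.
have [n c1n] := (nilP (nil_corner nc1)).1 nc1.
have iter0 (f : A -> A) : (forall c, cent c -> f c \in Lp) ->
    (forall c, cent c -> exists2 c', cent c' & f c = c1 * f c') ->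
    forall c, cent c -> f c = 0.
  move=> fL fS {}c cc; apply: (dv_eq0 (hL := hL)) => k.
  have [c' cc' ->] : exists2 c', cent c' & f c = c1 ^+ (n.+1 * k) * f c'.
    elim: (n.+1 * k)%N => [|m [c' cc' ->]]; first by exists c; rewrite ?expr0 ?mul1r.
    by have [c'' cc'' ->] := fS c' cc'; exists c''; rewrite // exprSr mulrA.
  apply: dvMr; last exact: fL.
  elim: k => [|k IH]; first by rewrite muln0 expr0 dv0 rpred1.
  by rewrite mulnS addnC exprD -addn1; apply: dvM.
have cL x : cent x -> x \in Lp by case=> [[]].
have c1C x : cent x -> x * c1 = c1 * x.
  move=> cx; apply/eqP; rewrite -subr_eq0; apply/eqP.
  apply: (iter0 (fun x => x * c1 - c1 * x)) cx => y cy.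
    by rewrite rpredB // rpredM // cL.
  have [y0 [cy0 y0C nil_yy0]] := centP cy.
  have [y' cy' yE] := c1P _ (centB cy cy0) nil_yy0.
  exists y' => //; rewrite -(subrK y0 y) yE mulrDl mulrDr y0C // opprD addrACA subrr addr0.
  by rewrite mulrBr !mulrA.
move=> cc cd; apply/eqP; rewrite -subr_eq0; apply/eqP.
apply: (iter0 (fun x => x * d - d * x)) cc => y cy.
  by rewrite rpredB // rpredM // cL.
have [y0 [cy0 y0C nil_yy0]] := centP cy.
have [y' cy' yE] := c1P _ (centB cy cy0) nil_yy0.
exists y' => //; rewrite -(subrK y0 y) yE mulrDl mulrDr y0C // opprD addrACA subrr addr0.
by rewrite mulrBr !mulrA c1C.
Qed.

End Centralizer.

(* The hypothesis on T says that F(T) contains every root of unity of order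
   prime to p in its centralizer. *)
Lemma teichmuller_centralizer T : corner T ->
  (forall T', corner T' -> T' ^+ (p ^ r) = T' -> T' * T = T * T' ->
     forall d, corner d -> d * T = T * d -> T' * d = d * T') ->
  forall c d, in_corner c -> in_corner d -> c * T = T * c -> d * T = T * d ->
  c * d = d * c.
Proof.
move=> cT maxT.
have comm c d : corner c /\ c * T = T * c -> corner d /\ d * T = T * d -> c * d = d * c.
  apply: (cent_commutative cT) => {c d} - c [cc cC].
  have [cL [ec ce]] := cc.
  have [r0 rs /(_ c cL)[c0 [c0L c0Q cc0 c0C /(_ e eL ec ce)[ec0 c0e]]]] := hrs.
  have cc0' : corner c0 by [].
  have c0T : c0 * T = T * c0 by rewrite c0C //; case: cT.
  exists c0; split=> //; first by move=> d [cd dC]; apply: maxT.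
  have ps : (0 < p ^ s)%N by rewrite expn_gt0 prime_gt0 ?(prime_p hF).
  apply/(nilP (cornerB cc cc0')); exists (p ^ s).-1; rewrite prednK //.
  (* As [r %| s], Frobenius gives that (c - c0)^(p^s) is congruent to c^(p^s) - c0, hence to 0,
     modulo pi. *)
  have c0s : c0 ^+ (p ^ s) = c0.
    case/dvdnP: rs => q ->; elim: q => [|q IH]; first by rewrite mul0n expn0 expr1.
    by rewrite mulSn expnD exprM c0Q.
  have := dv_frobenius s cL c0L (c0C c cL erefl).
  rewrite c0s => h; rewrite -(subrK (c ^+ (p ^ s) - c0) ((c - c0) ^+ _)).
  exact: dvD.
move=> c d cc cd cC dC.
have [k /(mlo_predE hL) kc] := mlo_span hL c.
have [l /(mlo_predE hL) ld] := mlo_span hL d.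
apply: (scalerI (unifX_neq0 hF k)); apply: (scalerI (unifX_neq0 hF l)).
rewrite [in LHS]scalerAl [in LHS]scalerAr [in RHS]scalerAr [in RHS]scalerAl.
by apply: comm; split; rewrite -?scalerAl -?scalerAr ?cC ?dC //; split=> //;
   apply: in_cornerZ.
Qed.

End Corner.

(** * Unramified elements and the reduced trace *)

Lemma prim_root_exists (E : closedFieldType) n : (0 < n)%N -> n%:R != 0 :> E ->
  exists z : E, n.-primitive_root z.
Proof.
move=> n0 nE; have [rs rsE] := closed_field_poly_normal ('X^n - 1 : {poly E}).
rewrite (monicP _) ?monicXnsubC // scale1r in rsE.
have [|||z _ zP] := hasP (@has_prim_root E n rs n0 _ _ _); last by exists z.
- apply/allP => z zrs; rewrite unity_rootE -[z ^+ n == 1]subr_eq0.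
  have : root (\prod_(z <- rs) ('X - z%:P)) z by rewrite root_prod_XsubC.
  by rewrite -rsE /root !hornerE.
- by rewrite -separable_prod_XsubC -rsE separable_Xn_sub_1.
- by rewrite -ltnS -(size_prod_XsubC _ id) -rsE size_XnsubC.
Qed.

(** * Eigenvectors, and idempotent matrices of trace one *)

Section Eigenvectors.
Variables (E : closedFieldType) (n : nat).
Implicit Types (X Y Z : 'M[E]_n.+1) (v w : 'rV[E]_n.+1).

(** Z is a product of some of the factors X - z. Only its commutation property is recorded: it makes
    [v *m Z] an eigenvector of every matrix that commutes with X and has v as an eigenvector. *)
Lemma eigenvector_prod X v (rs : seq E) : v != 0 ->
  v *m \prod_(z <- rs) (X - z%:M) = 0 ->
  exists l Z, [/\ v *m Z != 0, v *m Z *m X = l *: (v *m Z) &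
    forall Y, Y * X = X * Y -> Y * Z = Z * Y].
Proof.
elim: rs v => [|z rs IH] v v0; first by rewrite big_nil mulmx1 => v0'; rewrite v0' eqxx in v0.
rewrite big_cons mulmxA; have [vz _|vz] := eqVneq (v *m (X - z%:M)) 0.
  exists z, 1; rewrite mulmx1; split=> // [|Y _]; last by rewrite mulr1 mul1r.
  by apply/eqP; rewrite -subr_eq0 -mul_mx_scalar -mulmxBr vz.
case/(IH _ vz)=> l [Z [wZ wZX ZC]].
exists l, ((X - z%:M) * Z); rewrite mulmxA; split=> // Y YX.
have -> : Y * ((X - z%:M) * Z) = (X - z%:M) * Y * Z.
  rewrite mulrA; congr (_ * _); rewrite mulrBr mulrBl YX; congr (_ - _).
  exact: scalar_mxC.
by rewrite -!mulrA ZC.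
Qed.

Lemma eigenvector_unity X v N : (0 < N)%N -> v != 0 -> v *m X ^+ N = v ->
  exists l Z, [/\ l ^+ N = 1, v *m Z != 0, v *m Z *m X = l *: (v *m Z) &
    forall Y, Y * X = X * Y -> Y * Z = Z * Y].
Proof.
move=> N0 v0 vX.
have [rs rsE] := closed_field_poly_normal ('X^N - 1 : {poly E}).
have : v *m \prod_(z <- rs) (X - z%:M) = 0.
  have : horner_mx X ('X^N - 1) = \prod_(z <- rs) (X - z%:M).
    rewrite rsE (monicP _) ?monicXnsubC // scale1r rmorph_prod /=.
    by apply: eq_bigr => z _; rewrite rmorphB /= horner_mx_X horner_mx_C.
  move=> <-; rewrite rmorphB rmorphXn rmorph1 /= horner_mx_X.
  by rewrite mulmxBr mulmx1 vX subrr.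
case/(eigenvector_prod v0) => l [Z [vZ vZX ZC]].
exists l, Z; split=> //.
have vZXk k : v *m Z *m X ^+ k = l ^+ k *: (v *m Z).
  elim: k => [|k IH]; first by rewrite !expr0 mulmx1 scale1r.
  by rewrite exprSr -[X ^+ k * X]/(X ^+ k *m X) mulmxA IH -scalemxAl vZX scalerA -exprSr.
have := vZXk N; rewrite -mulmxA -[Z *m _]/(Z * X ^+ N) -ZC; last first.
  by rewrite -exprSr exprS.
rewrite mulmxA vX => /eqP; rewrite -{1}[v *m Z]scale1r -subr_eq0 -scalerBl.
by rewrite scaler_eq0 (negPf vZ) orbF subr_eq0 => /eqP.
Qed.

(* If M = C R is a full rank factorization then R C = 1 and M Y M = C (R Y C) R,
   where R Y C is an arbitrary matrix. *)
Lemma trace_idempotent_comm (M : 'M[E]_n.+1) : M != 0 -> M * M = M ->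
  (forall Y Z, (M * Y * M) * (M * Z * M) = (M * Z * M) * (M * Y * M)) ->
  \tr M = 1.
Proof.
move=> M0 MM MC; pose C := col_base M; pose R := row_base M.
have CR : M = C *m R by rewrite mulmx_base.
have RC : R *m C = 1%:M.
  apply: (row_free_inj (row_base_free M)); apply: (row_full_inj (col_base_full M)).
  by rewrite mul1mx -/C -/R -CR -mulmxA -CR mulmxA -CR mulmxE MM.
have : (0 < \rank M)%N by rewrite lt0n mxrank_eq0.
move: (\rank M) C R CR RC => k C R CR RC k0.
have rk1 : (k <= 1)%N.
  rewrite leqNgt; apply/negP => rk.
  have comm (W W' : 'M[E]_k) : W *m W' = W' *m W.
    have sand (V : 'M[E]_k) : M * (C *m V *m R) * M = C *m V *m R.
      rewrite -!mulmxE CR -!mulmxA (mulmxA R C) RC mul1mx.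
      by rewrite (mulmxA R C) RC mul1mx.
    have := MC (C *m W *m R) (C *m W' *m R); rewrite !sand -!mulmxE.
    rewrite -!mulmxA !(mulmxA R C) RC !mul1mx.
    move/(congr1 (fun Y => R *m Y *m C)).
    by rewrite !mulmxA RC !mul1mx -!mulmxA RC !mulmx1.
  pose i0 : 'I_k := Ordinal (ltnW rk); pose i1 : 'I_k := Ordinal rk.
  have /matrixP/(_ i0 i0) := comm (delta_mx i0 i1) (delta_mx i1 i0).
  rewrite !mul_delta_mx !mxE !eqxx /= => /eqP.
  by rewrite oner_eq0.
have {k0 rk1} rk : k = 1%N by apply/eqP; rewrite eqn_leq rk1.
by rewrite CR mxtrace_mulC RC mxtrace1 rk.
Qed.

End Eigenvectors.

(** * A maximal unramified element and its spectral projection *)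

Section Key.
Variables (F : fieldType) (p : nat) (hF : local_field F p) (A : algType F).
Variables (L : set A) (hL : max_local_order hF L).
Variables (E : closedFieldType) (n : nat) (phi : {rmorphism F -> E}).
Variables (rho : {rmorphism A -> 'M[E]_n.+1}).
Local Notation Lp := (mlo_pred hL).

Variable e : A.
Hypotheses (eL : e \in Lp) (ee : e * e = e) (rhoe0 : rho e != 0).
Hypothesis noidem : forall f, corner hL e f -> f * f = f -> f = 0 \/ f = e.
Variables (r s : nat) (hrs : teichmuller_exponents hL r s).

Local Notation N := (p ^ r).-1.
Local Notation corner := (corner hL e).

Lemma rho_idem_neq0 : e != 0.
Proof. by apply: contraNneq rhoe0 => ->; rewrite rmorph0. Qed.

Lemma teich_order_gt0 : (0 < N)%N.
Proof.
have [r0 _ _] := hrs; rewrite -ltnS prednK ?expn_gt0 ?prime_gt0 ?(prime_p hF) //.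
by rewrite -(exp1n r) ltn_exp2r // prime_gt1 ?(prime_p hF).
Qed.

(** The roots of unity of the corner. Their powers are written with exponents [k.+1], because the
    power 0 would be 1 instead of e. *)
Definition teich_unit x := corner x /\ x ^+ N = e.

Lemma teich_unitX x k : teich_unit x -> x ^+ (N * k.+1) = e.
Proof.
move=> [_ xN]; elim: k => [|k IH]; first by rewrite muln1.
by rewrite mulnS exprD xN IH ee.
Qed.

Lemma teich_unit_mod x k : teich_unit x -> x ^+ k.+1 = x ^+ (k %% N).+1.
Proof.
move=> ux; have [cx _] := ux; rewrite {1}(divn_eq k N).
case: (k %/ N)%N => [|q]; first by rewrite mul0n add0n.
by rewrite -addnS mulnC exprD teich_unitX // (cornerX _ cx).2.1.
Qed.

(** A finite group of roots of unity in a field is cyclic, seen through eigenvalues: on a common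
    eigenvector w' of rho x and rho y, a Bezout combination z has an eigenvalue of which both others
    are powers. A corner element whose image kills w' is 0, since otherwise it would be invertible;
    so x and y are themselves powers of z. *)
Lemma teich_unit_comm x y : teich_unit x -> teich_unit y -> x * y = y * x ->
  exists z i j, [/\ teich_unit z, x = z ^+ i.+1 & y = z ^+ j.+1].
Proof.
have N0 := teich_order_gt0; move=> ux uy xy; have [[cx xN] [cy yN]] := (ux, uy).
have rxy : rho x * rho y = rho y * rho x by rewrite -!rmorphM xy.
have [i0 v0] : exists i, row i (rho e) != 0.
  apply: contrapT => no; case/negP: rhoe0; apply/eqP/row_matrixP => i; rewrite row0.
  by apply/eqP/negPn/negP => vi; apply: no; exists i.
have ve : row i0 (rho e) *m rho e = row i0 (rho e).
  by rewrite -row_mul mulmxE -rmorphM ee.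
have vxN : row i0 (rho e) *m rho x ^+ N = row i0 (rho e).
  by rewrite -rmorphXn xN ve.
have [a [Z [aN w0 wx ZC]]] := eigenvector_unity N0 v0 vxN.
set w := _ *m Z in w0 wx.
have we : w *m rho e = w.
  rewrite -mulmxA -[Z *m _]/(Z * rho e) -ZC; first by rewrite mulmxA ve.
  by rewrite -!rmorphM cx.2.1 cx.2.2.
have wyN : w *m rho y ^+ N = w by rewrite -rmorphXn yN we.
have [b [Z' [bN w'0 w'y Z'C]]] := eigenvector_unity N0 w0 wyN.
set w' := _ *m Z' in w'0 w'y.
have w'e : w' *m rho e = w'.
  rewrite -mulmxA -[Z' *m _]/(Z' * rho e) -Z'C; first by rewrite mulmxA we.
  by rewrite -!rmorphM cy.2.1 cy.2.2.
have w'x : w' *m rho x = a *: w'.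
  rewrite -mulmxA -[Z' *m _]/(Z' * rho x) -Z'C // mulmxA wx -scalemxAl //.
have NE : N%:R != 0 :> E.
  by rewrite -(rmorph_nat phi) fmorph_eq0 (char0_natr_neq0 hF).
have [z0 z0P] := prim_root_exists N0 NE.
have [ia aE] := prim_rootP z0P aN; have [ib bE] := prim_rootP z0P bN.
have shift c : z0 ^+ c = z0 ^+ (c + N) by rewrite exprD (prim_expr_order z0P) mulr1.
rewrite shift in aE; rewrite shift in bE.
move: (ia + N)%N (ib + N)%N aE bE (ltn_addl ia N0) (ltn_addl ib N0) => {}ia {}ib aE bE ia0 ib0.
case: (egcdnP ib ia0) => km kn gE _.
set g := gcdn ia ib in gE.
have g0 : (0 < g)%N by rewrite gcdn_gt0 ia0.
(* The Bezout relation is km * ia = kn * ib + g. Modulo N the exponent kn * N.-1 stands for - kn,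
   and the summands N keep both exponents positive. *)
pose z := x ^+ (km + N) * y ^+ (kn * N.-1 + N).
have w'X u c k : w' *m rho u = c *: w' -> w' *m rho (u ^+ k) = c ^+ k *: w'.
  move=> w'u; elim: k => [|k IH]; first by rewrite expr0 rmorph1 mulmx1 scale1r.
  by rewrite exprS rmorphM /= -mulmxE mulmxA w'u -scalemxAl IH scalerA -exprS.
have w'z : w' *m rho z = z0 ^+ g *: w'.
  rewrite /z rmorphM /= -mulmxE mulmxA (w'X _ _ _ w'x) -scalemxAl (w'X _ _ _ w'y) scalerA.
  congr (_ *: _); rewrite aE bE -!exprM -exprD.
  have e1 : (ib * (kn * N.-1) + kn * ib = ib * kn * N)%N.
    by rewrite mulnA (mulnC kn) addnC -mulnS prednK.
  have -> : (ia * (km + N) + ib * (kn * N.-1 + N) = g + N * (ib * kn + ia + ib))%N.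
    by rewrite !mulnDr (mulnC ia km) gE (mulnC N (ib * kn)) -e1; lia.
  by rewrite exprD exprM (prim_expr_order z0P) expr1n mulr1.
have uz : teich_unit z.
  have XN u k : teich_unit u -> u ^+ ((k + N) * N) = e.
    by move=> uu; rewrite -(prednK N0) addnS mulnC prednK // teich_unitX.
  split; first by rewrite /z -(prednK N0) !addnS; apply: cornerM; apply: cornerX.
  rewrite /z exprMn_comm; last exact/commrX/commr_sym/commrX/commr_sym.
  by rewrite -!exprM !XN.
have pw u k : corner u -> w' *m rho u = z0 ^+ (g * k.+1) *: w' -> u = z ^+ k.+1.
  move=> cu w'u; apply/eqP; rewrite -subr_eq0; apply: contraT => d0.
  have [|d' [_ dd' _]] := corner_division eL ee rho_idem_neq0 noidem hrs _ d0.
    by apply: in_cornerB; [case: cu | apply: in_cornerX; case: uz => [[]]].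
  case/negP: w'0; rewrite -w'e -dd' rmorphM /= -mulmxE mulmxA rmorphB /= mulmxBr.
  by rewrite w'u (w'X _ _ _ w'z) -exprM subrr mul0mx.
have [ga gb] : (g %| ia)%N /\ (g %| ib)%N by rewrite dvdn_gcdl dvdn_gcdr.
exists z, (ia %/ g).-1, (ib %/ g).-1; split=> //.
  by apply: pw => //; rewrite prednK ?divn_gt0 ?(dvdn_leq ia0) // mulnC divnK // -aE.
by apply: pw => //; rewrite prednK ?divn_gt0 ?(dvdn_leq ib0) // mulnC divnK // -bE.
Qed.

Definition teich_powers (x : A) := undup [seq x ^+ j.+1 | j <- iota 0 N].

Lemma teich_powers_mem x k : teich_unit x -> x ^+ k.+1 \in teich_powers x.
Proof.
move=> ux; rewrite mem_undup; apply/mapP; exists (k %% N)%N; last exact: teich_unit_mod.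
by rewrite mem_iota /= add0n ltn_mod teich_order_gt0.
Qed.

(** T has the largest number of powers. A nonzero T' commuting with T lies together with T in the
    powers of one z, which by maximality are the powers of T; so T' is a power of T. *)
Lemma exists_teich_max : exists T, teich_unit T /\
  forall T', corner T' -> T' ^+ (p ^ r) = T' -> T' * T = T * T' ->
     forall d, corner d -> d * T = T * d -> T' * d = d * T'.
Proof.
have N0 := teich_order_gt0.
have ue : teich_unit e.
  by split=> //; rewrite -(prednK N0); elim: N.-1 => [|k IH]; rewrite ?expr1 // exprS IH ee.
have [||m [T uT TE] Tmax] := @ex_max_nat
  (fun m => exists2 T, teich_unit T & m = size (teich_powers T)) N.
- by exists (size (teich_powers e)), e.
- by move=> _ [T _ ->]; rewrite (leq_trans (size_undup _)) // size_map size_iota.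
exists T; split=> // T' cT' T'Q T'T d cd dT.
have Q0 : (0 < p ^ r)%N by rewrite expn_gt0 prime_gt0 ?(prime_p hF).
have [T'0|T'N] : T' ^+ N = 0 \/ T' ^+ N = e.
  apply: noidem; first by rewrite -(prednK N0); apply: cornerX.
  move: N0 T'Q; case: (p ^ r)%N => [|[|Q]] //= _ T'Q.
  by rewrite -exprD addSnnS addnC exprD T'Q -exprS.
  by rewrite -(prednK Q0) exprSr T'0 mul0r in T'Q; rewrite -T'Q mul0r mulr0.
have [z [i [j [uz Tz T'z]]]] := teich_unit_comm uT (conj cT' T'N) (esym T'T).
have sub : {subset teich_powers T <= teich_powers z}.
  move=> y; rewrite mem_undup => /mapP[k _ ->].
  by rewrite Tz -exprM mulnS addSn; apply: teich_powers_mem.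
have le_size : (size (teich_powers z) <= size (teich_powers T))%N.
  by rewrite -TE; apply: Tmax; exists z.
have [_ eqTz] := uniq_min_size (undup_uniq _) sub le_size.
have : z \in teich_powers T by rewrite eqTz -[z]expr1; apply: teich_powers_mem.
rewrite mem_undup => /mapP[k _ zT]; rewrite T'z zT -exprM.
exact/commr_sym/commrX.
Qed.

Hypothesis rho_span : forall X : 'M[E]_n.+1, exists (I : finType) (c : I -> E) (a : I -> A),
  X = \sum_i c i *: rho (a i).

(** M is the projection onto the eigenspace of T for l = 1/mu. It turns powers of T into scalars, so
    M rho(a) M is, up to the factor 1/N, equal to M rho(P a) M, where P a sums the conjugates of a
    under T and thus commutes with T. As the centralizer is commutative and rho(A) spans all
    matrices, the matrices M Y M commute, which forces trace 1. *)
Lemma key_idempotent : exists T mu, [/\ T \in Lp, mu ^+ N = 1 &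
  \sum_(j < N) mu ^+ j.+1 * \tr (rho (T ^+ j.+1)) = N%:R].
Proof.
have N0 := teich_order_gt0.
have [T [uT maxT]] := exists_teich_max; have [cT TN] := uT.
have TS k : T ^+ (k + N).+1 = T ^+ k.+1.
  by rewrite teich_unit_mod // modnDr -teich_unit_mod.
have [i0 v0] : exists i, row i (rho e) != 0.
  apply: contrapT => no; case/negP: rhoe0; apply/eqP/row_matrixP => i; rewrite row0.
  by apply/eqP/negPn/negP => vi; apply: no; exists i.
have ve : row i0 (rho e) *m rho e = row i0 (rho e).
  by rewrite -row_mul mulmxE -rmorphM ee.
have vTN : row i0 (rho e) *m rho T ^+ N = row i0 (rho e).
  by rewrite -rmorphXn TN ve.
have [l [Z [lN w0 wT _]]] := eigenvector_unity N0 v0 vTN.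
set w := _ *m Z in w0 wT.
have l0 : l != 0 by apply: contra_eq_neq lN => ->; rewrite expr0n (gtn_eqF N0) eq_sym oner_eq0.
pose mu := l^-1; have muN : mu ^+ N = 1 by rewrite exprVn lN invr1.
have NE : N%:R != 0 :> E.
  by rewrite -(rmorph_nat phi) fmorph_eq0 (char0_natr_neq0 hF).
exists T, mu; split=> //; first by case: cT.
pose S := \sum_(j < N) mu ^+ j.+1 *: rho T ^+ j.+1.
pose M := N%:R^-1 *: S.
have rTS k : rho T ^+ (k + N).+1 = rho T ^+ k.+1 by rewrite -!rmorphXn TS.
have TM : rho T * M = l *: M.
  rewrite -scalerAr scalerA mulrC -scalerA; congr (_ *: _).
  rewrite mulr_sumr scaler_sumr /= -(prednK N0) big_ord_recr [RHS]big_ord_recl /= addrC.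
  congr (_ + _).
    rewrite -scalerAr -exprS expr1 scalerA mulfV // scale1r prednK //.
    by rewrite muN scale1r -(rTS 0).
  apply: eq_bigr => i _; rewrite /bump /= add1n -scalerAr -exprS scalerA.
  by rewrite [mu ^+ _.+2]exprS mulrA mulfV // mul1r.
have TXM k : rho T ^+ k * M = l ^+ k *: M.
  elim: k => [|k IH]; first by rewrite !expr0 mul1r scale1r.
  by rewrite exprSr -mulrA TM -scalerAr IH scalerA -exprS.
have MM : M * M = M.
  rewrite {1}/M -scalerAl mulr_suml.
  under eq_bigr do rewrite -scalerAl TXM scalerA -exprMn mulVf // expr1n scale1r.
  by rewrite sumr_const card_ord -scaler_nat scalerA mulVf // scale1r.
have M0 : M != 0.
  apply: contraNneq w0 => M0.
  have : w *m M = w.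
    have wX k : w *m rho T ^+ k = l ^+ k *: w.
      elim: k => [|k IH]; first by rewrite !expr0 mulmx1 scale1r.
      by rewrite exprS -mulmxE mulmxA wT -scalemxAl IH scalerA -exprS.
    rewrite -scalemxAr mulmx_sumr.
    under eq_bigr do rewrite -scalemxAr wX scalerA -exprMn mulVf // expr1n scale1r.
    by rewrite sumr_const card_ord -scaler_nat scalerA mulVf // scale1r.
  by rewrite M0 mulmx0 => <-.
have MT : M * rho T = rho T * M.
  rewrite -scalerAl -scalerAr; congr (_ *: _); rewrite mulr_suml mulr_sumr.
  by apply: eq_bigr => j _; rewrite -scalerAl -scalerAr -exprSr -exprS.
have MTX k : M * rho T ^+ k = l ^+ k *: M.
  by rewrite -TXM; apply: commrX.
(* The second power is the inverse of the first in the corner; 2 * N instead of N keeps its exponent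
   positive for k.+1 = N. *)
pose P a := \sum_(k < N) T ^+ k.+1 * a * T ^+ (2 * N - k.+1).
have eT k : e * T ^+ k.+1 = T ^+ k.+1 by rewrite (cornerX _ cT).2.1.
have Te k : T ^+ k.+1 * e = T ^+ k.+1 by rewrite (cornerX _ cT).2.2.
have kN (k : 'I_N) : (2 * N - k.+1 = (2 * N - k.+2).+1)%N.
  by have := ltn_ord k; lia.
have Pc a : in_corner e (P a).
  split; rewrite /P.
    by rewrite mulr_sumr; apply: eq_bigr => k _; rewrite !mulrA eT.
  by rewrite mulr_suml; apply: eq_bigr => k _; rewrite kN -mulrA Te.
have PT a : P a * T = T * P a.
  rewrite /P mulr_suml mulr_sumr; move: N0 TS; case: N => // N' _ TS.
  rewrite big_ord_recl [RHS]big_ord_recr /= addrC; congr (_ + _).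
    rewrite -mulrA -exprSr !mulrA -exprS -(TS 0); congr (_ * _ * _).
    have -> : (2 * N'.+1 - 1).+1 = (N' + N'.+1).+1 by lia.
    by rewrite TS; congr (_ ^+ _); lia.
  apply: eq_bigr => k _; rewrite /bump /= add1n -mulrA -exprSr !mulrA -exprS.
  by congr (_ * _ ^+ _); have := ltn_ord k; lia.
have PP a b : P a * P b = P b * P a.
  exact: (teichmuller_centralizer eL ee rho_idem_neq0 noidem hrs cT maxT).
have MP a : rho (P a) * M = M * rho (P a).
  have rPT : rho (P a) * rho T = rho T * rho (P a) by rewrite -!rmorphM PT.
  rewrite -scalerAl -scalerAr; congr (_ *: _); rewrite mulr_suml mulr_sumr.
  by apply: eq_bigr => j _; rewrite -scalerAl -scalerAr; congr (_ *: _); apply: commrX.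
have MS : M = N%:R^-1 *: S by [].
clearbody M.
have MPM a : M * rho a * M = N%:R^-1 *: (M * rho (P a) * M).
  rewrite rmorph_sum mulr_sumr mulr_suml.
  under eq_bigr => k _.
    rewrite !rmorphM !rmorphXn /= !mulrA MTX -!mulrA TXM -scalerAl -!scalerAr scalerA.
    rewrite -exprD subnKC; last by have := ltn_ord k; lia.
    rewrite mulnC exprM lN expr1n scale1r.
    over.
  by rewrite sumr_const card_ord -scaler_nat scalerA mulVf // scale1r !mulrA.
have comm1 a b : (M * rho a * M) * (M * rho b * M) = (M * rho b * M) * (M * rho a * M).
  have sand c : M * rho (P c) * M = rho (P c) * M by rewrite -MP -mulrA MM.
  have prod c d : rho (P c) * M * (rho (P d) * M) = rho (P c * P d) * M.
    by rewrite -mulrA (mulrA M) -MP -(mulrA _ M M) MM mulrA rmorphM.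
  by rewrite (MPM a) (MPM b) !sand -!scalerAl -!scalerAr !prod PP.
have commM Y W : (M * Y * M) * (M * W * M) = (M * W * M) * (M * Y * M).
  have [I [c [a ->]]] := rho_span Y; have [J [d [b ->]]] := rho_span W.
  have ME (K : finType) (f : K -> E) (g : K -> A) :
      M * (\sum_i f i *: rho (g i)) * M = \sum_i f i *: (M * rho (g i) * M).
    rewrite mulr_sumr mulr_suml; apply: eq_bigr => i _.
    by rewrite -scalerAr -scalerAl.
  rewrite !ME mulr_suml [RHS]mulr_sumr; apply: eq_bigr => i _.
  rewrite mulr_sumr mulr_suml; apply: eq_bigr => j _.
  by rewrite -!scalerAl -!scalerAr comm1 scalerA mulrC -scalerA.
have := trace_idempotent_comm M0 MM commM; rewrite MS mxtraceZ.
rewrite raddf_sum /= => /(congr1 (fun x => N%:R * x)); rewrite mulVKf // mulr1 => <-.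
by apply: eq_bigr => j _; rewrite mxtraceZ rmorphXn.
Qed.

End Key.

(** * Minimal idempotents and the relation of trace one *)

Section RegularMatrix.
Variables (F : fieldType) (gT : finGroupType).
Local Notation A := (galg F gT).
Implicit Types x y : A.

Definition reg_mx x : 'M[F]_#|gT| :=
  \matrix_(i, j) gcoef x ((enum_val i)^-1 * enum_val j)%g.

Lemma reg_mxM x y : reg_mx (x * y) = reg_mx x *m reg_mx y.
Proof.
apply/matrixP => i j; rewrite !mxE gcoefME.
rewrite (reindex_inj (mulgI (enum_val i)^-1%g)) /=.
rewrite (reindex (enum_val (A := predT))) /=; last first.
  by apply: onW_bij; apply: enum_val_bij.
by apply: eq_bigr => k _; rewrite !mxE invMg invgK -mulgA mulKVg.
Qed.

Lemma reg_mx_inj : injective reg_mx.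
Proof.
move=> x y /matrixP xy; apply: galgP => g.
have := xy (enum_rank 1%g) (enum_rank g).
by rewrite !mxE !enum_rankK invg1 mul1g.
Qed.

(** A measure that drops strictly from an idempotent to a smaller one, so that minimal idempotents
    exist. *)
Lemma rank_idempotent x y : x * y = y -> y * x = y -> x * x = x -> y * y = y -> y != x ->
  (\rank (reg_mx y) < \rank (reg_mx x))%N.
Proof.
move=> xy yx xx yy neq.
have sub : (reg_mx y <= reg_mx x)%MS by rewrite -yx reg_mxM submxMl.
rewrite ltn_neqAle mxrankS // andbT; apply: contra neq => /eqP rk.
have /submxP[D xE] : (reg_mx x <= reg_mx y)%MS.
  by rewrite -(mxrank_leqif_sup sub).2 rk.
by apply/eqP/reg_mx_inj; rewrite -xy reg_mxM xE -mulmxA -reg_mxM yy.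
Qed.

End RegularMatrix.

(** The idempotent e has least rank among those of L on which rho does not vanish. It is primitive:
    for an idempotent f of e L e other than 0 and e, rho would vanish on f and on e - f, hence on
    e. *)
Theorem trace_unit (F : fieldType) (p : nat) (hF : local_field F p) (gT : finGroupType)
    (L : set (galg F gT)) (E : closedFieldType) (phi : {rmorphism F -> E}) (n : nat)
    (rho : {rmorphism galg F gT -> 'M[E]_n.+1}) :
  max_local_order hF L ->
  (forall X : 'M[E]_n.+1, exists (I : finType) (c : I -> E) (a : I -> galg F gT),
     X = \sum_i c i *: rho (a i)) ->
  exists N T mu, [/\ (N%:R : F)^-1 \in integers hF, (0 < N)%N, L T, mu ^+ N = 1 &
    \sum_(j < N) mu ^+ j.+1 * \tr (rho (T ^+ j.+1)) = N%:R].
Proof.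
move=> hL rho_span.
have [|d [e [eL [ee rhoe0]] dE] dmin] := @ex_min_nat (fun d => exists2 e,
    e \in mlo_pred hL /\ e * e = e /\ rho e != 0 & d = \rank (reg_mx e)).
  exists (\rank (reg_mx (1 : galg F gT))), 1 => //.
  by rewrite rpred1 mulr1 rmorph1 oner_eq0.
have smaller f : corner hL e f -> f * f = f -> f != e -> rho f = 0.
  move=> [fL [ef fe]] ff fne; apply/eqP/negPn/negP => rhof.
  have := dmin _ (ex_intro2 _ _ f (conj fL (conj ff rhof)) erefl).
  by rewrite dE leqNgt rank_idempotent.
have noidem f : corner hL e f -> f * f = f -> f = 0 \/ f = e.
  move=> cf ff; have [->|fne] := eqVneq f e; first by right.
  left; apply/eqP; apply: contraT => f0.
  have [fL [ef fe]] := cf.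
  have cef : corner hL e (e - f) by apply: cornerB; rewrite // /corner /in_corner ee.
  have : rho (e - f) = 0.
    apply: smaller => //; first by rewrite mulrBl !mulrBr ee ef fe ff subrr subr0.
    by rewrite -subr_eq0 addrAC subrr sub0r oppr_eq0.
  move/eqP; rewrite rmorphB (smaller f) // subr0.
  by rewrite (negPf rhoe0).
have [r [s hrs]] := teichmuller hL.
have [T [mu [TL muN E1]]] := key_idempotent phi eL ee rhoe0 noidem hrs rho_span.
exists (p ^ r).-1, T, mu; split=> //.
- by apply: integersV_expB1; case: hrs.
- by exact: teich_order_gt0 hrs.
- exact/(mlo_predE hL).
Qed.

(** * Extension of automorphisms to the algebraic closure *)

Section ExtendAutomorphism.
Variables (F : fieldType) (E : closedFieldType) (iota : {rmorphism F -> E}).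
Hypothesis iota_alg : is_alg_closure iota.
Implicit Types (G : set (E * E)) (x y : E) (P Q : {poly E}).

(* Graphs of partial F-embeddings: F-subalgebras of E * E that define a function;
   injectivity and closure under inverses follow from algebraicity. *)
Record partial_embedding G : Prop := PartialEmbedding {
  pe_base : forall a, G (iota a, iota a);
  pe_sub : forall x y x' y', G (x, y) -> G (x', y') -> G (x - x', y - y');
  pe_mul : forall x y x' y', G (x, y) -> G (x', y') -> G (x * x', y * y');
  pe_fun : forall y, G (0, y) -> y = 0
}.

Definition coef_graph G P Q := forall i, G (P`_i, Q`_i).

Section Properties.
Variable G : set (E * E).
Hypothesis pG : partial_embedding G.

Lemma pe0 : G (0, 0).
Proof. by have := pe_base pG 0; rewrite rmorph0. Qed.

Lemma pe1 : G (1, 1).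
Proof. by have := pe_base pG 1; rewrite rmorph1. Qed.

Lemma pe_add x y x' y' : G (x, y) -> G (x', y') -> G (x + x', y + y').
Proof.
move=> Gx Gx'; rewrite -[x']opprK -[y']opprK -[- x']sub0r -[- y']sub0r.
by apply: (pe_sub pG) => //; apply: (pe_sub pG) => //; apply: pe0.
Qed.

Lemma pe_sum (I : Type) (r : seq I) (f g : I -> E) :
  (forall i, G (f i, g i)) -> G (\sum_(i <- r) f i, \sum_(i <- r) g i).
Proof.
move=> fg; elim: r => [|i r IH]; first by rewrite !big_nil; apply: pe0.
by rewrite !big_cons; apply: pe_add.
Qed.

Lemma pe_exp x y n : G (x, y) -> G (x ^+ n, y ^+ n).
Proof.
move=> Gxy; elim: n => [|n IH]; first by rewrite !expr0; apply: pe1.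
by rewrite !exprS; apply: (pe_mul pG).
Qed.

Lemma pe_horner P Q x y : coef_graph G P Q -> G (x, y) -> G (P.[x], Q.[y]).
Proof.
move=> PQ Gxy; rewrite (horner_coef_wide x (leq_maxl (size P) (size Q))).
rewrite (horner_coef_wide y (leq_maxr (size P) (size Q))).
by apply: pe_sum => i; apply: (pe_mul pG) => //; apply: pe_exp.
Qed.

Lemma coef_graph_base (q : {poly F}) : coef_graph G (map_poly iota q) (map_poly iota q).
Proof. by move=> i; rewrite coef_map; apply: pe_base. Qed.

Lemma coef_graphB P Q P' Q' : coef_graph G P Q -> coef_graph G P' Q' ->
  coef_graph G (P - P') (Q - Q').
Proof. by move=> PQ PQ' i; rewrite !coefB; apply: (pe_sub pG). Qed.

Lemma coef_graphM P Q P' Q' : coef_graph G P Q -> coef_graph G P' Q' ->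
  coef_graph G (P * P') (Q * Q').
Proof. by move=> PQ PQ' i; rewrite !coefM; apply: pe_sum => j; apply: (pe_mul pG). Qed.

Lemma coef_graphC x y : G (x, y) -> coef_graph G x%:P y%:P.
Proof. by move=> Gxy i; rewrite !coefC; case: eqP => // _; apply: pe0. Qed.

Lemma coef_graphXn n : coef_graph G 'X^n 'X^n.
Proof. by move=> i; rewrite !coefXn; case: eqP => _; [apply: pe1 | apply: pe0]. Qed.

(** Let q be a polynomial over F of least degree with root x. Evaluating it at the pair (x, 0) gives
    q(0) = 0, so 'X divides q; if x != 0 the quotient still has the root x, against minimality. *)
Lemma pe_inj x : G (x, 0) -> x = 0.
Proof.
move=> Gx; apply/eqP; apply: contraT => x0.
have [|d [q q0 [qx dE]] dmin] := @ex_min_nat (fun d => exists2 q : {poly F}, q != 0 &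
    root (map_poly iota q) x /\ d = size q).
  by have [q q0 qx] := iota_alg x; exists (size q), q.
have Gq : G ((map_poly iota q).[x], (map_poly iota q).[0]).
  by apply: pe_horner => //; apply: coef_graph_base.
rewrite (rootP qx) in Gq; move: (pe_fun pG Gq) => /eqP.
rewrite horner_coef0 coef_map fmorph_eq0 => /eqP q00.
have [q' qE] : exists q', q = q' * 'X.
  have /factor_theorem[q'] : root q 0 by rewrite /root horner_coef0 q00.
  by rewrite subr0; exists q'.
have q'0 : q' != 0 by apply: contraNneq q0 => q'0; rewrite qE q'0 mul0r.
have q'x : root (map_poly iota q') x.
  move: qx; rewrite qE rmorphM /= map_polyX rootM.
  by rewrite [root 'X x]/root hornerX (negPf x0) orbF.
have := dmin _ (ex_intro2 _ _ q' q'0 (conj q'x erefl)).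
by rewrite dE qE size_mulX // ltnn.
Qed.

Lemma pe_eq0 x y : G (x, y) -> (x == 0) = (y == 0).
Proof.
move=> Gxy; apply/eqP/eqP => e0; rewrite e0 in Gxy; first exact: pe_fun Gxy.
exact: pe_inj.
Qed.

Lemma coef_graph_size P Q : coef_graph G P Q -> size P = size Q.
Proof.
move=> PQ; apply/eqP; rewrite eqn_leq; apply/andP.
by split; apply/leq_sizeP => j /leq_sizeP le; apply/eqP;
  [rewrite (pe_eq0 (PQ j)) | rewrite -(pe_eq0 (PQ j))]; rewrite le.
Qed.

(* M is a minimal polynomial of x over the domain of G, transported to N. *)
Definition min_graph x M N := [/\ coef_graph G M N, M != 0, root M x &
  forall P Q, coef_graph G P Q -> P != 0 -> root P x -> (size M <= size P)%N].

Lemma min_graph_exists x : exists M N, min_graph x M N.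
Proof.
have [|d [M [N [MN M0 Mx dE]]] dmin] := @ex_min_nat (fun d => exists M N,
    [/\ coef_graph G M N, M != 0, root M x & d = size M]).
  have [q q0 qx] := iota_alg x; exists (size (map_poly iota q)).
  exists (map_poly iota q), (map_poly iota q); split=> //; first exact: coef_graph_base.
  by rewrite map_poly_eq0.
exists M, N; split=> // P Q PQ P0 Px; rewrite -dE; apply: dmin.
by exists P, Q.
Qed.

(** Pseudo-division: the domain of G is only known to be a ring, so P is multiplied by the leading
    coefficient of M before a multiple of M is subtracted. The transported polynomials undergo the
    same steps. *)
Lemma min_graph_root x y M N P Q : min_graph x M N -> root N y ->
  coef_graph G P Q -> root P x -> root Q y.
Proof.
move=> [MN M0 Mx Mmin] Ny; move: {2}(size P) (leqnn (size P)) => n.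
elim: n P Q => [|n IH] P Q szP PQ Px.
  move: szP; rewrite leqn0 size_poly_eq0 => /eqP P0.
  have -> : Q = 0; last by rewrite root0.
  by apply/eqP; rewrite -size_poly_eq0 -(coef_graph_size PQ) size_poly_eq0 P0.
have [P0|P0] := eqVneq P 0.
  by apply: IH PQ Px; rewrite P0 size_poly0.
have leMP := Mmin P Q PQ P0 Px.
set m := (size M).-1; set k := (size P).-1.
pose P' := (M`_m)%:P * P - (P`_k)%:P * ('X^(k - m) * M).
pose Q' := (N`_m)%:P * Q - (Q`_k)%:P * ('X^(k - m) * N).
have PQ' : coef_graph G P' Q'.
  apply: coef_graphB; apply: coef_graphM => //; first exact: coef_graphC.
    exact: coef_graphC.
  by apply: coef_graphM => //; apply: coef_graphXn.
have P'x : root P' x.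
  by rewrite /root /P' hornerD hornerN !hornerM (rootP Px) (rootP Mx) !mulr0 subrr.
have szP' : (size P' <= n)%N.
  apply: leq_trans (_ : (size P' <= k)%N) _; last by rewrite /k; case: (size P) szP.
  apply/leq_sizeP => j; rewrite leq_eqVlt => /orP[/eqP <-|kj].
    rewrite coefB !coefCM coefXnM ltnNge leq_subr /= subKn; last by rewrite /k /m; lia.
    by rewrite mulrC subrr.
  rewrite coefB !coefCM coefXnM ltnNge (leq_trans (leq_subr _ _) (ltnW kj)) /=.
  rewrite (_ : P`_j = 0); last first.
    by apply: nth_default; move: kj; rewrite /k; case: (size P).
  rewrite (_ : M`_(j - (k - m)) = 0) ?mulr0 ?subrr //.
  apply: nth_default; move: kj leMP; rewrite /k /m.
  by move: (size (polyseq M)) (size (polyseq P)) => a b; clear; lia.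
have := IH P' Q' szP' PQ' P'x.
rewrite /root /Q' hornerD hornerN !hornerM hornerC (rootP Ny) !mulr0 subr0 mulf_eq0 => /orP[|//].
by rewrite -(pe_eq0 (MN m)) -/(lead_coef M) lead_coef_eq0 (negPf M0).
Qed.

Lemma pe_extend x y M N : min_graph x M N -> root N y ->
  exists G', [/\ partial_embedding G', G `<=` G' & G' (x, y)].
Proof.
move=> minM Ny.
exists (fun z => exists P Q, coef_graph G P Q /\ z = (P.[x], Q.[y])); split.
- split.
  + move=> a; exists (iota a)%:P, (iota a)%:P; rewrite !hornerC; split=> //.
    by apply: coef_graphC; apply: pe_base.
  + move=> _ _ _ _ [P [Q [PQ [-> ->]]]] [P' [Q' [PQ' [-> ->]]]].
    by exists (P - P'), (Q - Q'); rewrite !hornerE; split=> //; apply: coef_graphB.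
  + move=> _ _ _ _ [P [Q [PQ [-> ->]]]] [P' [Q' [PQ' [-> ->]]]].
    by exists (P * P'), (Q * Q'); rewrite !hornerE; split=> //; apply: coef_graphM.
  move=> _ [P [Q [PQ [Px ->]]]]; apply/eqP; apply: min_graph_root minM Ny PQ _.
  by rewrite /root -Px.
- move=> [a b] Gab; exists a%:P, b%:P; rewrite !hornerC; split=> //.
  exact: coef_graphC.
by exists 'X, 'X; rewrite !hornerX; split=> //; apply: (coef_graphXn 1).
Qed.

Lemma min_graph_root_exists x M N : min_graph x M N -> exists y, root N y.
Proof.
move=> [MN M0 Mx _]; apply/closed_rootP; rewrite -(coef_graph_size MN).
by rewrite gtn_eqF // (root_size_gt1 M0 Mx).
Qed.

End Properties.

Lemma pe_total G0 : partial_embedding G0 -> exists G,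
  [/\ partial_embedding G, G0 `<=` G & forall x, exists y, G (x, y)].
Proof.
move=> pG0.
(* Adjoining G0 to every member of the family makes the empty chain admissible. *)
have [|G [pG Gmax]] := @Zorn_bigcup _ (fun G => partial_embedding (G0 `|` G)).
- move=> H HP Htot; have chain u v : (G0 `|` \bigcup_(X in H) X) u ->
      (G0 `|` \bigcup_(X in H) X) v ->
      (G0 u /\ G0 v) \/ exists2 X, H X & (G0 `|` X) u /\ (G0 `|` X) v.
    case=> [Gu|[X HX Xu]]; case=> [Gv|[Y HY Yv]].
    + by left.
    + by right; exists Y => //; split; [left|right].
    + by right; exists X => //; split; [right|left].
    right; case: (Htot X Y HX HY) => sub.
      by exists Y => //; split; right => //; apply: sub.
    by exists X => //; split; right => //; apply: sub.
  have sub X : H X -> (G0 `|` X) `<=` (G0 `|` \bigcup_(X in H) X).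
    by move=> HX u [Gu|Xu]; [left | right; exists X].
  split.
  + by move=> a; left; apply: pe_base.
  + move=> x y x' y' Gx Gx'; case: (chain _ _ Gx Gx') => [[G0x G0x']|[X HX [Xx Xx']]].
      by left; apply: (pe_sub pG0).
    by apply: (sub X HX); apply: (pe_sub (HP _ HX)).
  + move=> x y x' y' Gx Gx'; case: (chain _ _ Gx Gx') => [[G0x G0x']|[X HX [Xx Xx']]].
      by left; apply: (pe_mul pG0).
    by apply: (sub X HX); apply: (pe_mul (HP _ HX)).
  move=> y Gy; case: (chain _ _ Gy Gy) => [[G0y _]|[X HX [Xy _]]].
    exact: (pe_fun pG0).
  exact: (pe_fun (HP _ HX)).
exists (G0 `|` G); split=> [//|u|x]; first by left.
have [M [N minM]] := min_graph_exists pG x.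
have [y Ny] := min_graph_root_exists pG minM.
have [G' [pG' GG' G'xy]] := pe_extend pG minM Ny.
exists y; apply: contrapT => nGxy.
have G0G' : G0 `|` G' = G' by apply: setUidr => u G0u; apply: GG'; left.
apply: (Gmax G'); last by rewrite G0G'.
split=> [u Gu|]; first by apply: GG'; right.
by move=> /(_ _ G'xy) Gxy; apply: nGxy; right.
Qed.

Lemma absolute_galois_extend G0 : partial_embedding G0 ->
  exists2 t : {rmorphism E -> E}, absolute_galois iota t &
    forall x y, G0 (x, y) -> t x = y.
Proof.
move=> /pe_total[G [pG G0G /choice[t tP]]].
have fun_G x y y' : G (x, y) -> G (x, y') -> y = y'.
  move=> Gxy Gxy'; have := pe_sub pG Gxy Gxy'; rewrite subrr => /(pe_fun pG) /eqP.
  by rewrite subr_eq0 => /eqP.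
have tE x y : G (x, y) -> t x = y by apply: fun_G.
have tB : zmod_morphism t by move=> x y; apply: tE; apply: (pe_sub pG).
have tM : monoid_morphism t.
  by split=> [|x y]; apply: tE; [apply: pe1 | apply: (pe_mul pG)].
pose tz := GRing.isZmodMorphism.Build E E t tB.
pose tm := GRing.isMonoidMorphism.Build E E t tM.
pose tr : {rmorphism E -> E} := HB.pack t tz tm.
have tF a : t (iota a) = iota a by apply: tE; apply: pe_base.
exists tr; last by move=> x y G0xy; apply: tE; apply: G0G.
split=> //.
have t_inj : injective tr by apply: fmorph_inj.
(* An injective map that sends the finite set of roots of q into itself is onto it. *)
have surj y : exists x, tr x = y.
  have [q q0 qy] := iota_alg y.
  have [rs rsE] := closed_field_poly_normal (map_poly iota q).
  have q0' : lead_coef (map_poly iota q) != 0 by rewrite lead_coef_eq0 map_poly_eq0.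
  have mem_rs z : (z \in undup rs) = root (map_poly iota q) z.
    by rewrite mem_undup rsE rootZ // root_prod_XsubC.
  have sub : {subset [seq tr z | z <- undup rs] <= undup rs}.
    move=> _ /mapP[z zrs ->]; rewrite !mem_rs in zrs *.
    have -> : map_poly iota q = map_poly tr (map_poly iota q).
      by rewrite -map_poly_comp; apply: eq_map_poly => a /=; rewrite tF.
    by rewrite fmorph_root.
  have [||_ eqrs] := uniq_min_size _ sub _.
  - by rewrite map_inj_uniq ?undup_uniq.
  - by rewrite size_map.
  have : y \in [seq tr z | z <- undup rs] by rewrite eqrs mem_rs.
  by case/mapP => x _ ->; exists x.
have /choice[t' t'P] := surj.
by exists t' => x; [apply: t_inj |]; rewrite t'P.
Qed.

Hypothesis F_char0 : [pchar F] =i pred0.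

(** Let M be a minimal polynomial of x over F. If M / (X - x) is not constant, each of its roots is
    an image of x under an automorphism, hence x itself. Then x is a root of the derivative of M,
    which is nonzero in characteristic 0 and of smaller degree. *)
Lemma absolute_galois_fixed x : (forall t, absolute_galois iota t -> t x = x) ->
  exists a, x = iota a.
Proof.
move=> fix_x; pose G : set (E * E) := fun z => exists a, z = (iota a, iota a).
have pG : partial_embedding G.
  split.
  - by move=> a; exists a.
  - by move=> _ _ _ _ [a [-> ->]] [b [-> ->]]; exists (a - b); rewrite rmorphB.
  - by move=> _ _ _ _ [a [-> ->]] [b [-> ->]]; exists (a * b); rewrite rmorphM.
  - by move=> y [a [a0 ->]].
have diag P Q : coef_graph G P Q -> P = Q.
  by move=> PQ; apply/polyP => i; have [a [-> ->]] := PQ i.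
have [M [N minM]] := min_graph_exists pG x; have [MN M0 Mx Mmin] := minM.
have NE := diag _ _ MN; rewrite -{}NE in MN minM.
have /factor_theorem[q Mq] := Mx.
have q0 : q != 0 by apply: contraNneq M0 => q0; rewrite Mq q0 mul0r.
have [sq|sq] := eqVneq (size q) 1%N.
  have [[a M0a] [b M1b]] := (MN 0, MN 1); case: M0a => M0a _; case: M1b => M1b _.
  have /size_poly1P[c c0 qE] : size q == 1%N by rewrite sq.
  exists (- (a / b)); rewrite rmorphN fmorph_div -M0a -M1b Mq qE.
  rewrite mul_polyC !coefZ !coefB !coefX !coefC /= subr0 mulr1 sub0r mulrN mulNr opprK.
  by rewrite mulrAC mulfV // mul1r.
have [y qy] : exists y, root q y by apply/closed_rootP.
have My : root M y by rewrite Mq rootM qy.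
have [G' [pG' _ G'xy]] := pe_extend pG minM My.
have [t tgal tG'] := absolute_galois_extend pG'.
have xy : y = x by rewrite -(tG' _ _ G'xy) fix_x.
have M'x : root M^`() x.
  rewrite Mq derivM derivXsubC mulr1 /root !hornerE subrr mulr0 add0r.
  by rewrite -xy.
have M'G : coef_graph G M^`() M^`().
  move=> i; rewrite !coef_deriv; have [a [-> _]] := MN i.+1.
  by exists (a *+ i.+1); rewrite rmorphMn.
have szM : (1 < size M)%N := root_size_gt1 M0 Mx.
have M'0 : M^`() != 0.
  apply/eqP => /polyP/(_ (size M).-2); rewrite coef_deriv coef0.
  have -> : (size M).-2.+1 = (size M).-1 by case: (size M) szM => [|[]].
  rewrite -mulr_natr => /eqP; rewrite mulf_eq0 -/(lead_coef M) lead_coef_eq0 (negPf M0) /=.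
  rewrite -(rmorph_nat iota) fmorph_eq0 ((pcharf0P F).1 F_char0).
  by case: (size M) szM => [|[]].
have := Mmin _ _ M'G M'0 M'x; rewrite leqNgt lt_size_deriv //.
Qed.

End ExtendAutomorphism.

(** * Characters and the action of the Galois group *)

Section IrreducibleCharacters.
Variables (E : closedFieldType) (gT : finGroupType).
Hypothesis E_char0 : [pchar E] =i pred0.
Local Notation G := [set: gT]%G.
Implicit Types (chi : gT -> E) (t : {rmorphism E -> E}).

Lemma natr_neq0 n : (0 < n)%N -> n%:R != 0 :> E.
Proof. by move=> n0; rewrite ((pcharf0P E).1 E_char0) -lt0n. Qed.

Lemma pchar0_group : ([pchar E]%R^'.-group G)%g.
Proof. by apply/pgroupP => q _ _; rewrite inE /= E_char0. Qed.

Lemma irr_character_map chi t : irr_character chi -> irr_character (t \o chi).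
Proof.
move=> [n [rG [irrG chiE]]]; exists n, (map_repr t rG); split.
  by apply/mx_abs_irrW; rewrite map_mx_abs_irr; apply: group_closure_closed_field.
by move=> g /=; rewrite chiE trace_map_mx.
Qed.

Lemma irr_characterC chi g h : irr_character chi -> chi (g * h)%g = chi (h * g)%g.
Proof.
move=> [n [rG [_ chiE]]].
by rewrite !chiE !repr_mxM ?inE // mxtrace_mulC.
Qed.

Lemma irr_character1 chi : irr_character chi -> exists2 n, (0 < n)%N & chi 1%g = n%:R.
Proof.
move=> [n [rG [irrG chiE]]]; exists n; last by rewrite chiE repr_mx1 mxtrace1.
by case/mx_irrP: irrG.
Qed.

(* A field automorphism raises the eigenvalues of rG g to a common power. *)
Lemma irr_character_power chi t g : irr_character chi ->
  exists a, t (chi g) = chi (g ^+ a)%g.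
Proof.
move=> [[|n] [rG [irrG chiE]]]; first by case/mx_irrP: irrG.
have m0 : (0 < #[g]%g)%N by apply: order_gt0.
have [z zP] := prim_root_exists m0 (natr_neq0 m0).
have rgm k : rG (g ^+ k)%g = rG g ^+ k.
  elim: k => [|k IH]; first by rewrite expg0 repr_mx1 expr0.
  by rewrite expgS repr_mxM ?inE // IH exprS.
have [P Pu /(similar_diagLR Pu)[d]] : exists2 P, P \in unitmx & similar_diag P (rG g).
  apply/diagonalizableP; exists [seq z ^+ i | i <- iota 0 #[g]%g].
    rewrite map_inj_in_uniq ?iota_uniq // => i j; rewrite !mem_iota /= !add0n => ilt jlt.
    by move/eqP; rewrite (eq_prim_root_expr zP) !modn_small // => /eqP.
  have -> : \prod_(x <- [seq z ^+ i | i <- iota 0 #[g]%g]) ('X - x%:P) = 'X^#[g]%g - 1.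
    by rewrite -(factor_Xn_sub_1 zP) /index_iota subn0 big_map.
  apply: mxminpoly_min; rewrite rmorphB rmorphXn rmorph1 /= horner_mx_X -rgm expg_order.
  by rewrite repr_mx1 subrr.
rewrite conjVmx // => rgE.
have rgk k : rG g ^+ k = invmx P *m diag_mx (\row_i d 0 i ^+ k) *m P.
  elim: k => [|k IH].
    have -> : \row_i d 0 i ^+ 0 = const_mx 1 by apply/rowP => i; rewrite !mxE.
    by rewrite diag_const_mx mulmx1 mulVmx.
  rewrite exprS -mulmxE IH rgE -!mulmxA mulKVmx // (mulmxA (diag_mx _)) mulmx_diag.
  congr (_ *m (diag_mx _ *m _)).
  by apply/rowP => i; rewrite !mxE exprS.
have trk k : chi (g ^+ k)%g = \sum_i d 0 i ^+ k.
  rewrite chiE rgm rgk mxtrace_mulC mulmxA mulmxV // mul1mx mxtrace_diag.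
  by apply: eq_bigr => i _; rewrite mxE.
have dz i : exists j, d 0 i = z ^+ j.
  have : d 0 i ^+ #[g]%g = 1.
    have := rgk #[g]%g; rewrite -rgm expg_order repr_mx1 => /(congr1 (fun X => P *m X *m invmx P)).
    rewrite mulmx1 mulmxV // !mulmxA mulmxV // mul1mx mulmxK //.
    by move/matrixP/(_ i i); rewrite !mxE eqxx !mulr1n => <-.
  by case/(prim_rootP zP) => j ->; exists j.
have [a tz] : exists a, t z = z ^+ a.
  have : t z ^+ #[g]%g = 1 by rewrite -rmorphXn (prim_expr_order zP) rmorph1.
  by case/(prim_rootP zP) => j ->; exists j.
exists a; rewrite trk -{1}[g]expg1 trk rmorph_sum; apply: eq_bigr => i _.
by have [j ->] := dz i; rewrite expr1 rmorphXn /= tz -!exprM mulnC.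
Qed.

Let sG : irrType E G := DecSocleType (regular_repr E G).

Definition irr_index : finType := sG.
Definition irr_value (j : irr_index) (g : gT) : E := \tr (irr_repr (j : sG) g).

Lemma irr_valueP j : irr_character (irr_value j).
Proof. by exists (irr_degree (j : sG)), (irr_repr (j : sG)); split=> //; apply: socle_irr. Qed.

Lemma irr_value_exists chi : irr_character chi -> exists j, chi =1 irr_value j.
Proof.
move=> [n [rG [irrG chiE]]]; exists (irr_comp sG rG) => g.
by rewrite chiE (mxtrace_rsim (rsim_irr_comp_pchar sG pchar0_group irrG)) // inE.
Qed.

Lemma irr_value_sum g : \sum_j irr_value j 1%g * irr_value j g = #|gT|%:R *+ (g == 1%g).
Proof.
have splitG : group_splitting_field E G.
  by move=> n rG; apply: group_closure_closed_field.
have Gg : g \in G by rewrite inE.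
have trE := mxtrace_regular_pchar sG pchar0_group splitG Gg.
transitivity (\tr (regular_repr E G g)).
  rewrite trE; apply: eq_bigr => j _.
  by rewrite /irr_value repr_mx1 mxtrace1 mulr_natl.
have idx_bij : bijective (gring_index G).
  by exists enum_val => x; [rewrite gring_indexK ?inE | rewrite gring_valK].
rewrite /mxtrace (reindex (gring_index G)) /=; last exact: onW_bij.
transitivity (\sum_(h : gT) (g == 1%g)%:R : E); last first.
  by rewrite sumr_const -cardsT mulrb; case: eqP => // _; rewrite mul0rn.
apply: eq_bigr => h _; rewrite mxE mxE eqxx /= gring_indexK ?inE //.
rewrite (inj_eq (bij_inj idx_bij)); congr (_%:R).
by rewrite -{1}[h]mulg1 (inj_eq (mulgI h)) eq_sym.
Qed.

(** The coefficients c of the central idempotent of the component j extract b j from the relation: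
    this idempotent acts as 1 in the representation j and as 0 in the others. *)
Lemma irr_value_free (b : irr_index -> E) :
  (forall g, \sum_j b j * irr_value j g = 0) -> forall j, b j = 0.
Proof.
move=> b0 j.
have [c cP] : exists c : gT -> E, forall i : sG,
    gring_op (irr_repr i) (Wedderburn_id (j : sG)) = \sum_g c g *: irr_repr i g.
  have idx_bij : bijective (gring_index G).
    by exists enum_val => x; [rewrite gring_indexK ?inE | rewrite gring_valK].
  exists (fun g => gring_row (Wedderburn_id (j : sG)) 0 (gring_index G g)) => i.
  rewrite gring_opE /gring_mx /= mulmx_sum_row linear_sum /=.
  rewrite (reindex (gring_index G)) /=; last exact: onW_bij.
  by apply: eq_bigr => g _; rewrite linearZ /= rowK mxvecK gring_indexK ?inE.
have trc (i : sG) : \sum_g c g * irr_value i g =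
    \tr (gring_op (irr_repr i) (Wedderburn_id (j : sG))).
  by rewrite cP raddf_sum /=; apply: eq_bigr => g _; rewrite mxtraceZ.
have : \sum_g c g * (\sum_i b i * irr_value i g) = b j * irr_value j 1%g.
  under eq_bigr do rewrite mulr_sumr.
  rewrite exchange_big /= (bigD1 j) //= [X in _ + X]big1 ?addr0 => [|i ij].
    under eq_bigr do rewrite mulrCA.
    rewrite -mulr_sumr trc (op_Wedderburn_id_pchar pchar0_group).
    by rewrite mxtrace1 /irr_value repr_mx1 mxtrace1.
  under eq_bigr do rewrite mulrCA.
  rewrite -mulr_sumr trc (irr_repr'_op0_pchar pchar0_group (j := (j : sG))) ?Wedderburn_id_mem //.
    by rewrite mxtrace0 mulr0.
  by rewrite eq_sym.
under eq_bigr do rewrite b0 mulr0.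
rewrite big1 // => /esym/eqP; rewrite mulf_eq0 => /orP[/eqP //|].
by have [n n0 ->] := irr_character1 (irr_valueP j); rewrite (negPf (natr_neq0 n0)).
Qed.

End IrreducibleCharacters.

(** * Galois orbits of irreducible characters and the trace *)

Section GaloisOrbits.
Variables (F : fieldType) (E : closedFieldType) (iota : {rmorphism F -> E}).
Hypotheses (F_char0 : [pchar F] =i pred0) (iota_alg : is_alg_closure iota).
Variables (gT : finGroupType) (k : nat) (chi : 'I_k -> gT -> E).
Hypothesis hchi : character_representatives iota chi.
Implicit Types (t : {rmorphism E -> E}) (i : 'I_k) (j : irr_index E gT).
Local Notation K i := (in_value_field iota (chi i)).
Local Notation absgal := (absolute_galois iota).

Lemma E_char0 : [pchar E] =i pred0.
Proof. by move=> q; rewrite (fmorph_pchar iota) F_char0. Qed.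

Lemma val_vfB i (x y : value_field iota (chi i)) : val (x - y) = val x - val y.
Proof. by []. Qed.

Lemma val_vfM i (x y : value_field iota (chi i)) : val (x * y) = val x * val y.
Proof. by []. Qed.

Lemma value_field_agree i t t' : absgal t -> absgal t' ->
  (forall g, t (chi i g) = t' (chi i g)) -> forall x, x \in K i -> t x = t' x.
Proof.
move=> [_ tF] [_ t'F] tchi x /in_value_fieldP xK; apply/eqP.
apply: (xK (fun x => t x == t' x)) => [|a|g].
- split=> [|y z /eqP ty /eqP tz|y z /eqP ty /eqP tz]; rewrite -topredE /=.
  + by rewrite !rmorph1.
  + by rewrite !rmorphB ty tz.
  + by rewrite !fmorph_div ty tz.
- by rewrite -topredE /= tF t'F.
by rewrite -topredE /= tchi.
Qed.

(** F(chi) is normal over F because a Galois conjugate of a character value is a value of the same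
    character at a power of g. *)
Lemma value_field_stable i t x : absgal t -> x \in K i -> t x \in K i.
Proof.
move=> [_ tF] /in_value_fieldP xK.
apply: (xK (fun x => t x \in K i)) => [|a|g].
- split=> [|y z ty tz|y z ty tz]; rewrite -topredE /=.
  + by rewrite rmorph1 rpred1.
  + by rewrite rmorphB rpredB.
  + by rewrite fmorph_div rpred_div.
- by rewrite -topredE /= tF iota_in_value_field.
have [a tchi] := irr_character_power E_char0 t g (hchi.1 i).
by rewrite -topredE /= tchi chi_in_value_field.
Qed.

Lemma absgal_inv t : absgal t -> exists2 t', absgal t' &
  (forall x, t' (t x) = x) /\ (forall x, t (t' x) = x).
Proof.
move=> [[u tu ut] tF].
have [|t' galt' t'P] := @absolute_galois_extend _ _ _ iota_alg (fun z => z.1 = t z.2).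
  split=> [a|x y x' y' /= -> ->|x y x' y' /= -> ->|y /= /esym/eqP].
  - by rewrite /= tF.
  - by rewrite rmorphB.
  - by rewrite rmorphM.
  - by rewrite fmorph_eq0 => /eqP.
exists t' => //; split=> x; first exact: t'P.
by rewrite -{1}(ut x) (t'P _ (u x)) /= ?ut.
Qed.

Lemma absgal_comp t t' : absgal t -> absgal t' -> absgal (t \o t').
Proof.
by move=> [tb tF] [t'b t'F]; split=> [|a] /=; [apply: bij_comp | rewrite t'F tF].
Qed.

Lemma absgal_id : absgal idfun.
Proof. by split=> //; exists id. Qed.

Lemma vf_gal_restrict i t : absgal t -> exists2 s,
  vf_gal (iota := iota) (chi := chi i) s & forall x, val (s x) = t (val x).
Proof.
move=> galt.
have lift u : absgal u -> exists s : value_field iota (chi i) -> value_field iota (chi i),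
    forall x, val (s x) = u (val x).
  move=> galu; have uK (x : value_field iota (chi i)) : u (val x) \in K i.
    by apply: value_field_stable => //; apply: valP.
  by exists (fun x => Sub (u (val x)) (uK x)) => x; rewrite SubK.
have [t' galt' [t't tt']] := absgal_inv galt.
have [[s sE] [s' s'E]] := (lift t galt, lift t' galt').
exists s => //; split.
- by move=> x y; apply: val_inj; rewrite sE !val_vfB !sE rmorphB.
- split=> [|x y]; apply: val_inj; rewrite sE; first exact: rmorph1.
  by rewrite !val_vfM !sE rmorphM.
- by exists s' => x; apply: val_inj; rewrite ?sE ?s'E ?sE ?s'E.
by move=> a; apply: val_inj; rewrite sE; apply: galt.2.
Qed.

Lemma vf_gal_extend i s : vf_gal (iota := iota) (chi := chi i) s ->
  exists2 t, absgal t & forall x, t (val x) = val (s x).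
Proof.
move=> [sB [s1 sM] _ sF].
have s0 : s 0 = 0 by have := sB 0 0; rewrite !subrr.
have [|t galt tP] := @absolute_galois_extend _ _ _ iota_alg
    (fun z => exists x : value_field iota (chi i), z = (val x, val (s x))).
  split.
  - by move=> a; exists (vf_incl iota (chi i) a); rewrite sF.
  - by move=> _ _ _ _ [x [-> ->]] [y [-> ->]]; exists (x - y); rewrite sB !rmorphB.
  - by move=> _ _ _ _ [x [-> ->]] [y [-> ->]]; exists (x * y); rewrite sM !rmorphM.
  - move=> _ [x [x0 ->]]; have -> : x = 0 by apply: val_inj; exact: esym x0.
    by rewrite s0.
by exists t => // x; apply: tP; exists x.
Qed.

Variables (orb : irr_index E gT -> 'I_k) (gal : irr_index E gT -> {rmorphism E -> E}).
Hypothesis galP : forall j, absgal (gal j) /\ forall g, irr_value j g = gal j (chi (orb j) g).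

Lemma orb_unique j i t : absgal t -> (forall g, irr_value j g = t (chi i g)) -> orb j = i.
Proof.
move=> galt jt; have [i0 [_ uniq_i0]] := hchi.2 _ (irr_valueP j).
have [galj jE] := galP j.
by rewrite -(uniq_i0 (orb j)) ?(uniq_i0 i) //; [exists t | exists (gal j)].
Qed.

Lemma orb_galois i t : absgal t -> exists2 j, orb j = i &
  forall g, irr_value j g = t (chi i g).
Proof.
move=> galt; have [j jE] := irr_value_exists E_char0 (irr_character_map t (hchi.1 i)).
by exists j => [|g]; [apply: orb_unique galt _ => g|]; rewrite -jE.
Qed.

Lemma irr_value_inj j j' : irr_value j =1 irr_value j' -> j = j'.
Proof.
move=> jj'; apply/eqP; apply: contraT => neq.
have b0 g : \sum_(l : irr_index E gT) ((l == j)%:R - (l == j')%:R) * irr_value l g = 0.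
  under eq_bigr do rewrite mulrBl.
  have delta (l : irr_index E gT) :
    \sum_(m : irr_index E gT) (m == l)%:R * irr_value m g = irr_value l g.
    rewrite (bigD1 l) //= eqxx mul1r big1 ?addr0 // => m /negPf ->.
    by rewrite mul0r.
  by rewrite sumrB !delta jj' subrr.
have := irr_value_free E_char0 b0 j.
by rewrite eqxx (negPf neq) subr0 => /eqP; rewrite oner_eq0.
Qed.

(** On F_i this is the trace to F, indexed by the characters in the orbit of chi_i instead of
    Gal(F_i/F). Outside F_i it depends on the chosen [gal] but is still additive and F-linear. *)
Definition orb_trace i (x : E) : E := \sum_(j | orb j == i) gal j x.

Lemma orb_traceD i x y : orb_trace i (x + y) = orb_trace i x + orb_trace i y.
Proof. by rewrite /orb_trace -big_split; apply: eq_bigr => j _; rewrite rmorphD. Qed.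

Lemma orb_trace0 i : orb_trace i 0 = 0.
Proof. by rewrite /orb_trace big1 // => j _; rewrite rmorph0. Qed.

Lemma orb_trace_sum i (I : Type) (r : seq I) (f : I -> E) :
  orb_trace i (\sum_(l <- r) f l) = \sum_(l <- r) orb_trace i (f l).
Proof.
by elim: r => [|l r IH]; rewrite ?big_nil ?orb_trace0 // !big_cons orb_traceD IH.
Qed.

Lemma orb_traceZ i a x : orb_trace i (iota a * x) = iota a * orb_trace i x.
Proof.
rewrite /orb_trace mulr_sumr; apply: eq_bigr => j _.
by rewrite rmorphM; have [[_ ->] _] := galP j.
Qed.

(** Applying t permutes the characters of the orbit by tau. The automorphisms [gal (tau j)] and
    [t \o gal j] are only known to agree on F_i, whence the condition on x. *)
Lemma orb_trace_fixed i x t : absgal t -> x \in K i -> t (orb_trace i x) = orb_trace i x.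
Proof.
move=> galt xK.
have /choice[tau tauP] : forall j, exists j', orb j' = orb j /\
    forall g, irr_value j' g = t (irr_value j g).
  move=> j; have [galj jE] := galP j.
  have [j' oj' j'E] := orb_galois (orb j) (absgal_comp galt galj).
  by exists j'; split=> // g; rewrite j'E jE.
have tau_inj : injective tau.
  move=> j j' tjj'; apply: irr_value_inj => g.
  by apply: (fmorph_inj t); rewrite -(tauP j).2 -(tauP j').2 tjj'.
rewrite /orb_trace rmorph_sum [RHS](reindex_inj tau_inj) /=.
apply: eq_big => [j|j /eqP oj]; first by rewrite (tauP j).1.
have [galj jE] := galP j; have [galtj tjE] := galP (tau j).
apply: esym; apply: (@value_field_agree i _ (t \o gal j)) => //; first exact: absgal_comp.
by move=> g /=; rewrite -oj -jE -(tauP j).2 tjE (tauP j).1.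
Qed.

Lemma orb_trace_base i x : x \in K i -> exists a, orb_trace i x = iota a.
Proof.
move=> xK; apply: (absolute_galois_fixed iota_alg F_char0) => t galt.
exact: orb_trace_fixed.
Qed.

Lemma sum_orb_trace (f : 'I_k -> E) :
  \sum_i orb_trace i (f i) = \sum_j gal j (f (orb j)).
Proof.
rewrite (partition_big orb predT) //=; apply: eq_bigr => i _.
by apply: eq_bigr => j /eqP ->.
Qed.

Lemma orb_trace_free (b : 'I_k -> E) :
  (forall g, \sum_i orb_trace i (b i * chi i g) = 0) -> forall i, b i = 0.
Proof.
move=> b0 i; have [j <- _] := orb_galois i absgal_id.
apply/eqP; rewrite -(fmorph_eq0 (gal j)); apply/eqP.
apply: (irr_value_free E_char0 (b := fun j => gal j (b (orb j)))) => g.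
apply: etrans (b0 g); rewrite sum_orb_trace; apply: eq_bigr => l _.
by rewrite rmorphM; have [_ ->] := galP l.
Qed.

Definition chi_lin i (x : galg F gT) : E := \sum_g iota (gcoef x g) * chi i g.

Lemma orb_trace_regular (x : galg F gT) :
  \sum_i orb_trace i (chi i 1%g * chi_lin i x) = #|gT|%:R * iota (gcoef x 1%g).
Proof.
have trE i : orb_trace i (chi i 1%g * chi_lin i x) =
    \sum_g iota (gcoef x g) * orb_trace i (chi i 1%g * chi i g).
  rewrite mulr_sumr orb_trace_sum; apply: eq_bigr => g _.
  by rewrite mulrCA orb_traceZ.
under eq_bigr do rewrite trE.
rewrite exchange_big /= (bigD1 1%g) //= [X in _ + X]big1 ?addr0 => [|g g1].
  rewrite -mulr_sumr sum_orb_trace mulrC; congr (_ * _).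
  transitivity (\sum_(j : irr_index E gT) irr_value j 1%g * irr_value j 1%g).
    by apply: eq_bigr => j _; rewrite rmorphM; have [_ ->] := galP j.
  by rewrite (irr_value_sum E_char0) eqxx.
rewrite -mulr_sumr sum_orb_trace.
have -> : \sum_j gal j (chi (orb j) 1%g * chi (orb j) g) =
    \sum_(j : irr_index E gT) irr_value j 1%g * irr_value j g.
  by apply: eq_bigr => j _; rewrite rmorphM; have [_ jE] := galP j; rewrite !jE.
by rewrite (irr_value_sum E_char0) (negPf g1) mulr0.
Qed.

Lemma vf_gal_bij i :
  exists h : irr_index E gT -> value_field iota (chi i) -> value_field iota (chi i),
  set_bij [set j | orb j == i] (vf_gal (iota := iota) (chi := chi i)) h /\
  forall j x, orb j = i -> val (h j x) = gal j (val x).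
Proof.
have /choice[h hP] : forall j, exists s,
    vf_gal (iota := iota) (chi := chi i) s /\ forall x, val (s x) = gal j (val x).
  by move=> j; have [s sP sE] := vf_gal_restrict i (galP j).1; exists s.
exists h; split; last by move=> j x _; apply: (hP j).2.
split.
- by move=> j _; apply: (hP j).1.
- move=> j j' /set_mem /eqP oj /set_mem /eqP oj' hjj'; apply: irr_value_inj => g.
  rewrite (galP j).2 (galP j').2 oj oj'.
  by rewrite -[chi i g]/(val (vf_chi iota (chi i) g)) -!(hP _).2 hjj'.
move=> s sgal; have [t galt tE] := vf_gal_extend sgal.
have [j oj jE] := orb_galois i galt.
exists j; first by rewrite /= oj.
apply/funext => x; apply: val_inj; rewrite (hP j).2 -tE.
apply: (@value_field_agree i) => //; first exact: (galP j).1.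
  by move=> g; rewrite -jE (galP j).2 oj.
exact: valP.
Qed.

(** The additive map [phi] lets one statement serve both the trace and the coefficients of
    [vf_central]. *)
Lemma vf_gal_sum i (W : nmodType) (phi : W -> E)
    (f : (value_field iota (chi i) -> value_field iota (chi i)) -> W)
    (f' : irr_index E gT -> E) :
  phi 0 = 0 -> {morph phi : x y / x + y} ->
  (forall s j, orb j = i -> (forall x, val (s x) = gal j (val x)) -> phi (f s) = f' j) ->
  phi (\sum_(s \in vf_gal (iota := iota) (chi := chi i)) f s) = \sum_(j | orb j == i) f' j.
Proof.
move=> phi0 phiD ff'; have [h [hbij hE]] := vf_gal_bij i.
rewrite (reindex_fsbig h [set j | orb j == i] _ f hbij).
rewrite -(@bigfs _ _ _ _ (enum (irr_index E gT)) (fun j => orb j == i) (f \o h)) //.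
- rewrite big_enum_cond (big_morph phi phiD phi0) /=.
  by apply: eq_bigr => j /eqP oj; apply: ff' => // x; apply: hE.
- by rewrite enum_uniq.
by move=> j _; rewrite mem_enum.
Qed.

Lemma val_vf_trace i (x : value_field iota (chi i)) : val (vf_trace x) = orb_trace i (val x).
Proof. exact: (@vf_gal_sum i _ val). Qed.

End GaloisOrbits.

(** * Integrality *)

Section IntegersRing.
Variables (F : fieldType) (p : nat) (hF : local_field F p).

Definition integers_ring := {x : F | x \in integers hF}.

HB.instance Definition _ := SubType.on integers_ring.
HB.instance Definition _ := Choice.on integers_ring.
HB.instance Definition _ := [SubChoice_isSubComNzRing of integers_ring by <:].

Variables (E : fieldType) (iota : {rmorphism F -> E}).
Local Notation o := (integers hF).
Local Notation o_incl := (iota \o (val : integers_ring -> F)).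

Definition integral_over x := exists q : {poly F},
  [/\ q \is monic, q \is a polyOver o & root (map_poly iota q) x].

Lemma integral_overP x : integral_over x <-> integralOver o_incl x.
Proof.
split=> [[q [q_monic qo qx]]|[q q_monic qx]].
  have vK a : a \in o -> val (insubd (0 : integers_ring) a) = a.
    by move=> ao; rewrite insubdK.
  have qE : q = map_poly val (map_poly (insubd (0 : integers_ring)) q).
    apply/polyP => i; rewrite coef_map coef_map_id0; last first.
      by apply: val_inj; rewrite vK ?rpred0.
    by rewrite /= vK //; apply: (polyOverP qo).
  exists (map_poly (insubd (0 : integers_ring)) q).
    apply/eqP/val_inj; rewrite -(lead_coef_map_inj val_inj) //.
    by rewrite -qE (monicP q_monic).
  by rewrite map_poly_comp -qE.
exists (map_poly val q); split; first exact: monic_map; last by rewrite -map_poly_comp.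
by apply/polyOverP => i; rewrite coef_map; apply: valP.
Qed.

Lemma integral_over_subring : subring_closed (fun x => `[< integral_over x >]).
Proof.
split=> [|x y /asboolP/integral_overP xi /asboolP/integral_overP yi|
          x y /asboolP/integral_overP xi /asboolP/integral_overP yi];
  apply/asboolP/integral_overP.
- exact: integral1.
- exact: integral_sub.
exact: integral_mul.
Qed.

Lemma integral_over_base a : a \in o -> integral_over (iota a).
Proof.
move=> ao; exists ('X - a%:P); rewrite monicXsubC polyOverXsubC ao; split=> //.
by rewrite rmorphB /= map_polyX map_polyC /= root_XsubC.
Qed.

End IntegersRing.

(** * Integral traces and integral central elements of a maximal order *)

Section IntegralTrace.
Variables (F : fieldType) (p : nat) (hF : local_field F p) (A : algType F).
Variables (L : set A) (hL : max_local_order hF L).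
Variables (E : closedFieldType) (iota : {rmorphism F -> E}) (n : nat).
Variable rho : {rmorphism A -> 'M[E]_n.+1}.
Hypothesis rhoZ : forall c x, rho (c *: x) = iota c *: rho x.
Local Notation o := (integers hF).

(* The vectors v rho(s_j), with s_j generators of L, span a finitely generated
   o-module on which rho(y) acts as multiplication by a. *)
Lemma integral_eigenvalue y a : L y -> eigenvalue (rho y) a -> integral_over hF iota a.
Proof.
move=> Ly /eigenvalueP[v vy v0].
have [m [s Ls]] := mlo_gen hL; have [L1 _ LM] := mlo_ring hL.
have Lsj j : L (s j) by apply/(mlo_predE hL)/(o_span_gen hL _ Ls).
have /choice[C CP] : forall j, exists c : 'I_m -> integers_ring hF,
    y * s j = \sum_l val (c l) *: s l.
  move=> j; have := LM _ _ Ly (Lsj j); rewrite {1}Ls => -[c co ->].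
  exists (fun l => Sub (c l) (co l)).
  by apply: eq_bigr => l _; rewrite SubK.
pose M : 'M[integers_ring hF]_m := \matrix_(l, j) C j l.
apply/integral_overP; exists (char_poly M); first exact: char_poly_monic.
rewrite map_char_poly -eigenvalue_root_char; apply/eigenvalueP.
have [d dE] : exists d : 'I_m -> F, 1 = \sum_j d j *: s j.
  by move: L1; rewrite Ls => -[d _ dE]; exists d.
have [i0 vi0] : exists i0, v 0 i0 != 0.
  apply: contrapT => no; case/negP: v0; apply/eqP/rowP => i; rewrite mxE.
  by apply/eqP/negPn/negP => vi; apply: no; exists i.
have rho_comb (c : 'I_m -> F) : v *m rho (\sum_l c l *: s l) =
    \sum_l iota (c l) *: (v *m rho (s l)).
  rewrite rmorph_sum mulmx_sumr; apply: eq_bigr => l _.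
  by rewrite rhoZ -scalemxAr.
pose w : 'rV[E]_m := \row_j (v *m rho (s j)) 0 i0.
exists w.
  apply/rowP => j; have := rho_comb (fun l => val (C j l)).
  rewrite -CP rmorphM -mulmxE mulmxA vy -scalemxAl => /rowP/(_ i0).
  rewrite mxE summxE => wj; rewrite [RHS]mxE [w 0 j]mxE {}wj mxE.
  by apply: eq_bigr => l _; rewrite !mxE mulrC.
apply: contraNneq vi0 => w0.
have : v = \sum_l iota (d l) *: (v *m rho (s l)).
  by rewrite -rho_comb -dE rmorph1 mulmx1.
move/rowP/(_ i0); rewrite summxE big1 => [->//|l _].
by rewrite mxE; have /rowP/(_ l) := w0; rewrite !mxE => ->; rewrite mulr0.
Qed.

Lemma integral_trace y : L y -> integral_over hF iota (\tr (rho y)).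
Proof.
move=> Ly; have [rs rsE] := closed_field_poly_normal (char_poly (rho y)).
rewrite (monicP (char_poly_monic _)) scale1r in rsE.
have szrs : size rs = n.+1.
  by apply/eqP; rewrite -eqSS -(size_prod_XsubC _ id) -rsE size_char_poly.
have := char_poly_trace (rho y) (ltn0Sn n); rewrite rsE.
have -> : n.+1.-1 = (size rs).-1 by rewrite szrs.
rewrite coefPn_prod_XsubC ?szrs // => /oppr_inj <-.
have [i1 isub imul] := integral_over_subring hF iota.
have int0 : integral_over hF iota 0 by rewrite -(rmorph0 iota); apply/integral_over_base/rpred0.
have : forall x, x \in rs -> integral_over hF iota x.
  move=> x xrs; apply: (integral_eigenvalue Ly).
  by rewrite eigenvalue_root_char rsE root_prod_XsubC.
elim: rs {rsE szrs} => [|x rs IH] rsP; first by rewrite big_nil.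
rewrite big_cons; apply/integral_overP/integral_add; apply/integral_overP.
  by apply: rsP; rewrite mem_head.
by apply: IH => z zrs; apply: rsP; rewrite inE zrs orbT.
Qed.

(** Maximality again: L[z] is a ring as z is central, and its denominators are bounded because the
    powers of z below n' generate all of them over o. *)
Lemma mlo_integral_central (z : A) n' (c : 'I_n' -> F) :
  (forall y, z * y = y * z) -> (forall i, c i \in o) ->
  z ^+ n' = \sum_i c i *: z ^+ i -> L z.
Proof.
move=> zC co zn; set Lp := mlo_pred hL.
have /choice[b bP] : forall i : 'I_n', exists b, unif hF ^+ b *: z ^+ i \in Lp.
  by move=> i; have [b /(mlo_predE hL) bP] := mlo_span hL (z ^+ i); exists b.
pose B := (\max_i b i)%N.
have zB m : unif hF ^+ B *: z ^+ m \in Lp.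
  elim/ltn_ind: m => m IH; case: (ltnP m n') => mn.
    have leB : (b (Ordinal mn) <= B)%N by apply: leq_bigmax.
    rewrite -(subnK leB) exprD -scalerA.
    by apply: mlo_predZ (bP (Ordinal mn)); apply: unifX_integers.
  rewrite -(subnKC mn) exprD zn mulr_suml scaler_sumr; apply: rpred_sum => i _.
  rewrite -scalerAl -exprD scalerA mulrC -scalerA; apply: mlo_predZ => //.
  by apply: IH; rewrite -{2}(subnKC mn) ltn_add2r.
have comm_z (P : {poly A}) : comm_poly P z by rewrite /comm_poly zC.
apply: (mlo_max hL (Gam := fun x => exists2 P : {poly A}, P \is a polyOver Lp & x = P.[z])).
- split.
  + by exists 1; rewrite ?rpred1 ?hornerC.
  + by move=> _ _ [P PL ->] [Q QL ->]; exists (P - Q); rewrite ?rpredB // hornerD hornerN.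
  + by move=> _ _ [P PL ->] [Q QL ->]; exists (P * Q); rewrite ?rpredM // hornerM_comm.
- move=> x /(mlo_predE hL) xL; exists x%:P; rewrite ?hornerC //.
  by rewrite polyOverC.
- exists B => _ [P PL ->]; apply/(mlo_predE hL).
  rewrite horner_coef scaler_sumr; apply: rpred_sum => i _.
  by rewrite scalerAr rpredM //; apply/polyOverP.
by exists 'X; rewrite ?hornerX ?polyOverX.
Qed.

End IntegralTrace.

(** * The centre of the group algebra *)

Section GroupAlgebraRepresentation.
Variables (F : fieldType) (E : closedFieldType) (iota : {rmorphism F -> E}).
Variable gT : finGroupType.
Local Notation G := [set: gT]%G.
Local Notation A := (galg F gT).

Lemma galg_of_mulr (x : A) g h : gcoef (x * galg_of F g) h = gcoef x (h * g^-1)%g.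
Proof.
rewrite gcoefME (bigD1 (h * g^-1)%g) //= gcoef_of invMg invgK mulgKV eqxx mulr1.
rewrite big1 ?addr0 // => l lh; rewrite gcoef_of; case: eqP => [lg|]; last by rewrite mulr0.
by case/eqP: lh; rewrite -lg invMg invgK mulKVg.
Qed.

Lemma galg_ofM g h : galg_of F g * galg_of F h = galg_of F (g * h)%g :> A.
Proof.
apply: galgP => l; rewrite galg_of_mulr !gcoef_of; congr (_%:R).
by rewrite -(inj_eq (mulIg h)) mulgKV.
Qed.

(** Absolute irreducibility appears twice, as spanning for [trace_unit] and as Schur's lemma for
    central elements. The last clause, degree one if and only if G' acts trivially, ties chi(1) = 1
    to the idempotent e. *)
Lemma irr_galg_rep (chi : gT -> E) : irr_character chi ->
  exists n (rho : {rmorphism A -> 'M[E]_n.+1}),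
  [/\ (forall c x, rho (c *: x) = iota c *: rho x) /\
      (forall x, \sum_g iota (gcoef x g) * chi g = \tr (rho x)),
      forall X : 'M[E]_n.+1, exists (I : finType) (c : I -> E) (a : I -> A),
        X = \sum_i c i *: rho (a i),
      forall X : 'M[E]_n.+1, (forall x, X *m rho x = rho x *m X) -> is_scalar_mx X,
      chi 1%g = n.+1%:R &
      n = 0 <-> (forall h, h \in G^`(1)%g -> rho (galg_of F h) = 1)].
Proof.
move=> [[|n] [rG [irrG chiE]]]; first by case/mx_irrP: irrG.
have absG : mx_absolutely_irreducible rG by apply: group_closure_closed_field.
pose f (x : A) : 'M[E]_n.+1 := \sum_g iota (gcoef x g) *: rG g.
have fB : zmod_morphism f.
  move=> x y; rewrite /f -sumrB; apply: eq_bigr => g _.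
  by rewrite gcoefD gcoefN rmorphB scalerBl.
have fof g : f (galg_of F g) = rG g.
  rewrite /f (bigD1 g) //= gcoef_of eqxx rmorph1 scale1r big1 ?addr0 // => h /negPf gh.
  by rewrite gcoef_of gh rmorph0 scale0r.
have fM : monoid_morphism f.
  split; first by rewrite [1]/(galg_of F 1%g) fof repr_mx1.
  move=> x y; rewrite /f mulr_suml.
  transitivity (\sum_g \sum_h (iota (gcoef x h) * iota (gcoef y (h^-1 * g)%g)) *: rG g).
    apply: eq_bigr => g _; rewrite gcoefME rmorph_sum scaler_suml.
    by apply: eq_bigr => h _; rewrite rmorphM.
  rewrite exchange_big /=; apply: eq_bigr => h _.
  rewrite (reindex_inj (mulgI h)) /= mulr_sumr; apply: eq_bigr => g _.
  by rewrite mulKg repr_mxM ?inE // -scalerAl -scalerAr scalerA.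
pose fz := GRing.isZmodMorphism.Build A 'M[E]_n.+1 f fB.
pose fm := GRing.isMonoidMorphism.Build A 'M[E]_n.+1 f fM.
pose rho : {rmorphism A -> 'M[E]_n.+1} := HB.pack f fz fm.
have rhof g : rho (galg_of F g) = rG g by apply: fof.
exists n, rho; split.
- split=> [c x|x]; rewrite /= /f.
    rewrite scaler_sumr; apply: eq_bigr => g _.
    by rewrite gcoefZ rmorphM scalerA.
  rewrite [RHS]raddf_sum; apply: eq_bigr => g _ /=.
  by rewrite chiE -mxtraceZ.
- move=> X; have [_ [a aP]] := mx_abs_irrP absG.
  exists gT, (fun g => a g X), (fun g => galg_of F g).
  rewrite {1}[X]aP; apply: eq_big => [g|g _]; first by rewrite inE.
  by rewrite rhof.
- move=> X XC; apply: (mx_abs_irr_cent_scalar absG); apply/centgmxP => g _.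
  by rewrite -rhof XC.
- by rewrite chiE repr_mx1 mxtrace1.
have splitG : group_splitting_field E G by move=> m rG'; apply: group_closure_closed_field.
have der := der1_sub_rker splitG irrG.
split=> [n0 h hG'|triv].
  have /fintype.subsetP/(_ h hG')/rkerP[_ rh1] : (G^`(1)%g \subset rker rG) by rewrite der n0.
  by rewrite rhof rh1.
apply/eqP; rewrite -eqSS -der; apply/fintype.subsetP => h hG'.
apply/rkerP; split; first by rewrite inE.
by rewrite -rhof triv.
Qed.

End GroupAlgebraRepresentation.

(** * Central elements supported on one component *)

Section CentralElements.
Variables (F : fieldType) (E : closedFieldType) (iota : {rmorphism F -> E}).
Hypotheses (F_char0 : [pchar F] =i pred0) (iota_alg : is_alg_closure iota).
Variables (gT : finGroupType) (k : nat) (chi : 'I_k -> gT -> E).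
Hypothesis hchi : character_representatives iota chi.
Variables (orb : irr_index E gT -> 'I_k) (gal : irr_index E gT -> {rmorphism E -> E}).
Hypothesis galP : forall j, absolute_galois iota (gal j) /\
  forall g, irr_value j g = gal j (chi (orb j) g).
Implicit Types (i : 'I_k) (x y z : galg F gT) (al be : E).
Local Notation K i := (in_value_field iota (chi i)).
Local Notation tr := (orb_trace orb gal).
Local Notation chl := (chi_lin iota chi).
Local Notation A := (galg F gT).

Definition chi_ratio i : E := locked (chi i 1%g / #|gT|%:R).
Local Notation c i := (chi_ratio i).

Lemma card_neq0 : #|gT|%:R != 0 :> E.
Proof.
apply: natr_neq0; first exact: E_char0 iota F_char0.
by apply/card_gt0P; exists 1%g.
Qed.

Lemma chi1_neq0 i : chi i 1%g != 0.
Proof.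
by have [n n0 ->] := irr_character1 (hchi.1 i); apply: natr_neq0 => //; apply: E_char0 iota F_char0.
Qed.

Lemma chi_ratio_neq0 i : c i != 0.
Proof. by rewrite /chi_ratio -lock mulf_neq0 ?invr_eq0 ?chi1_neq0 ?card_neq0. Qed.

Lemma chi_ratio_mem i : c i \in K i.
Proof. by rewrite /chi_ratio -lock rpred_div ?chi_in_value_field ?rpred_nat. Qed.

Lemma chi_ratioE i : #|gT|%:R * c i = chi i 1%g.
Proof. by rewrite /chi_ratio -lock mulrC divfK ?card_neq0. Qed.

Lemma chl_mem i x : chl i x \in K i.
Proof.
by apply: rpred_sum => g _; rewrite rpredM ?iota_in_value_field ?chi_in_value_field.
Qed.

Lemma chl_of i g : chl i (galg_of F g) = chi i g.
Proof.
rewrite /chi_lin (bigD1 g) //= gcoef_of eqxx rmorph1 mul1r big1 ?addr0 // => h /negPf gh.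
by rewrite gcoef_of gh rmorph0 mul0r.
Qed.

(** z is the image of al under the inclusion of F_i in the centre of F[G]. It is a relation because
    the formula has values in Fbar, which are only afterwards seen to come from F. *)
Definition central_elt i al z := forall h, iota (gcoef z h) = tr i (al * c i * chi i h^-1%g).

Lemma central_elt_exists i al : al \in K i -> exists z, central_elt i al z.
Proof.
move=> alK; have /choice[f fP] : forall h, exists a, iota a = tr i (al * c i * chi i h^-1%g).
  move=> h; have [|a ->] := orb_trace_base F_char0 iota_alg hchi galP (i := i)
    (x := al * c i * chi i h^-1%g).
    by apply: rpredM; [apply: rpredM => //; apply: chi_ratio_mem | apply: chi_in_value_field].
  by exists a.
by exists [ffun h => f h] => h; rewrite -fP /gcoef ffunE.
Qed.

Lemma central_elt_inj i al z z' : central_elt i al z -> central_elt i al z' -> z = z'.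
Proof.
by move=> zP z'P; apply: galgP => h; apply: (fmorph_inj iota); rewrite zP z'P.
Qed.

Lemma central_elt0 i : central_elt i 0 0.
Proof. by move=> h; rewrite gcoef0 rmorph0 !mul0r orb_trace0. Qed.

Lemma central_eltD i al be z w : central_elt i al z -> central_elt i be w ->
  central_elt i (al + be) (z + w).
Proof. by move=> zP wP h; rewrite gcoefD rmorphD zP wP -orb_traceD !mulrDl. Qed.

Lemma central_eltZ i a al z : central_elt i al z -> central_elt i (iota a * al) (a *: z).
Proof. by move=> zP h; rewrite gcoefZ rmorphM zP -(orb_traceZ galP) !mulrA. Qed.

Lemma central_elt_sum i (I : Type) (r : seq I) (al : I -> E) (z : I -> galg F gT) :
  (forall l, central_elt i (al l) (z l)) ->
  central_elt i (\sum_(l <- r) al l) (\sum_(l <- r) z l).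
Proof.
move=> zP; elim: r => [|l r IH]; first by rewrite !big_nil; apply: central_elt0.
by rewrite !big_cons; apply: central_eltD.
Qed.

(** As L is stable under multiplication by group elements, this reduces integrality of all
    coefficients to the one at 1. *)
Lemma gcoef_mulV x y h : gcoef (x * y) h = gcoef (x * (y * galg_of F h^-1%g)) 1%g.
Proof. by rewrite mulrA galg_of_mulr mul1g invgK. Qed.

Lemma central_elt_coef1 i al z y : central_elt i al z ->
  iota (gcoef (z * y) 1%g) = tr i (al * c i * chl i y).
Proof.
move=> zP; rewrite gcoefME rmorph_sum /chi_lin mulr_sumr orb_trace_sum.
rewrite [LHS](reindex_inj invg_inj) /=; apply: eq_bigr => h _.
by rewrite rmorphM zP invgK mulg1 (mulrCA (al * c i)) (orb_traceZ galP) mulrC.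
Qed.

Lemma central_elt_central i al z y : central_elt i al z -> z * y = y * z.
Proof.
move=> zP; have zJ h g : gcoef z (g^-1 * h * g)%g = gcoef z h.
  apply: (fmorph_inj iota); rewrite !zP; congr (tr i (_ * _)).
  by rewrite !invMg invgK mulgA (irr_characterC _ _ (hchi.1 i)) mulgA mulgV mul1g.
apply: galgP => g; rewrite !gcoefME.
rewrite [LHS](reindex_inj invg_inj) [LHS](reindex_inj (mulIg g^-1%g)) /=.
apply: eq_bigr => h _; rewrite invgK mulgKV invMg invgK mulrC; congr (_ * _).
by rewrite -[LHS](zJ _ g) !mulgA mulVg mul1g.
Qed.

Lemma central_omega z : (forall y, z * y = y * z) ->
  exists om : 'I_k -> E, forall i, om i \in K i /\ forall y, chl i (z * y) = om i * chl i y.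
Proof.
move=> zC; exists (fun i => chl i z / chi i 1%g) => i; split.
  by rewrite rpred_div ?chl_mem ?chi_in_value_field.
move=> y; have [n [rho [[rhoZ trE] span schur chi1 _]]] := irr_galg_rep iota (hchi.1 i).
have /is_scalar_mxP[a zE] : is_scalar_mx (rho z).
  by apply: schur => x; rewrite !mulmxE -!rmorphM zC.
rewrite /chi_lin !trE rmorphM /= zE -mulmxE mul_scalar_mx mxtraceZ mxtrace_scalar chi1.
by rewrite -(mulr_natr a) mulfK // -chi1 chi1_neq0.
Qed.

Lemma central_coef1 z om y : (forall i y, chl i (z * y) = om i * chl i y) ->
  iota (gcoef (z * y) 1%g) = \sum_i tr i (om i * c i * chl i y).
Proof.
move=> omP; apply: (mulfI card_neq0).
rewrite -(orb_trace_regular F_char0 galP) mulr_sumr; apply: eq_bigr => i _.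
have -> : #|gT|%:R = iota #|gT|%:R by rewrite rmorph_nat.
rewrite -(orb_traceZ galP) rmorph_nat; congr (tr i _).
by rewrite -{1}chi_ratioE omP -!mulrA; congr (_ * _); rewrite mulrCA.
Qed.

(** In place of orthogonality relations, the coefficient at 1 of z * g is computed twice, from the
    definition of z and from its unknown scalars om; independence of the characters identifies the
    scalars. *)
Lemma central_elt_chl i al z : central_elt i al z -> forall i' y,
  chl i' (z * y) = (if i' == i then al else 0) * chl i' y.
Proof.
move=> zP; have [om omP] := central_omega (fun y => central_elt_central y zP).
have omE y := central_coef1 y (fun i => (omP i).2).
pose d i' := if i' == i then al else 0.
pose b i' := (om i' - d i') * c i'.
have b0 g : \sum_i' tr i' (b i' * chi i' g) = 0.
  have trB l u v : tr l (u - v) = tr l u - tr l v.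
    rewrite orb_traceD; congr (_ + _); apply/eqP.
    by rewrite -addr_eq0 -orb_traceD addNr orb_trace0.
  under eq_bigr do rewrite /b !mulrBl trB.
  rewrite sumrB; apply/eqP; rewrite subr_eq0; apply/eqP.
  under eq_bigr do rewrite -chl_of.
  rewrite -omE (central_elt_coef1 _ zP) (bigD1 i) //= /d eqxx chl_of [X in _ = _ + X]big1 ?addr0 //.
  by move=> l /negPf ->; rewrite !mul0r orb_trace0.
move=> i' y; rewrite (omP i').2; congr (_ * _); apply/eqP.
have /eqP := orb_trace_free F_char0 hchi galP b0 i'.
by rewrite mulf_eq0 (negPf (chi_ratio_neq0 i')) orbF subr_eq0.
Qed.

Lemma central_eltM i al be z w : central_elt i al z -> central_elt i be w ->
  central_elt i (al * be) (z * w).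
Proof.
move=> zP wP h; rewrite gcoef_mulV (central_elt_coef1 _ zP) (central_elt_chl wP) eqxx chl_of.
by congr (tr i _); rewrite mulrACA -!mulrA.
Qed.

Lemma central_eltX i al z n : central_elt i al z -> central_elt i (al ^+ n.+1) (z ^+ n.+1).
Proof.
move=> zP; elim: n => [|n IH]; first by rewrite !expr1.
by rewrite exprS (exprS z); apply: central_eltM.
Qed.

End CentralElements.

(** * From a relation with foreign coefficients to the unit ideal *)

Section UnitIdeal.
Variables (E : fieldType) (R : {pred E}) (I : E -> Prop).
Hypotheses (RP : subring_closed R) (IR : forall x, I x -> x \in R).
Hypotheses (I0 : I 0) (ID : forall x y, I x -> I y -> I (x + y)).
Hypothesis IM : forall a x, a \in R -> I x -> I (a * x).

Lemma ideal_sum (J : Type) (r : seq J) (f : J -> E) :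
  (forall j, I (f j)) -> I (\sum_(j <- r) f j).
Proof.
by move=> If; elim: r => [|j r IH]; rewrite ?big_nil // big_cons; apply: ID.
Qed.

Lemma ideal_prod_congr (J : Type) (r : seq J) (f g : J -> E) :
  (forall j, f j \in R) -> (forall j, g j \in R) -> (forall j, I (f j - g j)) ->
  I (\prod_(j <- r) f j - \prod_(j <- r) g j).
Proof.
have [R1 RB RM] := RP; move=> fR gR fg.
have prodR (h : J -> E) s : (forall j, h j \in R) -> \prod_(j <- s) h j \in R.
  by move=> hR; elim: s => [|j s IH]; rewrite ?big_nil // big_cons; apply: RM.
elim: r => [|j r IH]; first by rewrite !big_nil subrr.
rewrite !big_cons -(subrK (f j * \prod_(j <- r) g j) (f j * _)) -addrA -mulrBr -mulrBl.
by apply: ID; [apply: IM | rewrite mulrC; apply: IM => //; apply: prodR].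
Qed.

Lemma ideal_det_congr n (X Y : 'M[E]_n) :
  (forall i j, X i j \in R) -> (forall i j, Y i j \in R) ->
  (forall i j, I (X i j - Y i j)) -> I (\det X - \det Y).
Proof.
have [R1 RB RM] := RP; move=> XR YR XY; rewrite /determinant -sumrB.
apply: ideal_sum => s; rewrite -mulrBr; apply: IM; last exact: ideal_prod_congr.
have R0 : 0 \in R by rewrite -(subrr 1) RB.
have RN1 : -1 \in R by rewrite -sub0r RB.
by case: (odd_perm s); rewrite ?expr0 ?expr1.
Qed.

(* The vector (mu ^ l)_l is fixed by the circulant matrix with entries
   t_d / N, hence det (1 - M) = 0, and this determinant is 1 modulo I. *)
Lemma unit_ideal N (t : nat -> E) (mu : E) : (0 < N)%N -> N%:R != 0 :> E ->
  N%:R^-1 \in R -> (forall j, I (t j)) -> mu ^+ N = 1 ->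
  \sum_(j < N) mu ^+ j.+1 * t j = N%:R -> I 1.
Proof.
have [R1 RB RM] := RP.
case: N => // n _ N0 NR It muN sumE.
have R0 : 0 \in R by rewrite -(subrr 1) RB.
(* The shift by u accounts for t j being paired with the power j.+1 of mu. *)
pose u : 'I_n.+1 := inZp 1.
pose M : 'M[E]_n.+1 := \matrix_(l, l') (n.+1%:R^-1 * t (l' - l - u)%R).
pose v : 'rV[E]_n.+1 := \row_l mu ^+ l.
have vD (a b : 'I_n.+1) : mu ^+ (a + b)%R = mu ^+ a * mu ^+ b.
  by rewrite /= expr_mod // exprD.
have vM : v *m M^T = v.
  apply/rowP => l; rewrite !mxE (reindex_inj (addrI (l + u))) /=.
  have E1 (j : 'I_n.+1) : v 0 (l + u + j)%R * M^T (l + u + j)%R l =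
      n.+1%:R^-1 * mu ^+ l * (mu ^+ j.+1 * t j).
    rewrite !mxE !vD [X in t X](_ : _ = nat_of_ord j).
      by rewrite /= expr_mod // expr1 exprS; ring.
    by congr (nat_of_ord _); rewrite -addrA -opprD addrAC subrr add0r.
  under eq_bigr do rewrite E1.
  by rewrite -mulr_sumr sumE mulrAC mulVf // mul1r.
have det0 : \det (1%:M - M) = 0.
  apply/eqP; rewrite -det_tr; apply/det0P; exists v.
    apply/eqP => /rowP/(_ ord0); rewrite !mxE expr0 => /eqP.
    by rewrite oner_eq0.
  by rewrite linearB /= trmx1 mulmxBr mulmx1 vM subrr.
have IMij i j : I (M i j) by rewrite mxE; apply: IM.
have idE i j : (1%:M : 'M[E]_n.+1) i j = (i == j)%:R by rewrite mxE.
have YE i j : (1%:M - M) i j = (i == j)%:R - M i j.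
  by rewrite [LHS]mxE [X in X + _]mxE [X in _ + X]mxE.
have bR (b : bool) : b%:R \in R by case: b.
have := @ideal_det_congr _ 1%:M (1%:M - M).
rewrite det1 det0 subr0; apply=> i j.
- by rewrite idE.
- by rewrite YE; apply: RB => //; apply: IR.
by rewrite YE idE opprB addrC subrK.
Qed.

End UnitIdeal.

(** * The idempotent of the commutator subgroup *)

Section CommutatorIdempotent.
Variables (F : fieldType) (p : nat) (hF : local_field F p) (gT : finGroupType).
Local Notation A := (galg F gT).
Local Notation o := (integers hF).
Local Notation Lam := (group_ring_order o gT).
Local Notation G' := ([set: gT]%G^`(1)%g).
Local Notation Tr := (commutator_trace F gT).
Local Notation e := (commutator_idem F gT).
Implicit Types x y : A.

Lemma card_der_neq0 : #|G'|%:R != 0 :> F.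
Proof. by apply: char0_natr_neq0 hF _ _; apply: cardG_gt0. Qed.

Lemma commutator_traceE : Tr = #|G'|%:R *: e.
Proof. by rewrite scalerA mulfV ?scale1r ?card_der_neq0. Qed.

Lemma galg_of_trace h : h \in G' -> galg_of F h * Tr = Tr.
Proof.
move=> hG; rewrite mulr_sumr [RHS](reindex_inj (mulgI h)) /=.
by apply: eq_big => [g|g _]; rewrite ?groupMl // galg_ofM.
Qed.

Lemma galg_of_idem h : h \in G' -> galg_of F h * e = e.
Proof. by move=> hG; rewrite -scalerAr galg_of_trace. Qed.

Lemma galg_comm x y : (forall g, galg_of F g * y = y * galg_of F g) -> x * y = y * x.
Proof.
move=> yC; rewrite [x]galg_sumE mulr_suml mulr_sumr; apply: eq_bigr => g _.
by rewrite -scalerAl -scalerAr yC.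
Qed.

Lemma commutator_idem_central x : x * e = e * x.
Proof.
apply: galg_comm => g; rewrite -scalerAr -scalerAl; congr (_ *: _).
rewrite mulr_sumr mulr_suml (reindex_inj (conjg_inj g)) /=; apply: eq_big => [h|h _].
  by rewrite memJ_norm // (fintype.subsetP (der_norm 1 [set: gT]%G)) ?inE.
by rewrite !galg_ofM -conjgC.
Qed.

Lemma commutator_idemK : e * e = e.
Proof.
rewrite -scalerAl [Tr * e]mulr_suml (eq_bigr (fun=> e)); last exact: galg_of_idem.
by rewrite sumr_const -scaler_nat scalerA mulVf ?scale1r ?card_der_neq0.
Qed.

(** The commutator of two group elements lies in G' and is absorbed by e: F[G]e is the group algebra
    of G/G'. *)
Lemma commutator_idem_abelian x y : x * y * e = y * x * e.
Proof.
have ofC g h : galg_of F g * galg_of F h * e = galg_of F h * galg_of F g * e.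
  rewrite !galg_ofM (commgC g h) -(galg_ofM _ (h * g)) -mulrA galg_of_idem //.
  by rewrite derg1 mem_commg ?inE.
have ofC' h z : z * galg_of F h * e = galg_of F h * z * e.
  rewrite [z]galg_sumE !mulr_suml mulr_sumr mulr_suml; apply: eq_bigr => g _.
  by rewrite -(scalerAr _ (galg_of F h)) -!scalerAl ofC.
rewrite [y]galg_sumE mulr_sumr !mulr_suml; apply: eq_bigr => g _.
by rewrite -!(scalerAr _ x) -!scalerAl ofC'.
Qed.

Lemma trace_ideal_central x y : x * Tr * y = y * (x * Tr).
Proof.
have xey : x * e * y = y * (x * e).
  by rewrite -mulrA -commutator_idem_central !mulrA commutator_idem_abelian.
rewrite commutator_traceE -(scalerAr _ x) -scalerAl xey; exact: scalerAr.
Qed.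

(** An element fixed by e is constant on the cosets of G'. Keeping its coefficient at one
    representative of each coset gives y, without a division by |G'|. *)
Lemma group_ring_trace x : Lam x -> x * e = x -> exists2 y, Lam y & x = y * Tr.
Proof.
move=> xL xe.
have inv g h : h \in G' -> gcoef x (g * h)%g = gcoef x g.
  move=> hG; have {2}<- : x * galg_of F h^-1%g = x.
    by rewrite -{1}xe -mulrA -commutator_idem_central galg_of_idem ?groupV.
  by rewrite galg_of_mulr invgK.
pose rp h := repr (h *: G')%g.
have rp_mem h : (h^-1 * rp h)%g \in G'.
  by rewrite -mem_lcoset; apply: mem_repr (lcoset_refl _ _).
exists [ffun h => if rp h == h then gcoef x h else 0].
  by move=> h; rewrite /gcoef ffunE; case: eqP => _; [apply: xL | apply: rpred0].
apply: galgP => h; rewrite mulr_sumr gcoef_sum.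
have rpM g : g \in G' -> rp (h * g^-1)%g = rp h.
  by move=> gG; rewrite /rp lcosetM lcoset_id ?groupV.
have g0 : ((rp h)^-1 * h)%g \in G' by rewrite -groupV invMg invgK.
rewrite (bigD1 ((rp h)^-1 * h)%g) //= big1 ?addr0 => [|g /andP[gG gne]].
  rewrite galg_of_mulr /gcoef ffunE rpM // invMg invgK mulKVg eqxx.
  by have := inv h _ (rp_mem h); rewrite mulKVg.
rewrite galg_of_mulr /gcoef ffunE rpM //; case: eqP => // rpE.
by case/eqP: gne; rewrite rpE invMg invgK mulgKV.
Qed.

End CommutatorIdempotent.

(** * The conductor formula *)

Lemma gcoef_sum_of (R : fieldType) (gT : finGroupType) (f : gT -> R) h :
  gcoef (\sum_g f g *: galg_of R g) h = f h.
Proof.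
rewrite gcoef_sum (bigD1 h) //= gcoefZ gcoef_of eqxx mulr1 big1 ?addr0 // => g /negPf gh.
by rewrite gcoefZ gcoef_of eq_sym gh mulr0.
Qed.

Section Components.
Variables (F : fieldType) (p : nat) (hF : local_field F p).
Variables (E : closedFieldType) (iota : {rmorphism F -> E}).
Hypothesis iota_alg : is_alg_closure iota.
Variables (gT : finGroupType) (k : nat) (chi : 'I_k -> gT -> E).
Hypothesis hchi : character_representatives iota chi.
Variables (orb : irr_index E gT -> 'I_k) (gal : irr_index E gT -> {rmorphism E -> E}).
Hypothesis galP : forall j, absolute_galois iota (gal j) /\
  forall g, irr_value j g = gal j (chi (orb j) g).
Implicit Types (i : 'I_k) (x y z : galg F gT) (al be w : E).
Local Notation o := (integers hF).
Local Notation K i := (in_value_field iota (chi i)).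
Local Notation vf i := (value_field iota (chi i)).
Local Notation tr := (orb_trace orb gal).
Local Notation chl := (chi_lin iota chi).
Local Notation A := (galg F gT).
Local Notation c i := (chi_ratio chi i).
Local Notation central_elt := (central_elt iota chi orb gal).
Local Notation component i :=
  (central_image (scaled_inverse_different (iota := iota) (chi := chi i) o)).
Let F0 := lf_char0 hF.

Lemma vf_root i (q : {poly F}) (x : vf i) :
  root (map_poly (vf_incl iota (chi i)) q) x = root (map_poly iota q) (val x).
Proof.
have -> : map_poly iota q = map_poly val (map_poly (vf_incl iota (chi i)) q).
  apply/polyP => j; rewrite !coef_map coef_map_id0 //.
  by apply: val_inj; rewrite /= rmorph0.
by rewrite fmorph_root.
Qed.

Lemma vf_integersP i (x : vf i) :
  vf_integers (iota := iota) (chi := chi i) o x <-> integral_over hF iota (val x).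
Proof. by split=> -[q [qm qo qx]]; exists q; split; rewrite // ?vf_root // -vf_root. Qed.

Lemma vf_central_coef i (al : vf i) h :
  val (gcoef (vf_central al) h) = tr i (val al * c i * chi i h^-1%g).
Proof.
apply: (vf_gal_sum F0 iota_alg hchi galP (phi := fun a => val (gcoef a h))).
- by rewrite gcoef0.
- by move=> x y; rewrite gcoefD.
move=> s j oj sj; rewrite gcoefZ gcoef_sum_of.
have -> : val (s al * (vf_chi iota (chi i) 1%g / #|gT|%:R) * s (vf_chi iota (chi i) h^-1%g)) =
    val (s al) * c i * val (s (vf_chi iota (chi i) h^-1%g)).
  by rewrite /chi_ratio -lock !rmorphM fmorphV rmorph_nat.
rewrite !sj !rmorphM /=; congr (_ * _ * _).
have [n _ chi1] := irr_character1 (hchi.1 i).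
by rewrite /chi_ratio -lock chi1 fmorph_div !rmorph_nat.
Qed.

Definition in_codifferent i be := be \in K i /\
  forall w, w \in K i -> integral_over hF iota w -> exists2 a, a \in o & tr i (be * w) = iota a.

(** The factor |G|/chi_i(1) of the component cancels the inverse factor in [vf_central], so the
    coefficients of z are the traces of be * chi_i. *)
Lemma componentP i z :
  component i z <-> exists2 be, in_codifferent i be & central_elt i (be / c i) z.
Proof.
have alE (x : vf i) : val (#|gT|%:R / vf_chi iota (chi i) 1%g * x) = val x / c i.
  by rewrite /chi_ratio -lock invf_div !rmorphM fmorphV rmorph_nat mulrC.
have gcoef_map (a : A) h : val (gcoef (galg_map (vf_incl iota (chi i)) a) h) = iota (gcoef a h).
  by rewrite /gcoef ffunE.
have trE (x y : vf i) : val (vf_trace (x * y)) = tr i (val x * val y).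
  exact: (val_vf_trace F0 iota_alg hchi galP).
split=> [[_ [x xD <-] zE]|[be [beK beD] zP]].
  exists (val x); last by move=> h; rewrite -gcoef_map zE vf_central_coef alE.
  split=> [|w wK wint]; first exact: valP.
  have [|a ao aE] := xD (Sub w wK : vf i); first by apply/vf_integersP; rewrite SubK.
  by exists a; rewrite // -[iota a]/(val (vf_incl iota (chi i) a)) -aE trE SubK.
exists (#|gT|%:R / vf_chi iota (chi i) 1%g * Sub be beK).
  exists (Sub be beK) => // y /vf_integersP yint.
  have [a ao aE] := beD _ (valP y) yint; exists a => //.
  by apply: val_inj; rewrite trE SubK aE.
apply: galgP => h; apply: val_inj.
by rewrite gcoef_map vf_central_coef alE SubK zP.
Qed.

Variables (L : set A) (maxL : is_maximal_order o L) (LamL : group_ring_order o gT `<=` L).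
Local Notation Lam := (group_ring_order o gT).
Local Notation con := (central_conductor L Lam).
Local Notation e := (commutator_idem F gT).
Let hL := galg_max_local_order maxL LamL.

Lemma order_galg_of g : L (galg_of F g).
Proof. by apply: LamL => h; rewrite gcoef_of; case: eqP; rewrite ?rpred0 ?rpred1. Qed.

Lemma order_mul x y : L x -> L y -> L (x * y).
Proof. by have [_ _ LM] := mlo_ring hL; apply: LM. Qed.

Lemma conductorP z : con z <->
  (forall y, z * y = y * z) /\ forall y, L y -> gcoef (z * y) 1%g \in o.
Proof.
split=> [[[Lz zC] zL]|[zC zo]].
  split=> [y|y Ly]; last exact: zL.
  by apply/esym/galg_comm => g; rewrite zC //; apply: order_galg_of.
have zL y : L y -> Lam (z * y).
  by move=> Ly h; rewrite gcoef_mulV; apply/zo/order_mul => //; apply: order_galg_of.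
split; last exact: zL.
split=> [|y _]; last exact: zC.
by apply: LamL; rewrite -[z]mulr1; apply: zL; have [] := mlo_ring hL.
Qed.

Lemma central_integral_mem z n (a : 'I_n -> F) : (forall y, z * y = y * z) ->
  (forall l, a l \in o) -> z ^+ n = \sum_l a l *: z ^+ l -> L z.
Proof. exact: (mlo_integral_central hL). Qed.

Lemma idem_mem : L e.
Proof.
apply: (@central_integral_mem _ 2 (fun l => (l == 1%N :> nat)%:R)).
- by move=> y; rewrite commutator_idem_central.
- by move=> l; rewrite rpred_nat.
rewrite big_ord_recl big_ord1 /= scale0r add0r scale1r expr1.
exact: (commutator_idemK hF).
Qed.

Lemma central_elt_integral i al z : al \in K i -> integral_over hF iota al ->
  central_elt i al z -> L z.
Proof.
move=> alK [q [q_monic qo qal]] zP; set d := (size q).-1.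
have szq : size q = d.+1 by rewrite prednK // size_poly_gt0 monic_neq0.
(* The equation of al is multiplied by al first: positive powers of z correspond to those of al, but
   the unit of F[G] is not supported on the single component i. *)
have q0 : \sum_(j < d.+1) q`_j *: z ^+ j.+1 = 0.
  apply: (central_elt_inj (i := i) (al := \sum_(j < d.+1) iota q`_j * al ^+ j.+1)).
    apply: central_elt_sum => j; apply: (central_eltZ galP).
    exact: (central_eltX F0 hchi galP).
  have -> : \sum_(j < d.+1) iota q`_j * al ^+ j.+1 = 0; last exact: central_elt0.
  have := rootP qal; rewrite horner_coef size_map_poly szq => /(congr1 ( *%R al)).
  rewrite mulr0 mulr_sumr; apply: etrans.
  by apply: eq_bigr => j _; rewrite coef_map exprS mulrCA.
apply: (@central_integral_mem _ d.+1 (fun j => if j : nat is j'.+1 then - q`_j' else 0)).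
- by move=> y; apply: central_elt_central zP.
- by case=> [[|j] jd]; rewrite ?rpred0 // rpredN; apply: (polyOverP qo).
have qd : q`_d = 1 by rewrite -[q`_d]/(lead_coef q) (monicP q_monic).
move: q0; rewrite big_ord_recr /= qd scale1r => /eqP; rewrite addrC addr_eq0 => /eqP ->.
rewrite big_ord_recl scale0r add0r -sumrN; apply: eq_bigr => j _.
by rewrite scaleNr.
Qed.

Lemma chl_integral i y : L y -> integral_over hF iota (chl i y).
Proof.
move=> Ly; have [n [rho [[rhoZ trE] _ _ _ _]]] := irr_galg_rep iota (hchi.1 i).
by rewrite /chi_lin trE; apply: (integral_trace hL rhoZ).
Qed.


(** The integral u in F_i for which all traces of om c_i w u, with w integral in F_i, lie in o form
    an ideal I, and the claim is that 1 lies in I. It contains chi_i(y) for y in L, since w is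
    realized by a central element of L; [trace_unit] provides the relation that [unit_ideal]
    needs. *)
Lemma codifferent_of_conductor i z om : con z -> om \in K i ->
  (forall y, chl i (z * y) = om * chl i y) -> in_codifferent i (om * c i).
Proof.
move=> /conductorP[zC zo] omK omP.
have [om' om'P] := central_omega F0 hchi zC.
have om'E : om' i = om.
  apply: (mulIf (chi1_neq0 F0 hchi i)); rewrite -(chl_of iota).
  by rewrite -(om'P i).2 omP.
have beK : om * c i \in K i by rewrite rpredM ?chi_ratio_mem.
pose R w := (w \in K i) /\ integral_over hF iota w.
pose Rp : {pred E} := fun w => `[< R w >].
have RpP w : (w \in Rp) <-> R w by split=> [/asboolP|/asboolP].
have [i1 iB iM] := integral_over_subring hF iota.
have Rring : subring_closed Rp.
  split=> [|x y /RpP[xK xi] /RpP[yK yi]|x y /RpP[xK xi] /RpP[yK yi]]; apply/RpP.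
  - by split; [rewrite rpred1 | apply/asboolP].
  - by split; [rewrite rpredB | apply/asboolP/iB; apply/asboolP].
  - by split; [rewrite rpredM | apply/asboolP/iM; apply/asboolP].
pose I (u : E) := R u /\
  forall w, R w -> exists2 a, a \in o & tr i (om * c i * w * u) = iota a.
have Rchl y : L y -> R (chl i y).
  by move=> Ly; split; [apply: chl_mem | apply: chl_integral].
have Ichl y : L y -> I (chl i y).
  move=> Ly; split=> [|w [wK wint]]; first exact: Rchl.
  have [wz wzP] := central_elt_exists F0 iota_alg hchi galP wK.
  have Lwz := central_elt_integral wK wint wzP.
  exists (gcoef (z * (wz * y)) 1%g); first by apply: zo; apply: order_mul.
  rewrite (central_coef1 F0 galP _ (fun i => (om'P i).2)) (bigD1 i) //=.
  rewrite [X in _ = _ + X]big1 ?addr0 => [|l li].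
    by rewrite (central_elt_chl F0 hchi galP wzP) eqxx om'E !mulrA.
  by rewrite (central_elt_chl F0 hchi galP wzP) (negPf li) mul0r mulr0 orb_trace0.
have I1 : I 1.
  have [n [rho [[rhoZ trE] span _ _ _]]] := irr_galg_rep iota (hchi.1 i).
  have [N [T [mu [No N0 LT muN sumE]]]] := trace_unit iota hL span.
  have NE : N%:R != 0 :> E.
    by rewrite -(rmorph_nat iota) fmorph_eq0 (char0_natr_neq0 hF).
  apply: (@unit_ideal E Rp I Rring _ _ _ _ N (fun j => chl i (T ^+ j.+1)) mu) => //.
  - by move=> x [xR _]; apply/RpP.
  - split; first by apply/RpP; have [r1 rB _] := Rring; rewrite -(subrr 1) rB.
    by move=> w _; exists 0; rewrite ?rpred0 // mulr0 orb_trace0 rmorph0.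
  - move=> x y [xR xI] [yR yI]; split.
      have [r1 rB _] := Rring; apply/RpP; rewrite -[y]opprK -[- y]sub0r.
      rewrite rB //; first exact/RpP.
      by rewrite rB //; [rewrite -(subrr 1) rB | apply/RpP].
    move=> w wR; have [a ao aE] := xI w wR; have [b bo bE] := yI w wR.
    by exists (a + b); rewrite ?rpredD // mulrDr orb_traceD aE bE rmorphD.
  - move=> a x /RpP aR [xR xI]; split.
      by have [_ _ rM] := Rring; apply/RpP/rM; apply/RpP.
    move=> w wR; rewrite mulrA -(mulrA _ w a); apply: xI.
    by have [_ _ rM] := Rring; apply/RpP/rM; apply/RpP.
  - apply/RpP; rewrite -(rmorph_nat iota) -fmorphV; split.
      exact: iota_in_value_field.
    exact: integral_over_base.
  - move=> j; apply: Ichl; elim: j => [|j IH]; first by rewrite expr1.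
    by rewrite exprS; apply: order_mul.
  - by rewrite -sumE; apply: eq_bigr => j _; rewrite /chi_lin trE.
split=> // w wK wint; have [a ao aE] := I1.2 w (conj wK wint).
by exists a; rewrite // -aE mulr1.
Qed.

Lemma chl_idem_linear i : chi i 1%g = 1 -> chl i e = 1.
Proof.
move=> chi1; have [n [rho [[rhoZ trE] _ _ rho1 der]]] := irr_galg_rep iota (hchi.1 i).
have n0 : n = 0%N.
  apply/eqP; rewrite -((pcharf0P E).1 (E_char0 iota F0)).
  by rewrite -(addrK 1 n%:R) natr1 -rho1 chi1 subrr.
have rhoe : rho e = 1.
  rewrite rhoZ rmorph_sum (eq_bigr (fun=> 1)) => [|h hG]; last exact: der.1.
  rewrite sumr_const -scaler_nat scalerA -(rmorph_nat iota) -rmorphM.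
  by rewrite mulVf ?rmorph1 ?scale1r ?(card_der_neq0 hF).
by rewrite /chi_lin trE rhoe -[1]/(1%:M) mxtrace1 -rho1 chi1.
Qed.

(** By Schur's lemma rho e is a scalar a. If a != 0, then h * e = e forces rho h = 1 for every h in
    G', and the degree is one. *)
Lemma chl_idem_nonlinear i y : chi i 1%g != 1 -> chl i (e * y) = 0.
Proof.
move=> chi1; have [n [rho [[rhoZ trE] _ schur rho1 der]]] := irr_galg_rep iota (hchi.1 i).
rewrite /chi_lin trE rmorphM.
have /is_scalar_mxP[a aE] : is_scalar_mx (rho e).
  by apply: schur => x; rewrite !mulmxE -!rmorphM commutator_idem_central.
have [a0|a0] := eqVneq a 0; first by rewrite aE a0 raddf0 mul0r mxtrace0.
case/eqP: chi1; rewrite rho1.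
suff -> : n = 0%N by [].
apply/der => h hG; have : rho (galg_of F h) * rho e = rho e.
  by rewrite -rmorphM galg_of_idem.
rewrite aE -mulmxE mul_mx_scalar => /(congr1 ( *:%R a^-1)).
by rewrite scalerA mulVf // scale1r scale_scalar_mx mulVf.
Qed.

Local Notation nonlinear := (fun i => chi i 1%g != 1).

Lemma component_conductor i z : chi i 1%g != 1 -> component i z -> con z /\ z * e = 0.
Proof.
move=> chi1 /componentP[be [beK beD] zP].
have c0 := chi_ratio_neq0 F0 hchi i.
split; last first.
  apply: galgP => h; apply: (fmorph_inj iota).
  rewrite gcoef_mulV (central_elt_coef1 galP _ zP) chl_idem_nonlinear // mulr0.
  by rewrite orb_trace0 gcoef0 rmorph0.
apply/conductorP; split=> [y|y Ly]; first exact: (central_elt_central hchi _ zP).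
have [a ao aE] := beD _ (chl_mem iota chi i y) (chl_integral i Ly).
suff -> : gcoef (z * y) 1%g = a by [].
by apply: (fmorph_inj iota); rewrite (central_elt_coef1 galP _ zP) divfK.
Qed.

Lemma con_add x y : con x -> con y -> con (x + y).
Proof.
move=> /conductorP[xC xo] /conductorP[yC yo]; apply/conductorP; split=> [z|z Lz].
  by rewrite mulrDl mulrDr xC yC.
by rewrite mulrDl gcoefD rpredD ?xo ?yo.
Qed.

Lemma con0 : con 0.
Proof.
by apply/conductorP; split=> [y|y _]; rewrite ?mul0r ?mulr0 // gcoef0 rpred0.
Qed.

(** The condition z * e = 0 expresses that the scalars of z at the linear characters vanish, because
    e acts as 1 there and as 0 elsewhere. *)
Lemma set_sum_component z :
  set_sum nonlinear (fun i => component i) z <-> con z /\ z * e = 0.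
Proof.
split=> [[x xP ->]|[conz ze]].
  elim/big_ind: _ => [|a b [ca ae] [cb be]|i chi1].
  - by split; [exact: con0 | rewrite mul0r].
  - by split; [exact: con_add | rewrite mulrDl ae be addr0].
  exact: component_conductor (xP i chi1).
have /conductorP[zC zo] := conz.
have [om omP] := central_omega F0 hchi zC.
have /choice[x xP] : forall i, exists x, central_elt i (om i) x.
  by move=> i; apply: (central_elt_exists F0 iota_alg hchi galP); case: (omP i).
have lin0 i : chi i 1%g = 1 -> om i = 0.
  move=> chi1; have := (omP i).2 e; rewrite ze chl_idem_linear // mulr1 => <-.
  by rewrite /chi_lin big1 // => g _; rewrite gcoef0 rmorph0 mul0r.
exists x => [i chi1|].
  apply/componentP; exists (om i * c i); last by rewrite mulfK ?(chi_ratio_neq0 F0 hchi).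
  by apply: codifferent_of_conductor conz _ _; case: (omP i).
apply: galgP => h; apply: (fmorph_inj iota).
rewrite gcoef_sum rmorph_sum -[z]mulr1 gcoef_mulV mul1r.
rewrite (central_coef1 F0 galP _ (fun i => (omP i).2)) [RHS]big_mkcond /=.
apply: eq_bigr => i _; rewrite chl_of; case: eqP => [chi1|_] /=; last by rewrite xP.
by rewrite lin0 // !mul0r orb_trace0.
Qed.

Lemma direct_sum_component : direct_sum nonlinear (fun i => component i).
Proof.
move=> x xP sum0.
have /choice[be beP] : forall i, exists be, chi i 1%g != 1 -> central_elt i be (x i).
  move=> i; have [chi1|/eqP chi1] := pselect (chi i 1%g = 1).
    by exists 0; rewrite chi1 eqxx.
  by have /componentP[be _ zP] := xP i chi1; exists (be / c i).
pose b i := if chi i 1%g != 1 then be i * c i else 0.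
have b0 g : \sum_i tr i (b i * chi i g) = 0.
  have := congr1 (fun y => iota (gcoef y g^-1%g)) sum0.
  rewrite gcoef_sum gcoef0 rmorph0 rmorph_sum big_mkcond /=; apply: etrans.
  apply: eq_bigr => l _; rewrite /b; case: ifP => chil; first by rewrite (beP l chil) invgK.
  by rewrite mul0r orb_trace0.
move=> i chi1; apply: (central_elt_inj (beP i chi1)).
have -> : be i = 0; last exact: central_elt0.
have /eqP := orb_trace_free F0 hchi galP b0 i.
by rewrite /b chi1 mulf_eq0 (negPf (chi_ratio_neq0 F0 hchi i)) orbF => /eqP.
Qed.

End Components.

Lemma group_ring_orderM (F : fieldType) (p : nat) (hF : local_field F p) (gT : finGroupType)
    (x y : galg F gT) :
  group_ring_order (integers hF) gT x -> group_ring_order (integers hF) gT y ->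
  group_ring_order (integers hF) gT (x * y).
Proof. by move=> xo yo g; rewrite gcoefME; apply: rpred_sum => h _; apply: rpredM. Qed.

Lemma mixed_mul (R : nzRingType) (e t a b c l : R) :
  e * e = e -> (forall x, x * e = e * x) -> t * e = t -> (forall x, t * x = x * t) ->
  (a * t + c * (1 - e)) * (b * e + l * (1 - e)) = a * b * t + c * (l * (1 - e)).
Proof.
move=> ee eC te tC; set E := 1 - e.
have EC x : x * E = E * x by rewrite mulrBl mulrBr mul1r mulr1 eC.
have tE : t * E = 0 by rewrite mulrBr mulr1 te subrr.
have Ee : E * e = 0 by rewrite mulrBl mul1r ee subrr.
have EE : E * E = E by rewrite {2}/E mulrBr mulr1 Ee subr0.
rewrite mulrDr !mulrDl -!mulrA; congr (_ + _).
  by rewrite (eC b) (mulrA E) Ee mul0r mulr0 addr0 -(eC b) (mulrA t b) tC -mulrA te.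
by rewrite EC (mulrA t) tE mul0r mulr0 add0r (mulrA E) EE.
Qed.

Lemma galois_data_exists (F : fieldType) (E : closedFieldType) (iota : {rmorphism F -> E})
    (gT : finGroupType) (k : nat) (chi : 'I_k -> gT -> E) :
  character_representatives iota chi ->
  exists (orb : irr_index E gT -> 'I_k) (gal : irr_index E gT -> {rmorphism E -> E}),
    forall j, absolute_galois iota (gal j) /\
      forall g, irr_value j g = gal j (chi (orb j) g).
Proof.
move=> hchi; have /choice[f fP] : forall j : irr_index E gT,
    exists it : 'I_k * {rmorphism E -> E}, absolute_galois iota it.2 /\
      forall g, irr_value j g = it.2 (chi it.1 g).
  move=> j; have [i [[t galt jt] _]] := hchi.2 _ (irr_valueP j).
  by exists (i, t).
by exists (fun j => (f j).1), (fun j => (f j).2).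
Qed.

Theorem proposition6p17 (F : fieldType) (p : nat) (hF : local_field F p)
    (gT : finGroupType)
    (Lam' : set (galg F gT))
    (hLam' : is_maximal_order (integers hF) Lam')
    (hLam : group_ring_order (integers hF) gT `<=` Lam')
    (Fbar : closedFieldType) (iota : {rmorphism F -> Fbar})
    (hFbar : is_alg_closure iota)
    (k : nat) (chi : 'I_k -> gT -> Fbar)
    (hchi : character_representatives iota chi) :
  let o := integers hF in
  let Lam := group_ring_order o gT in
  let TrG' := commutator_trace F gT in
  let e := commutator_idem F gT in
  let nonlinear := fun i : 'I_k => chi i 1%g != 1 in
  let component := fun i : 'I_k =>
    central_image (scaled_inverse_different (iota := iota) (chi := chi i) o) in
  [/\ central_conductor (mixed_order o Lam') Lam =
        set_add (set_mulr Lam TrG')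
                (set_mulr (central_conductor Lam' Lam) (1 - e)),
      direct_add (set_mulr Lam TrG')
                 (set_mulr (central_conductor Lam' Lam) (1 - e)),
      central_conductor (mixed_order o Lam') Lam =
        set_add (set_mulr Lam TrG') (set_sum nonlinear component),
      direct_add (set_mulr Lam TrG') (set_sum nonlinear component) &
      direct_sum nonlinear component].
Proof.
move=> o Lam TrG' e nonlinear component.
have [orb [gal galP]] := galois_data_exists hchi.
have conP := conductorP hLam' hLam.
have ee : e * e = e := commutator_idemK hF gT.
have eC x : x * e = e * x := commutator_idem_central x.
have eL : Lam' e := idem_mem hLam' hLam.
have TrE : TrG' = #|[set: gT]%G^`(1)%g|%:R *: e := commutator_traceE hF gT.
have [L1 LB LM] : is_subring Lam' by case: hLam' => [[]].
have L1e : Lam' (1 - e) by apply: LB.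
have Tre : TrG' * e = TrG' by rewrite TrE -scalerAl ee.
have e1e : e * (1 - e) = 0 by rewrite mulrBr mulr1 ee subrr.
have e1K : (1 - e) * e = 0 by rewrite mulrBl mul1r ee subrr.
have e11 : (1 - e) * (1 - e) = 1 - e by rewrite mulrBr mulr1 e1K subr0.
have e1C x : x * (1 - e) = (1 - e) * x by rewrite mulrBl mulrBr mul1r mulr1 eC.
have Lam1 : Lam 1 by move=> g; rewrite gcoef_of; case: eqP => _; rewrite ?rpred0 ?rpred1.
have Lam0 : Lam 0 by move=> g; rewrite gcoef0 rpred0.
have LamZ n x : Lam x -> Lam (n%:R *: x).
  by move=> xo g; rewrite gcoefZ rpredM ?rpred_nat.
have LamTr : Lam TrG'.
  move=> g; rewrite /TrG' /commutator_trace gcoef_sum; apply: rpred_sum => h _.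
  by rewrite gcoef_of rpred_nat.
(* As 1 - e is central and lies in [Lam'], it preserves the conductor, and its multiples there are
   the elements killed by e. *)
have con_e1 : set_mulr (central_conductor Lam' Lam) (1 - e) = set_sum nonlinear component.
  apply/seteqP; split=> z.
    move=> [c /conP[cC co] <-]; apply/(set_sum_component hFbar hchi galP hLam' hLam).
    split; last by rewrite -mulrA e1K mulr0.
    apply/conP; split=> [y|y Ly]; first by rewrite -mulrA -e1C mulrA cC mulrA.
    by rewrite -mulrA; apply/co/LM.
  move=> /(set_sum_component hFbar hchi galP hLam' hLam)[cz ze].
  by exists z; rewrite // mulrBr mulr1 ze subr0.
have dir X : (forall b, X b -> b * e = 0) -> direct_add (set_mulr Lam TrG') X.
  move=> Xe _ b [a _ <-] /Xe be ab0.
  have a0 : a * TrG' = 0.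
    by have := congr1 (fun y => y * e) ab0; rewrite mulrDl be addr0 mul0r -mulrA Tre.
  by rewrite a0 add0r in ab0.
have dir1 : direct_add (set_mulr Lam TrG') (set_mulr (central_conductor Lam' Lam) (1 - e)).
  by apply: dir => _ [c _ <-]; rewrite -mulrA e1K mulr0.
have eq1 : central_conductor (mixed_order o Lam') Lam =
    set_add (set_mulr Lam TrG') (set_mulr (central_conductor Lam' Lam) (1 - e)).
  apply/seteqP; split=> [x [[Mx xC] xM]|_ [_ [a aL <-]] [_ [c /conP[cC co] <-]] <-].
    have M1 l : Lam' l -> mixed_order o Lam' (l * (1 - e)).
      move=> Ll; exists (0 * e); first by exists 0.
      by exists (l * (1 - e)); [exists l | rewrite mul0r add0r].
    have Me : mixed_order o Lam' e.
      exists (1 * e); first by exists 1.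
      exists (0 * (1 - e)); last by rewrite mul1r mul0r addr0.
      by exists 0 => //; rewrite -(subrr 1); apply: LB.
    (* The mixed order contains e, so x * e lies in o[G] and is fixed by e. *)
    have [y yL xeE] := group_ring_trace (xM _ Me) (etrans (esym (mulrA x e e)) (congr1 _ ee)).
    exists (y * TrG'); first by exists y.
    exists (x * (1 - e)); last by rewrite -xeE -mulrDr addrC subrK mulr1.
    exists (x * (1 - e)); last by rewrite -mulrA e11.
    apply/conP; split=> [y'|y' Ly'].
      (* Commutation of x is only known with the mixed order, which contains g * (1 - e) but need
         not be assumed to contain g. *)
      apply/esym/galg_comm => g.
      have Lg := order_galg_of hLam g.
      by rewrite -[RHS]mulrA -(e1C (galg_of F g)) (xC _ (M1 _ Lg)) -mulrA -(e1C x).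
    by rewrite -mulrA -e1C; apply/xM/M1.
  have aTC y : a * TrG' * y = y * (a * TrG') := trace_ideal_central hF a y.
  have wC y : (a * TrG' + c * (1 - e)) * y = y * (a * TrG' + c * (1 - e)).
    by rewrite (mulrDl (a * TrG')) (mulrDr y) aTC; congr (_ + _);
      rewrite -mulrA -e1C mulrA cC mulrA.
  split.
    split=> [|y _]; last exact: wC.
    exists (a * TrG').
      exists (#|[set: gT]%G^`(1)%g|%:R *: a); first exact: LamZ.
      by rewrite TrE -scalerAl; apply: scalerAr.
    exists (c * (1 - e)) => //; exists c => //.
    by apply: (hLam) => g; rewrite -[c]mulr1 gcoef_mulV mul1r; apply/co/(order_galg_of hLam).
  move=> _ [_ [b bL <-] [_ [l Ll <-]] <-].
  have -> : (a * TrG' + c * (1 - e)) * (b * e + l * (1 - e)) =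
      a * b * TrG' + c * (l * (1 - e)).
    apply: mixed_mul => // y; have := trace_ideal_central hF 1 y.
    by rewrite mul1r.
  move=> g; rewrite gcoefD; apply: rpredD.
    by apply: group_ring_orderM => //; apply: group_ring_orderM.
  rewrite gcoef_mulV; apply: co; apply: (LM); first exact: LM.
  exact: (order_galg_of hLam).
split=> //; rewrite -?con_e1 //.
exact: (direct_sum_component hFbar hchi galP).
Qed.
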